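(* Let $(X_1,Y_1),\dots,(X_n,Y_n)$ be i.i.d. copies of $(X,Y)$ with joint distribution $\mathbb{P}$, and consider the Kullback-Leibler case $\varphi_1(x)=x\log x-x+1$ with the model $$h_\theta(x,y)=\exp\Big(\alpha+\sum_{k=1}^d\beta_k\,\xi_k(x)\,\zeta_k(y)\Big),\qquad \theta=(\alpha,\beta_1,\dots,\beta_d)^\top\in\Theta\subset\mathbb{R}\times\mathbb{R}^d,$$ for specified measurable real-valued functions $\xi_k$ on $\mathcal{X}$ and $\zeta_k$ on $\mathcal{Y}$. Assume that $X$ and $Y$ are independent, i.e. $\mathbb{P}=\mathbb{P}^\perp$, equivalently $\theta_T=\boldsymbol{0}:=(0,\dots,0)^\top\in\mathbb{R}^{1+d}$. With $f_\theta,g_\theta,\widehat\theta_{\varphi_1},\widehat I_{\varphi_1},\Sigma_1,\Sigma_2$ as defined in the context, assume: (i) if $h_\theta(x,y)=h_{\theta'}(x,y)$ for all $(x,y)\in\mathcal{X}\times\mathcal{Y}$, then $\theta=\theta'$; (ii) $\theta_0=\boldsymbol{0}$, the unique value such that $h_{\theta_0}(x,y)=1$ for all $(x,y)$, belongs to the interior of $\Theta$; (iii) $\Theta$ is a compact subset of $\mathbb{R}\times\mathbb{R}^d$; (iv) $\int\sup_{\theta\in\Theta}|f_\theta|\,d\mathbb{P}<\infty$; (v) $\int\sup_{\theta\in\Theta}g_\theta^2\,d\mathbb{P}^\perp<\infty$; (vi) there is a neighborhood $N(\theta_T)$ of $\theta_T$ such that the third-order partial derivatives in $\theta$ of $f_\theta(x,y)$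 (resp. of $g_\theta(x,y)$), for $\theta\in N(\theta_T)$, are dominated by some $\mathbb{P}$-integrable functions (resp. some $\mathbb{P}^\perp$-square-integrable functions) of $(x,y)$; (vii) the integrals $\int\|f'_{\theta_T}\|^2d\mathbb{P}$, $\int\|g'_{\theta_T}\|^2d\mathbb{P}^\perp$, $\int\|f''_{\theta_T}\|d\mathbb{P}$ and $\int\|g''_{\theta_T}\|^2d\mathbb{P}^\perp$ exist (are finite), and the matrix $\Sigma_1$ is nonsingular. Then, as $n\to\infty$: (a) $\sqrt n\,\widehat\theta_{\varphi_1}$ converges in distribution to a centered multivariate normal random variable with covariance matrix $\Sigma_1^{-1}\Sigma_2\Sigma_1^{-1}$; (b) $2n\,\widehat I_{\varphi_1}$ converges in distribution to the random variable $Z^\top Z$, where $Z$ is a centered multivariate normal random variable with covariance matrix $C=\Sigma_1^{-1/2}\Sigma_2\Sigma_1^{-1/2}$.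
   Context: For a probability distribution $P$ on the product measurable space $\mathcal{X}\times\mathcal{Y}$ with margins $P_1,P_2$, $P^\perp:=P_1\otimes P_2$. The model consists of the functions $$h_\theta(x,y)=\exp\Big(\alpha+\sum_{k=1}^d\beta_k\,\xi_k(x)\,\zeta_k(y)\Big),\qquad \theta=(\alpha,\beta_1,\dots,\beta_d)^\top\in\Theta\subset\mathbb{R}\times\mathbb{R}^d,$$ where $\xi_k$ on $\mathcal{X}$ and $\zeta_k$ on $\mathcal{Y}$, $k=1,\dots,d$, are specified measurable real-valued functions. The law $\mathbb{P}$ of $(X,Y)$ has margins $\mathbb{P}_1,\mathbb{P}_2$ and belongs to the model: $\theta_T$ is the unique $\theta\in\Theta$ with $d\mathbb{P}/d\mathbb{P}^\perp=h_\theta$, and it is an interior point of $\Theta$. For $\varphi_1(x)=x\log x-x+1$ and $h_\theta(x,y)=\exp\big(\alpha+\sum_{k=1}^d\beta_k\xi_k(x)\zeta_k(y)\big)$, the general definitions $f_\theta:=\varphi_1'(h_\theta)$ and $g_\theta:=\varphi_1^*(\varphi_1'(h_\theta))$ (where $\varphi_1^*(t)=e^t-1$ is the convex conjugate) become $$f_\theta(x,y)=\alpha+\sum_{k=1}^d\beta_k\xi_k(x)\zeta_k(y),\qquad g_\theta(x,y)=\exp\Big(\alpha+\sum_{k=1}^d\beta_k\xi_k(x)\zeta_k(y)\Big)-1 .$$ Primes denote gradients, and double primes Hessian matrices, with respect to $\theta$. **Estimators.** With $$M_n(\theta):=\frac1n\sum_{i=1}^nf_\theta(X_i,Y_i)-\frac1{n^2}\sum_{i=1}^n\sum_{j=1}^ng_\theta(X_i,Y_j),$$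 set $\widehat I_{\varphi_1}:=\sup_{\theta\in\Theta}M_n(\theta)$ and $\widehat\theta_{\varphi_1}:=\arg\sup_{\theta\in\Theta}M_n(\theta)$ (a maximizer). $\widehat I_{\varphi_1}$ estimates the Kullback-Leibler mutual information $\int\log\frac{d\mathbb{P}}{d\mathbb{P}^\perp}\,d\mathbb{P}$. **Matrices.** $$\Sigma_1:=-\Big(\int f''_{\theta_T}\,d\mathbb{P}-\int g''_{\theta_T}\,d\mathbb{P}^\perp\Big)$$ (a $(1+d)\times(1+d)$ matrix). Let $$V(X,Y):=\big(1,\xi_1(X),\dots,\xi_d(X),\zeta_1(Y),\dots,\zeta_d(Y),\xi_1(X)\zeta_1(Y),\dots,\xi_d(X)\zeta_d(Y)\big)^\top\in\mathbb{R}^{1+3d},$$ $\mu:=\mathbb{E}(V(X,Y))$, $\Sigma_V:=\mathbb{E}\big((V(X,Y)-\mu)(V(X,Y)-\mu)^\top\big)$, and let $\psi:\mathbb{R}^{1+3d}\to\mathbb{R}^{1+d}$ be $$\psi(x_0,x_1,\dots,x_d,y_1,\dots,y_d,z_1,\dots,z_d)=(0,x_1y_1-z_1,\dots,x_dy_d-z_d)^\top .$$ Then $\Sigma_2:=\psi'(\mu)\,\Sigma_V\,\psi'(\mu)^\top$, where $\psi'(\mu)$ is the Jacobian matrix of $\psi$ at $\mu$. *)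

(* Defs.v *)
From HB Require Import structures.
From mathcomp Require Import all_boot all_order all_algebra finmap.
From mathcomp Require Import all_classical all_reals all_analysis.
From mathcomp Require Import ring lra.

Set Implicit Arguments.
Unset Strict Implicit.
Unset Printing Implicit Defensive.

Import Order.TTheory GRing.Theory Num.Theory.
Import numFieldNormedType.Exports.

Local Open Scope classical_set_scope.
Local Open Scope ring_scope.

Section calculus.
Context {R : realType} {n : nat}.
Implicit Types (F : 'cV[R]_n -> R) (t : 'cV[R]_n).

Definition partial (i : 'I_n) F t : R := 'D_(delta_mx i 0) F t.

Definition gradient F t : 'cV[R]_n := \col_i partial i F t.

Definition hessian F t : 'M[R]_n := \matrix_(i, j) partial i (partial j F) t.

(* The usual m x n matrix of partial derivatives; the library's ['J f p] is its
   transpose, and is only available for row vectors. *)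
Definition jacobian_mx {m} (G : 'cV[R]_n -> 'cV[R]_m) t : 'M[R]_(m, n) :=
  \matrix_(i, j) partial j (fun v => G v i 0) t.

End calculus.

(* Euclidean norm of a vector, Frobenius norm of a matrix; the canonical
   norm [`|A|] of the library is the max norm. *)
Definition frobenius {R : realType} {m n} (A : 'M[R]_(m, n)) : R :=
  Num.sqrt (\sum_i \sum_j A i j ^+ 2).

Definition psdmx {R : realType} {n} (A : 'M[R]_n) : Prop :=
  A^T = A /\ forall u : 'cV[R]_n, 0 <= (u^T *m A *m u) 0 0.

(* The symmetric positive semidefinite square root; 0 if there is none. *)
Definition sqrtmx {R : realType} {n} (A : 'M[R]_n) : 'M[R]_n :=
  xget 0 [set S | psdmx S /\ S *m S = A].

(* Measurability for the Borel sigma-algebra of R^n, coordinate by coordinate. *)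
Definition random_vector {d} {T : measurableType d} {R : realType} {n}
    (Z : T -> 'cV[R]_n) : Prop :=
  forall i, measurable_fun [set: T] (fun w => Z w i 0).

(* The normal distribution N(m, v) on R with mean m and variance v >= 0. The
   library's [normal_prob m s] has standard deviation s, and is the Lebesgue
   measure on [0, 1] for s = 0. *)
Definition normal_law {R : realType} (m v : R) (A : set R) : \bar R :=
  if v == 0 then \d_m A else normal_prob m (Num.sqrt v) A.

(* Possibly degenerate: all linear combinations of coordinates are normal. *)
Definition multivariate_normal {d} {T : measurableType d} {R : realType}
    (P : probability T R) {n} (Z : T -> 'cV[R]_n)
    (m : 'cV[R]_n) (C : 'M[R]_n) : Prop :=
  [/\ random_vector Z, psdmx C &
      forall (u : 'cV[R]_n) (A : set R), measurable A ->
        P [set w | A ((u^T *m Z w) 0 0)] =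
        normal_law ((u^T *m m) 0 0) ((u^T *m C *m u) 0 0) A].

Definition cvg_in_distribution {R : realType} {V : topologicalType}
    {d} {T : measurableType d} (P : probability T R) (U : nat -> T -> V)
    {d'} {T' : measurableType d'} (P' : probability T' R) (Z : T' -> V) : Prop :=
  forall g : V -> R, continuous g -> (exists M, forall v, `|g v| <= M) ->
    ('E_P[g \o U n] @[n --> \oo] --> 'E_P'[g \o Z])%E.

Definition mutually_independent {R : realType} {d} {T : measurableType d}
    (P : probability T R) {d'} {T' : measurableType d'}
    (W : nat -> T -> T') : Prop :=
  forall (J : {fset nat}) (B : nat -> set T'),
    (forall i, measurable (B i)) ->
    P (\bigcap_(i in [set` J]) W i @^-1` B i) =
    (\prod_(i <- J) P (W i @^-1` B i))%E.

Definition iid {R : realType} {d} {T : measurableType d}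
    (P : probability T R) {d'} {T' : measurableType d'}
    (W : nat -> T -> T') (Q : probability T' R) : Prop :=
  [/\ forall i, measurable_fun [set: T] (W i),
      forall i A, measurable A -> P (W i @^-1` A) = Q A
    & mutually_independent P W].

HB.instance Definition _ {dX dY} {TX : measurableType dX}
    {TY : measurableType dY} :=
  isMeasurableFun.Build _ _ _ _ (@fst TX TY) measurable_fst.

HB.instance Definition _ {dX dY} {TX : measurableType dX}
    {TY : measurableType dY} :=
  isMeasurableFun.Build _ _ _ _ (@snd TX TY) measurable_snd.

(* The product of the two margins of P. *)
Definition indep_law {dX dY} {TX : measurableType dX} {TY : measurableType dY}
    {R : realType} (P : probability (TX * TY)%type R) :
    {measure set (TX * TY) -> \bar R} :=
  (distribution P (@fst TX TY) \x distribution P (@snd TX TY))%E.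

(* dP/dQ = h *)
Definition has_density {d} {T : measurableType d} {R : realType}
    (P Q : {measure set T -> \bar R}) (h : T -> R) : Prop :=
  forall A, measurable A -> P A = (\int[Q]_(z in A) (h z)%:E)%E.

Section phi1.
Context {R : realType}.

(* [ln 0 = 0] in the library, which is the continuous extension of x log x. *)
Definition phi1 (x : R) : R := x * ln x - x + 1.

(* The domain of [phi1] is [0, +oo[, and [ln] is extended by 0 to negative
   numbers. *)
Definition phi1_conj (t : R) : R := sup [set t * x - phi1 x | x in `[0, +oo[].

Lemma derive1_phi1 (x : R) : 0 < x -> derive1 phi1 x = ln x.
Proof.
move=> x0; rewrite derive1E.
have dl := is_derive1_ln x0.
have -> : phi1 = (@id R) * (@ln R) - (@id R) + cst 1 by [].
by rewrite derive_val /GRing.scale /= mulfV ?gt_eqF// mulr1; ring.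
Qed.

Lemma phi1_conjE (t : R) : phi1_conj t = expR t - 1.
Proof.
have maxt : (expR t - 1) = t * expR t - phi1 (expR t).
  by rewrite /phi1 expRK; ring.
have ub : ubound [set t * x - phi1 x | x in `[0, +oo[] (expR t - 1).
  move=> y [x /=]; rewrite in_itv /= andbT => x_ge0 <-{y}; rewrite /phi1.
  have [x_gt0|x_le0] := ltP 0 x; last first.
    have -> : x = 0 by apply/le_anti/andP.
    by have := expR_ge0 t; lra.
  have := expR_ge1Dx (t - ln x); rewrite expRD expRN lnK ?posrE//.
  rewrite ler_pdivlMr// => le_t; lra.
apply/eqP; rewrite eq_le; apply/andP; split.
  by apply: ge_sup => //; exists (expR t - 1), (expR t); rewrite //= in_itv /= expR_ge0.
apply: ub_le_sup; first by exists (expR t - 1).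
by exists (expR t); rewrite //= in_itv /= expR_ge0.
Qed.

End phi1.

Section model.
Context {dX dY} {TX : measurableType dX} {TY : measurableType dY}.
Context {R : realType} {d : nat}.
Variables (xi : 'I_d -> {mfun TX >-> R}) (zeta : 'I_d -> {mfun TY >-> R}).
Implicit Types (t : 'cV[R]_(1 + d)) (z : TX * TY) (P : probability (TX * TY)%type R).

(* In [t : 'cV_(1 + d)], the coefficient alpha is [usubmx t 0 0] and beta_k is
   [dsubmx t k 0]. *)
Definition model_h t z : R :=
  expR (usubmx t 0 0 + \sum_(k < d) dsubmx t k 0 * xi k z.1 * zeta k z.2).

Definition model_f t z : R :=
  usubmx t 0 0 + \sum_(k < d) dsubmx t k 0 * xi k z.1 * zeta k z.2.

Definition model_g t z : R :=
  expR (usubmx t 0 0 + \sum_(k < d) dsubmx t k 0 * xi k z.1 * zeta k z.2) - 1.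

Lemma model_fE t z : model_f t z = derive1 phi1 (model_h t z).
Proof. by rewrite derive1_phi1 ?expR_gt0// expRK. Qed.

Lemma model_gE t z : model_g t z = phi1_conj (derive1 phi1 (model_h t z)).
Proof. by rewrite derive1_phi1 ?expR_gt0// expRK phi1_conjE. Qed.

(* M_n; the sample (X_1, Y_1), ..., (X_n, Y_n) is indexed from 0 here. *)
Definition criterion (n : nat) (w : nat -> TX * TY) t : R :=
  n%:R^-1 * (\sum_(i < n) model_f t (w i)) -
  (n%:R ^+ 2)^-1 * (\sum_(i < n) \sum_(j < n) model_g t ((w i).1, (w j).2)).

Definition Sigma1 P t : 'M[R]_(1 + d) :=
  - ((\matrix_(i, j) \int[P]_z hessian (model_f^~ z) t i j) -
     (\matrix_(i, j) \int[indep_law P]_z hessian (model_g^~ z) t i j)).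

Definition statV z : 'cV[R]_(1 + (d + (d + d))) :=
  col_mx 1%:M (col_mx (\col_k xi k z.1)
    (col_mx (\col_k zeta k z.2) (\col_k (xi k z.1 * zeta k z.2)))).

Definition mean_V P : 'cV[R]_(1 + (d + (d + d))) := \col_i \int[P]_z statV z i 0.

Definition Sigma_V P : 'M[R]_(1 + (d + (d + d))) :=
  \matrix_(i, j)
    \int[P]_z ((statV z - mean_V P) *m (statV z - mean_V P)^T) i j.

(* [v] stacks the blocks x_0, (x_k), (y_k), (z_k). *)
Definition psi (v : 'cV[R]_(1 + (d + (d + d)))) : 'cV[R]_(1 + d) :=
  let x := usubmx (dsubmx v) in
  let y := usubmx (dsubmx (dsubmx v)) in
  let z := dsubmx (dsubmx (dsubmx v)) in
  col_mx 0 (\col_k (x k 0 * y k 0 - z k 0)).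

Definition Sigma2 P : 'M[R]_(1 + d) :=
  jacobian_mx psi (mean_V P) *m Sigma_V P *m (jacobian_mx psi (mean_V P))^T.

End model.

(* Main.v *)
(* Around theta = 0, the rescaled criterion A_n(s) = n M_n(s / sqrt n) is a random
   concave function that is uniformly close on bounded sets to
   the quadratic s^T U_n - s^T Sigma1 s / 2: the linear term of the expansion is
   the empirical covariance of the xi_k(X) and zeta_k(Y), the quadratic term is a
   product of empirical moments, and the cubic remainder is O(1 / sqrt n) in mean.
   A concave function close to a quadratic is maximized near Sigma1^-1 U_n, with
   maximum near U_n^T Sigma1^-1 U_n / 2, so both limits follow from U_n -> N(0, Sigma2).
   Hypothesis (v) with 0 interior to Theta makes exp (delta |xi_k(X) zeta_k(Y)|)
   integrable, so xi_k(X) zeta_k(Y) has all moments; as Sigma1 is nonsingular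
   these products are not almost surely zero, and by independence xi_k(X) and
   zeta_k(Y) have all moments too.  The central limit theorem is proved first for
   the expectations of cosines of linear forms; as trigonometric polynomials are
   dense on boxes, this gives convergence in distribution. *)

Require Import Defs.
From HB Require Import structures.
From mathcomp Require Import all_boot all_order all_algebra finmap.
From mathcomp Require Import all_classical all_reals all_analysis.
From mathcomp Require Import measurable_realfun gauss_integral.
From mathcomp Require Import ring lra.
From mathcomp.real_closed Require Import complex.

Set Implicit Arguments.
Unset Strict Implicit.
Unset Printing Implicit Defensive.

Import Order.TTheory GRing.Theory Num.Theory.
Import numFieldNormedType.Exports.

Local Open Scope classical_set_scope.
Local Open Scope ring_scope.

(** * Integrable functions *)

(** Smallness is measured in L^1 throughout: the errors of the expansion have mean O(1 / sqrt n) and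
    U_n has bounded second moments, so Markov's inequality does the work of convergence in
    probability. Concavity does the work of a consistency proof. [Theta] may fail to be convex, but
    the criterion is concave on the whole space, and the maximizer over [Theta] is compared with a
    single point, Sigma1^-1 U_n / sqrt n, which for large n lies in a box around 0 contained in
    [Theta]. The intercept pairs the constant 1 with itself, so the first coordinate of U_n vanishes
    and Sigma2 is singular: laws of variance 0 have to be carried along everywhere. Complex
    characteristic functions are avoided; the free phase b in cos (b + u^T x) carries the sine part.
    Stability of the normal law under sums serves twice, to compute its cosine transform and to
    construct normal vectors one column at a time. *)

Local Notation intg P f := (P.-integrable [set: _] (EFin \o f)).

Section integrable_functions.
Context {d} {T : measurableType d} {R : realType}.
Variable P : {measure set T -> \bar R}.
Implicit Types f g : T -> R.

Lemma intg_measurable f : intg P f -> measurable_fun [set: T] f.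
Proof. by move=> /measurable_int/measurable_EFinP. Qed.

Lemma intg_le f g : measurable_fun [set: T] f -> intg P g ->
  (forall x, `|f x| <= g x) -> intg P f.
Proof.
move=> mf ig fg; apply: (le_integrable _ _ _ ig) => //.
  exact/measurable_EFinP.
by move=> x _ /=; rewrite lee_fin (le_trans (fg x))// ler_norm.
Qed.

Lemma intgD f g : intg P f -> intg P g -> intg P (fun x => f x + g x).
Proof.
move=> fi gi; apply: eq_integrable (integrableD _ fi gi) => //.
Qed.

Lemma intgZ k f : intg P f -> intg P (fun x => k * f x).
Proof.
move=> fi; apply: eq_integrable (integrableZl _ k fi) => //.
Qed.

Lemma intgN f : intg P f -> intg P (fun x => - f x).
Proof.
by move=> /(intgZ (-1)); apply: eq_integrable => // x _ /=; rewrite mulN1r.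
Qed.

Lemma intgB f g : intg P f -> intg P g -> intg P (fun x => f x - g x).
Proof. by move=> fi gi; apply: intgD => //; exact: intgN. Qed.

Lemma intg_norm f : intg P f -> intg P (fun x => `|f x|).
Proof.
by move=> fi; apply: eq_integrable (integrable_abse fi) => // x _.
Qed.

Lemma intg_sum I (s : seq I) (Q : pred I) (h : I -> T -> R) :
  (forall i, Q i -> intg P (h i)) -> intg P (fun x => \sum_(i <- s | Q i) h i x).
Proof.
move=> hi; apply: eq_integrable (integrable_sum _ s hi) => // x _ /=.
by rewrite sumEFin.
Qed.

Lemma Rintegral_sum I (s : seq I) (Q : pred I) (h : I -> T -> R) :
  (forall i, Q i -> intg P (h i)) ->
  \int[P]_x (\sum_(i <- s | Q i) h i x) = \sum_(i <- s | Q i) \int[P]_x h i x.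
Proof.
move=> hi; elim: s => [|a s ih].
  under eq_Rintegral do rewrite big_nil.
  by rewrite big_nil /Rintegral integral0.
rewrite big_cons -ih; case: ifPn => Qa.
  rewrite -RintegralD//; [|exact: hi|exact: intg_sum].
  by apply: eq_Rintegral => x _; rewrite big_cons Qa.
by apply: eq_Rintegral => x _; rewrite big_cons (negbTE Qa).
Qed.

Lemma Rintegral_Nfun f : intg P f -> \int[P]_x (- f x) = - \int[P]_x f x.
Proof.
move=> fi; under eq_Rintegral do rewrite -mulN1r.
by rewrite RintegralZl// mulN1r.
Qed.

Lemma Rintegral_le_norm f g : measurable_fun [set: T] f -> intg P g ->
  (forall x, `|f x| <= g x) -> `|\int[P]_x f x| <= \int[P]_x g x.
Proof.
move=> mf gi fg; have fi := intg_le mf gi fg.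
apply: (le_trans (le_normr_Rintegral _ fi)) => //.
by apply: le_Rintegral => //; exact: intg_norm.
Qed.

Lemma ge0_intg f : measurable_fun [set: T] f -> (forall x, 0 <= f x) ->
  (\int[P]_x (f x)%:E < +oo)%E -> intg P f.
Proof.
move=> mf f0 foo; apply/integrableP; split; first exact/measurable_EFinP.
by under eq_integral do rewrite /= ger0_norm//.
Qed.

End integrable_functions.

Section probability_integrals.
Context {d} {T : measurableType d} {R : realType} (P : probability T R).
Implicit Types f g : T -> R.

Lemma intg_cst k : intg P (fun=> k : R).
Proof. exact: finite_measure_integrable_cst. Qed.

Lemma Rintegral_prob_cst (k : R) : \int[P]_x k = k.
Proof.
rewrite Rintegral_cst// -[RHS]mulr1; congr (k * _).
by have /= -> := @probability_setT _ _ _ P.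
Qed.

Lemma intg_bounded f M : measurable_fun [set: T] f ->
  (forall x, `|f x| <= M) -> intg P f.
Proof. by move=> mf fM; apply: (intg_le mf (intg_cst M)). Qed.

End probability_integrals.

Section change_of_law.
Context {d d'} {T : measurableType d} {T' : measurableType d'} {R : realType}.
Variables (P : probability T R) (Q : {measure set T' -> \bar R}) (X : T -> T').
Hypothesis mX : measurable_fun [set: T] X.
Hypothesis XQ : forall A, measurable A -> P (X @^-1` A) = Q A.

Lemma integral_law (f : T' -> \bar R) : measurable_fun [set: T'] f ->
  (forall x, 0 <= f x)%E -> (\int[Q]_x f x = \int[P]_x f (X x))%E.
Proof.
move=> mf f0; rewrite (eq_measure_integral (pushforward P X)); last first.
  by move=> A mA _; exact/esym/XQ.
by rewrite ge0_integral_pushforward.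
Qed.

Lemma intg_law (f : T' -> R) : intg Q f -> intg P (f \o X).
Proof.
move=> /integrableP[mf foo]; apply/integrableP; split.
  by apply: measurableT_comp mf mX.
apply: le_lt_trans foo.
by rewrite (@integral_law (abse \o (EFin \o f)))//=; exact: measurableT_comp.
Qed.

Lemma Rintegral_law (f : T' -> R) : intg Q f ->
  \int[P]_x f (X x) = \int[Q]_x f x.
Proof.
move=> fi; rewrite /Rintegral; congr fine.
rewrite [RHS](eq_measure_integral (pushforward P X)); last first.
  by move=> A mA _; exact/esym/XQ.
rewrite integral_pushforward//; first exact: measurable_int fi.
exact: intg_law.
Qed.

End change_of_law.

Section product_law.
Context {d d1 d2} {T : measurableType d} {T1 : measurableType d1}
  {T2 : measurableType d2} {R : realType}.
Variables (P : probability T R) (P1 : probability T1 R) (P2 : probability T2 R).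
Variables (U : T -> T1) (V : T -> T2).
Hypotheses (mU : measurable_fun [set: T] U) (mV : measurable_fun [set: T] V).
Hypothesis UV : forall A B, measurable A -> measurable B ->
  (P (U @^-1` A `&` V @^-1` B) = P1 A * P2 B)%E.

(** A finite measure on the product is determined by its values on rectangles, which [UV]
    prescribes. *)
Lemma law_pair A : measurable A ->
  P ((fun x => (U x, V x)) @^-1` A) = (P1 \x P2)%E A.
Proof.
move=> mA; have mW : measurable_fun [set: T] (fun x => (U x, V x)).
  by apply/measurable_fun_pairP; split.
symmetry.
exact: (@product_measure_unique _ _ _ _ _ P1 P2 (pushforward P (fun x => (U x, V x)))).
Qed.

End product_law.

Section product_integrals.
Context {d1 d2} {T1 : measurableType d1} {T2 : measurableType d2} {R : realType}.
Variables (P1 : probability T1 R) (P2 : probability T2 R).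

Lemma Rintegral_prod (f : T1 * T2 -> R) : intg (P1 \x P2)%E f ->
  \int[(P1 \x P2)%E]_z f z = fine (\int[P1]_x \int[P2]_y (f (x, y))%:E)%E.
Proof.
by move=> fi; rewrite /Rintegral -(integral12_prod_meas1 fi).
Qed.

Lemma intg_prodM (f : T1 -> R) (g : T2 -> R) : intg P1 f -> intg P2 g ->
  intg (P1 \x P2)%E (fun z => f z.1 * g z.2).
Proof.
move=> fi gi; have mf := intg_measurable fi; have mg := intg_measurable gi.
apply/(integrable12ltyP P1 P2).
  apply/measurable_EFinP/measurable_funM.
    by apply: measurableT_comp mf _.
  by apply: measurableT_comp mg _.
have/integrableP[_ g_oo] := gi; have/integrableP[_ f_oo] := fi.
under eq_integral => x _.
  under eq_integral => y _ do rewrite /= normrM EFinM.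
  rewrite ge0_integralZl//=; last first.
    by apply/measurable_EFinP; exact: measurableT_comp.
  over.
rewrite /= in g_oo f_oo *.
have gE : (\int[P2]_x `|g x|%:E)%E \is a fin_num.
  by rewrite ge0_fin_numE//; apply: integral_ge0 => *; rewrite lee_fin.
rewrite -(fineK gE) ge0_integralZr//=; last 2 first.
  - by apply/measurable_EFinP; exact: measurableT_comp.
  - by rewrite lee_fin fine_ge0// integral_ge0// => *; rewrite lee_fin.
have f_ge0 : (0 <= \int[P1]_x `|f x|%:E)%E.
  by apply: integral_ge0 => *; rewrite lee_fin.
by rewrite lte_mul_pinfty ?ltry// ge0_fin_numE.
Qed.

Lemma Rintegral_prodM (f : T1 -> R) (g : T2 -> R) : intg P1 f -> intg P2 g ->
  \int[(P1 \x P2)%E]_z (f z.1 * g z.2) = (\int[P1]_x f x) * \int[P2]_y g y.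
Proof.
move=> fi gi; rewrite Rintegral_prod; last exact: intg_prodM.
have gE := integrable_fin_num measurableT gi.
have fE := integrable_fin_num measurableT fi.
rewrite /= /Rintegral -fineM//; congr fine.
transitivity (\int[P1]_x ((f x)%:E * (fine (\int[P2]_y (g y)%:E))%:E))%E.
  apply: eq_integral => x _; rewrite (fineK gE) -integralZl//.
rewrite integralZr//; congr (_ * _)%E; exact: fineK.
Qed.

End product_integrals.

(** * Sums of i.i.d. variables *)

Section independence.
Context {d d'} {T : measurableType d} {T' : measurableType d'} {R : realType}.
Variables (P : probability T R) (Q : probability T' R) (W : nat -> T -> T').
Hypothesis iidW : iid P W Q.

Let mW i : measurable_fun [set: T] (W i).
Proof. by have [] := iidW. Qed.

Let lawW i A : measurable A -> P (W i @^-1` A) = Q A.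
Proof. by have [_ + _] := iidW; apply. Qed.

Let cylinder (J : {fset nat}) (B : nat -> set T') :=
  \bigcap_(i in [set` J]) W i @^-1` B i.

Let measurable_cylinder J B : (forall i, measurable (B i)) ->
  measurable (cylinder J B).
Proof.
move=> mB; apply: fin_bigcap_measurable => // i _.
by rewrite -[X in measurable X]setTI; exact: mW.
Qed.

Let cylinderU1 (k : nat) (J : {fset nat}) (B : nat -> set T') (C : set T') :
  k \notin J ->
  cylinder (k |` J)%fset (fun i => if i == k then C else B i) =
  W k @^-1` C `&` cylinder J B.
Proof.
move=> kJ; apply/seteqP; split=> w.
  move=> h; split; first by have := h k; rewrite /= eqxx; apply; exact: fset1U1.
  move=> i iJ; have := h i; rewrite /= (_ : (i == k) = false); last first.
    by apply/eqP => ik; move: kJ; rewrite -ik iJ.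
  by apply; exact: fset1Ur.
move=> [Ck h] i /=; rewrite in_fset1U => /predU1P[->|iJ].
  by rewrite eqxx.
by case: eqVneq => [->//|_]; exact: h.
Qed.

Let cylinder_prob (k : nat) (J : {fset nat}) (B : nat -> set T') (C : set T') :
  k \notin J -> (forall i, measurable (B i)) -> measurable C ->
  P (W k @^-1` C `&` cylinder J B) = (Q C * P (cylinder J B))%E.
Proof.
move=> kJ mB mC; have [_ _ ind] := iidW.
rewrite -cylinderU1//; pose B' i := if i == k then C else B i.
have mB' i : measurable (B' i) by rewrite /B'; case: ifP.
rewrite (ind _ B')// (ind J B)// big_fsetU1//= lawW// /B' eqxx.
congr (_ * _)%E; apply: eq_big_seq => i iJ; case: eqVneq => // ik.
by move: kJ; rewrite -ik iJ.
Qed.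

Lemma iid_pair i j A B : i != j -> measurable A -> measurable B ->
  (P (W i @^-1` A `&` W j @^-1` B) = Q A * Q B)%E.
Proof.
move=> ij mA mB; have := @cylinder_prob i [fset j]%fset (fun=> B) A.
rewrite inE => /(_ ij (fun=> mB) mA).
have -> : cylinder [fset j]%fset (fun=> B) = W j @^-1` B.
  apply/seteqP; split=> w; first by apply; rewrite /= inE.
  by move=> Bj i0 /=; rewrite inE => /eqP ->.
by rewrite lawW.
Qed.

(** Mutual independence speaks of cylinders only, and an event on a partial sum is not one.
    Independence of the sum from the next variable is built up one summand at a time. *)
Lemma iid_partial_sum (phi : T' -> R) (k : nat) :
  measurable_fun [set: T'] phi ->
  forall A B, measurable A -> measurable B ->
  (P ((fun w => (\sum_(i < k) phi (W i w))%R) @^-1` A `&` W k @^-1` B) =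
   P ((fun w => (\sum_(i < k) phi (W i w))%R) @^-1` A) * Q B)%E.
Proof.
move=> mphi.
pose S n w : R := \sum_(i < n) phi (W i w).
have mS n : measurable_fun [set: T] (S n).
  apply: measurable_sum => i; exact: measurableT_comp mphi (mW i).
(* To survive the induction, independence is claimed from every cylinder over indices at least [n],
   not only from [W n]. *)
suff h n (J : {fset nat}) (B : nat -> set T') A :
    (forall i, i \in J -> (n <= i)%N) -> (forall i, measurable (B i)) ->
    measurable A ->
    P (S n @^-1` A `&` cylinder J B) = (P (S n @^-1` A) * P (cylinder J B))%E.
  move=> A B mA mB; have := h k [fset k]%fset (fun=> B) A.
  have -> : cylinder [fset k]%fset (fun=> B) = W k @^-1` B.
    apply/seteqP; split=> w; first by apply; rewrite /= inE.
    by move=> Bj i0 /=; rewrite inE => /eqP ->.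
  by rewrite lawW// => -> // i; rewrite inE => /eqP ->.
elim: n J B A => [|n ih] J B A Jn mB mA.
  have S0 w : S 0%N w = 0 by rewrite /S big_ord0.
  have [A0|A0] := pselect (A 0).
    rewrite (_ : S 0%N @^-1` A = setT); last first.
      by apply/seteqP; split=> w //= _; rewrite S0.
    by rewrite setTI probability_setT mul1e.
  rewrite (_ : S 0%N @^-1` A = set0); last first.
    by apply/seteqP; split=> w //=; rewrite S0.
  by rewrite set0I measure0 mul0e.
have nJ : n \notin J by apply/negP => /Jn; rewrite ltnn.
have mE : measurable (cylinder J B) by exact: measurable_cylinder.
set E := cylinder J B in mE *.
(* On rectangles, the event on [W n] is absorbed into the cylinder [E], to which the induction
   hypothesis applies. *)
have rect (C : set R) (D : set T') : measurable C -> measurable D ->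
    P (S n @^-1` C `&` W n @^-1` D `&` E) = (P (S n @^-1` C) * Q D * P E)%E.
  move=> mC mD; rewrite -setIA -cylinderU1// ih//.
  - by rewrite cylinderU1// cylinder_prob// muleA.
  - by move=> i; rewrite in_fset1U => /predU1P[->//|/Jn/ltnW].
  - by move=> i; case: ifP.
have mSn := mS n; have mWn := mW n.
pose SW w := (S n w, W n w).
have mSW : measurable_fun [set: T] SW by apply/measurable_fun_pairP; split.
pose Sn : {mfun T >-> R} := HB.pack (S n) (isMeasurableFun.Build _ _ _ _ (S n) mSn).
pose PE : {nonneg R} := NngNum (fine_ge0 (measure_ge0 P E)).
have PEE : (PE%:num%:E = P E)%E by rewrite /= fineK// fin_num_measure.
pose m1 : probability R R := distribution P Sn.
(* The measures P (SW in ., E) and P E * P (SW in .) agree on rectangles with the product of the law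
   of [S n] and [P E] times [Q]. They are therefore equal, in particular on the preimage of [A]
   under [add], which is not a rectangle. *)
have e1 := @product_measure_unique _ _ _ _ _ m1 (mscale PE Q)
  (pushforward (mrestr P mE) SW).
have e2 := @product_measure_unique _ _ _ _ _ m1 (mscale PE Q)
  (mscale PE (pushforward P SW)).
pose add (z : R * T') := z.1 + phi z.2.
have madd : measurable_fun [set: (R * T')%type] add.
  apply: measurable_funD; first exact: measurable_fst.
  exact: measurableT_comp mphi measurable_snd.
have mX : measurable (add @^-1` A) by rewrite -[X in measurable X]setTI; exact: madd.
have h : (PE%:num%:E * P (SW @^-1` (add @^-1` A)) =
    P (SW @^-1` (add @^-1` A) `&` E))%E.
  transitivity ((m1 \x mscale PE Q)%E (add @^-1` A)).
    symmetry; apply: (e2 mSW) => // C D mC mD.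
    change (PE%:num%:E * P (S n @^-1` C `&` W n @^-1` D) =
            P (S n @^-1` C) * (PE%:num%:E * Q D))%E.
    have := ih [fset n]%fset (fun=> D) C.
    have -> : cylinder [fset n]%fset (fun=> D) = W n @^-1` D.
      apply/seteqP; split=> w; first by apply; rewrite /= inE.
      by move=> Bj i0 /=; rewrite inE => /eqP ->.
    rewrite lawW// => ->//; last by move=> i; rewrite inE => /eqP ->.
    by rewrite muleCA.
  apply: (e1 mSW) => // C D mC mD.
  change (P ((S n @^-1` C `&` W n @^-1` D) `&` E) =
   P (S n @^-1` C) * (PE%:num%:E * Q D))%E.
  by rewrite PEE rect// -muleA (muleC (Q D)).
have -> : S n.+1 @^-1` A = SW @^-1` (add @^-1` A).
  by apply/seteqP; split=> w /=; rewrite /S big_ord_recr.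
by rewrite -h PEE muleC.
Qed.

End independence.

(** * Elementary bounds for sine, cosine and exponential *)

Section taylor.
Context {R : realType}.

(** [g - f] is nondecreasing on [0, +oo[. Iterating this integrates an inequality, which is how the
    bounds on sine and cosine below climb one degree at a time. *)
Lemma le_of_derivative (f g f' g' : R -> R) :
  (forall x : R, is_derive x 1 f (f' x)) -> (forall x : R, is_derive x 1 g (g' x)) ->
  f 0 <= g 0 -> (forall x, 0 <= x -> f' x <= g' x) ->
  forall x : R, 0 <= x -> f x <= g x.
Proof.
move=> df dg fg0 fg x x0.
have dh (y : R) : is_derive y 1 (g - f) (g' y - f' y) by exact: is_deriveB.
have := @ger0_derive1_ndecry _ (g - f) 0 _ _ _ 0 x (lexx 0) x0.
have dfy (y : R) : derivable (g - f) y 1 by have [] := dh y.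
have cty : {within `[0, +oo[, continuous (g - f)}.
  by apply: continuous_subspaceT => y; apply/differentiable_continuous/derivable1_diffP.
move=> /(_ (fun y _ => dfy y)) /(_ _ cty) h.
suff : (g - f) 0 <= (g - f) x by rewrite !fctE; lra.
apply: h => y; rewrite in_itv /= andbT => y0.
by rewrite derive1E (@derive_val _ _ _ _ _ _ _ (dh y)) subr_ge0 fg// ltW.
Qed.

Let sin_le (x : R) : 0 <= x -> sin x <= x.
Proof.
apply: (@le_of_derivative sin id cos (cst 1)) => [|y _].
- by rewrite sin0.
- exact: cos_le1.
Qed.

Let cos_ge (x : R) : 0 <= x -> 1 - x ^+ 2 / 2 <= cos x.
Proof.
apply: (@le_of_derivative (fun x => 1 - x ^+ 2 / 2) cos (fun x => - x) (fun x => - sin x))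
  => [y||y y0].
- rewrite (_ : (fun x => _) = cst 1 - 2^-1 *: (@id R ^+ 2)); last first.
    by apply/funext => z /=; rewrite !fctE/= /GRing.scale/= mulrC.
  apply: is_derive_eq; rewrite /GRing.scale/= expr1; lra.
- by rewrite cos0 expr0n /=; lra.
- by rewrite lerN2 sin_le.
Qed.

(** The quadratic bound is what [cos_le] integrates; the cubic one gives the remainder in
    [cos_taylor]. *)
Let sin_ge (x : R) : 0 <= x -> x - x ^+ 2 / 2 <= sin x /\ x - x ^+ 3 / 6 <= sin x.
Proof.
have cosN1 (y : R) : 0 <= y -> 1 - y <= cos y.
  apply: (@le_of_derivative (fun x => 1 - x) cos (fun x => - 1) (fun x => - sin x)) => [z||z _].
  - rewrite (_ : (fun x => _) = cst 1 - (@id R)); last by [].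
    by apply: is_derive_eq; rewrite add0r.
  - by rewrite cos0 subr0.
  - by rewrite lerN2 sin_le1.
move=> x0; split; move: x x0.
  apply: (@le_of_derivative (fun x => x - x ^+ 2 / 2) sin (fun x => 1 - x) cos) => [y||y y0].
  - rewrite (_ : (fun x => _) = (@id R) - 2^-1 *: (@id R ^+ 2)); last first.
      by apply/funext => z /=; rewrite !fctE/= /GRing.scale/= mulrC.
    apply: is_derive_eq; rewrite /GRing.scale/= expr1; lra.
  - by rewrite sin0 expr0n /=; lra.
  - exact: cosN1.
apply: (@le_of_derivative (fun x => x - x ^+ 3 / 6) sin (fun x => 1 - x ^+ 2 / 2) cos) => [y||y y0].
- rewrite (_ : (fun x => _) = (@id R) - 6^-1 *: (@id R ^+ 3)); last first.
    by apply/funext => z /=; rewrite !fctE/= /GRing.scale/= mulrC.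
  apply: is_derive_eq; rewrite /GRing.scale/=; lra.
- by rewrite sin0 expr0n /=; lra.
- exact: cos_ge.
Qed.

Let is_derive_cube (y : R) : is_derive y 1 (fun x => x ^+ 3 / 6) (y ^+ 2 / 2).
Proof.
rewrite (_ : (fun x => _) = 6^-1 *: (@id R ^+ 3)); last first.
  by apply/funext => z /=; rewrite !fctE/= /GRing.scale/= mulrC.
apply: is_derive_eq; rewrite /GRing.scale/=; lra.
Qed.

Let is_derive_sqr (y : R) : is_derive y 1 (fun x => 1 - x ^+ 2 / 2) (- y).
Proof.
rewrite (_ : (fun x => _) = cst 1 - 2^-1 *: (@id R ^+ 2)); last first.
  by apply/funext => z /=; rewrite !fctE/= /GRing.scale/= mulrC.
apply: is_derive_eq; rewrite /GRing.scale/= expr1; lra.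
Qed.

Let cos_le (x : R) : 0 <= x -> cos x <= 1 - x ^+ 2 / 2 + x ^+ 3 / 6.
Proof.
apply: (@le_of_derivative cos (fun x => 1 - x ^+ 2 / 2 + x ^+ 3 / 6) (fun x => - sin x)
  (fun x => - x + x ^+ 2 / 2)) => [y||y y0].
- exact: (is_deriveD (is_derive_sqr y) (is_derive_cube y)).
- by rewrite cos0 !expr0n /=; lra.
- by have [+ _] := sin_ge y0; lra.
Qed.

Lemma sin_ge_cube (x : R) : 0 <= x -> x - x ^+ 3 / 6 <= sin x.
Proof. by move=> /sin_ge[]. Qed.

(** By the addition formula the remainder is cos x (cos h - 1 + h^2 / 2) - sin x (sin h - h), and
    each bracket is at most |h|^3 / 6. *)
Lemma cos_taylor (x h : R) :
  `|cos (x + h) - (cos x - h * sin x - h ^+ 2 / 2 * cos x)| <= `|h| ^+ 3.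
Proof.
have c0 : `|cos h - 1 + h ^+ 2 / 2| <= `|h| ^+ 3 / 6.
  have h0 := normr_ge0 h.
  rewrite -cos_norm -(real_normK (num_real h)).
  by have := cos_ge h0; have := cos_le h0 => ? ?; rewrite ler_norml; lra.
have s0 : `|sin h - h| <= `|h| ^+ 3 / 6.
  have h0 := normr_ge0 h; have [_ sg] := sin_ge h0; have sl := sin_le h0.
  have e : `|sin h - h| = `|sin `|h| - `|h| |.
    case: (ger0P h) => // _; rewrite -[LHS]normrN; congr `|_|.
    by rewrite sinN; ring.
  by rewrite e ler_norml; lra.
rewrite cosD (_ : _ - _ = cos x * (cos h - 1 + h ^+ 2 / 2) - sin x * (sin h - h)); last by ring.
rewrite (le_trans (ler_normB _ _))// !normrM.
have := cos_max x; have := sin_max x.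
have := normr_ge0 (cos h - 1 + h ^+ 2 / 2); have := normr_ge0 (sin h - h).
have : 0 <= `|h| ^+ 3 by rewrite exprn_ge0.
nra.
Qed.

(** exp (- y) lies between 1 - y and 1 / (1 + y), and the latter is at most 1 - y + y^2. *)
Lemma expRN_taylor (y : R) : 0 <= y -> `|expR (- y) - (1 - y)| <= y ^+ 2.
Proof.
move=> y0; have e1 := expR_ge1Dx (- y); have e2 := expR_ge1Dx y.
rewrite ler_norml; apply/andP; split; first by nra.
have := expRN y; have := expR_gt0 (- y); have e3 : expR y * expR (- y) = 1.
  by rewrite -expRD subrr expR0.
nra.
Qed.

End taylor.

Lemma measurable_cos (R : realType) : measurable_fun [set: R] (@cos R).
Proof. by apply: continuous_measurable_fun; exact: continuous_cos. Qed.

(** * Second moments and cosines of i.i.d. sums *)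

Section iid_expectations.
Context {d d'} {T : measurableType d} {T' : measurableType d'} {R : realType}.
Variables (P : probability T R) (Q : probability T' R) (W : nat -> T -> T').
Hypothesis iidW : iid P W Q.

Let mW i : measurable_fun [set: T] (W i).
Proof. by have [] := iidW. Qed.

Let lawW i A : measurable A -> P (W i @^-1` A) = Q A.
Proof. by have [_ + _] := iidW; apply. Qed.

Lemma intg_iid i f : intg Q f -> intg P (fun w => f (W i w)).
Proof. exact: intg_law (mW i) (@lawW i) f. Qed.

Lemma Rintegral_iid i (f : T' -> R) : intg Q f ->
  \int[P]_w f (W i w) = \int[Q]_z f z.
Proof. exact: Rintegral_law (mW i) (@lawW i) f. Qed.

Lemma iid_pair_law i j A : i != j -> measurable A ->
  P ((fun w => (W i w, W j w)) @^-1` A) = (Q \x Q)%E A.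
Proof.
by move=> ij; apply: law_pair => // B C mB mC; exact: (iid_pair iidW).
Qed.

Let mWW i j : measurable_fun [set: T] (fun w => (W i w, W j w)).
Proof. by apply/measurable_fun_pairP; split; exact: mW. Qed.

Lemma intg_iidM i j (f g : T' -> R) : i != j -> intg Q f -> intg Q g ->
  intg P (fun w => f (W i w) * g (W j w)).
Proof.
move=> ij fi gi.
have := intg_law (mWW i j) (fun A mA => iid_pair_law ij mA) (intg_prodM fi gi).
by [].
Qed.

Lemma Rintegral_iidM i j (f g : T' -> R) : i != j -> intg Q f -> intg Q g ->
  \int[P]_w (f (W i w) * g (W j w)) = (\int[Q]_z f z) * \int[Q]_z g z.
Proof.
move=> ij fi gi; rewrite -Rintegral_prodM//.
exact: (Rintegral_law (mWW i j) (fun A mA => iid_pair_law ij mA) (intg_prodM fi gi)).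
Qed.

Lemma sqr_iid_sum (phi : T' -> R) n w :
  (\sum_(i < n) phi (W i w)) ^+ 2 =
  \sum_(i < n) \sum_(j < n) phi (W i w) * phi (W j w).
Proof.
by rewrite expr2 mulr_suml; apply: eq_bigr => i _; rewrite mulr_sumr.
Qed.

Let intg_cross (phi : T' -> R) i j : intg Q phi ->
  intg Q (fun z => phi z ^+ 2) -> intg P (fun w => phi (W i w) * phi (W j w)).
Proof.
move=> phi1 phi2; case: (eqVneq i j) => [<-|ij]; last exact: intg_iidM.
have := intg_iid i phi2; apply: eq_integrable => // w _ /=.
Qed.

Lemma intg_sqr_iid_sum (phi : T' -> R) n : intg Q phi ->
  intg Q (fun z => phi z ^+ 2) ->
  intg P (fun w => (\sum_(i < n) phi (W i w)) ^+ 2).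
Proof.
move=> phi1 phi2.
under [X in integrable _ _ (EFin \o X)]funext do rewrite sqr_iid_sum.
by apply: intg_sum => i _; apply: intg_sum => j _; exact: intg_cross.
Qed.

(** The off-diagonal products vanish by independence and centering. *)
Lemma Rintegral_sqr_iid_sum (phi : T' -> R) n : intg Q phi ->
  intg Q (fun z => phi z ^+ 2) -> \int[Q]_z phi z = 0 ->
  \int[P]_w ((\sum_(i < n) phi (W i w)) ^+ 2) = n%:R * \int[Q]_z (phi z ^+ 2).
Proof.
move=> phi1 phi2 phi0.
under eq_Rintegral do rewrite sqr_iid_sum.
rewrite Rintegral_sum; last by move=> i _; apply: intg_sum => j _; exact: intg_cross.
transitivity (\sum_(i < n) \int[Q]_z (phi z ^+ 2)); last first.
  by rewrite sumr_const card_ord mulr_natl.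
apply: eq_bigr => i _; rewrite Rintegral_sum; last by move=> j _; exact: intg_cross.
rewrite (bigD1 i)//= big1 ?addr0; last first.
  by move=> j ji; rewrite Rintegral_iidM// 1?eq_sym// phi0 mulr0.
by rewrite -(Rintegral_iid i phi2).
Qed.

Section central_limit.
Variable phi : T' -> R.
Hypothesis mphi : measurable_fun [set: T'] phi.
Hypothesis phi3 : intg Q (fun z => `|phi z| ^+ 3).
Hypothesis phi_mean : \int[Q]_z phi z = 0.

Let norm1 (x : R) : `|x| <= 1 + `|x| ^+ 3.
Proof.
have := normr_ge0 x; set y := `|x| => y0.
by rewrite exprS; have [?|?] := leP y 1;
  [have : 0 <= y ^+ 3 by rewrite exprn_ge0|have : y * 1 <= y * y ^+ 2 by rewrite ler_wpM2l// expr_ge1 // ltW]; rewrite ?exprS; lra.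
Qed.

Let norm2 (x : R) : x ^+ 2 <= 1 + `|x| ^+ 3.
Proof.
rewrite -(real_normK (num_real x)); have := normr_ge0 x; set y := `|x| => y0.
have : 0 <= (y - 1) ^+ 2 * (y + 1) by rewrite mulr_ge0 ?sqr_ge0//; lra.
have : 0 <= y * (y - 1) ^+ 2 by rewrite mulr_ge0 ?sqr_ge0.
have [?|?] := leP y 1; rewrite !exprS !expr0; nra.
Qed.

Let phi1 : intg Q phi.
Proof.
apply: (intg_le mphi (g := fun z => 1 + `|phi z| ^+ 3)) => //.
by apply: intgD => //; exact: intg_cst.
Qed.

Let phi2 : intg Q (fun z => phi z ^+ 2).
Proof.
apply: (@intg_le _ _ _ _ _ (fun z => 1 + `|phi z| ^+ 3)) => //.
- exact: measurable_funX.
- by apply: intgD => //; exact: intg_cst.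
- by move=> x; rewrite ger0_norm ?sqr_ge0.
Qed.

Let v := \int[Q]_z (phi z ^+ 2).
Let m3 := \int[Q]_z (`|phi z| ^+ 3).

Let v0 : 0 <= v. Proof. by apply: Rintegral_ge0 => *; rewrite sqr_ge0. Qed.
Let m30 : 0 <= m3.
Proof. by apply: Rintegral_ge0 => *; rewrite exprn_ge0. Qed.

Variable s : R.
Hypothesis s0 : 0 <= s.

(** [gam] is the factor by which adding an independent normal variable of variance v s^2 shrinks the
    mean of a cosine; [eta] bounds the error made when one summand [s * phi] is replaced by such a
    variable. *)
Let gam := expR (- (v * s ^+ 2 / 2)).
Let eta := s ^+ 3 * m3 + (v * s ^+ 2 / 2) ^+ 2.
Let e k (x : R) := \int[P]_w cos (x + s * \sum_(i < k) phi (W i w)).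

Let gam01 : 0 <= gam <= 1.
Proof.
rewrite /gam expR_ge0 -expR0 ler_expR oppr_le0 mulr_ge0//.
by rewrite mulr_ge0// sqr_ge0.
Qed.

Let mcosphi x : measurable_fun [set: T'] (fun z => cos (x + s * phi z)).
Proof.
apply: measurableT_comp; first exact: measurable_cos.
by apply: measurable_funD => //; exact: measurable_funM.
Qed.

Let icos x : intg Q (fun z => cos (x + s * phi z)).
Proof. by apply: (@intg_bounded _ _ _ _ _ 1) => // z; rewrite cos_max. Qed.

(** Taylor expansion to second order: the linear term has mean 0, the quadratic one gives 1 - v s^2
    / 2, which is compared with [gam]. *)
Let one_step x : `|(\int[Q]_z cos (x + s * phi z)) - gam * cos x| <= eta.
Proof.
pose r z := cos (x + s * phi z) -
  (cos x - s * phi z * sin x - (s * phi z) ^+ 2 / 2 * cos x).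
have lin_i : intg Q (fun z => - (s * sin x) * phi z) by exact: intgZ.
have sqr_i : intg Q (fun z => - (s ^+ 2 / 2 * cos x) * phi z ^+ 2) by exact: intgZ.
have tay_i : intg Q (fun z => cos x - s * phi z * sin x - (s * phi z) ^+ 2 / 2 * cos x).
  have := intgD (intgD (intg_cst Q (cos x)) lin_i) sqr_i.
  by apply: eq_integrable => // z _ /=; congr (_%:E); ring.
have rE : \int[Q]_z r z = (\int[Q]_z cos (x + s * phi z)) - (1 - v * s ^+ 2 / 2) * cos x.
  rewrite RintegralB//; congr (_ - _).
  transitivity (\int[Q]_z (cos x + - (s * sin x) * phi z + - (s ^+ 2 / 2 * cos x) * phi z ^+ 2)).
    by apply: eq_Rintegral => z _; ring.
  rewrite RintegralD//; last by apply: intgD => //; exact: intg_cst.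
  rewrite RintegralD//; last exact: intg_cst.
  by rewrite !RintegralZl// Rintegral_prob_cst phi_mean -/v; ring.
have rle : `|\int[Q]_z r z| <= s ^+ 3 * m3.
  rewrite /m3 -RintegralZl//; apply: Rintegral_le_norm.
  - apply: measurable_funB => //; exact: intg_measurable tay_i.
  - exact: intgZ.
  - move=> z; apply: (le_trans (cos_taylor x (s * phi z))).
    by rewrite normrM exprMn (ger0_norm s0).
have /= := @expRN_taylor R (v * s ^+ 2 / 2).
rewrite -/gam => /(_ _)/wrap[]; first by rewrite mulr_ge0// mulr_ge0// sqr_ge0.
move=> ge.
have -> : (\int[Q]_z cos (x + s * phi z)) - gam * cos x =
   (\int[Q]_z r z) - (gam - (1 - v * s ^+ 2 / 2)) * cos x by rewrite rE; ring.
apply: (le_trans (ler_normB _ _)); rewrite lerD// normrM.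
by rewrite (le_trans _ ge)// ler_piMr// cos_max.
Qed.

Let mS k : measurable_fun [set: T] (fun w => \sum_(i < k) phi (W i w)).
Proof. by apply: measurable_sum => i; exact: measurableT_comp. Qed.

Let mcosS k x : measurable_fun [set: T] (fun w => cos (x + s * \sum_(i < k) phi (W i w))).
Proof.
apply: measurableT_comp; first exact: measurable_cos.
by apply: measurable_funD => //; exact: measurable_funM.
Qed.

Let icosS k x : intg P (fun w => cos (x + s * \sum_(i < k) phi (W i w))).
Proof. by apply: (@intg_bounded _ _ _ _ _ 1) => // z; rewrite cos_max. Qed.

(** The sine of the addition formula is written as a cosine shifted by [pi / 2], so that [e] alone
    occurs. *)
Let eD k x y : e k (x + y) = e k x * cos y - e k (x - pi / 2) * sin y.
Proof.
rewrite /e -!RintegralZr// -RintegralB//; last first.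
- have := intgZ (sin y) (icosS k (x - pi / 2)); apply: eq_integrable => // w _ /=.
  by rewrite mulrC.
- have := intgZ (cos y) (icosS k x); apply: eq_integrable => // w _ /=.
  by rewrite mulrC.
apply: eq_Rintegral => w _; set S := s * _.
rewrite (_ : x + y + S = (x + S) + y); last by ring.
rewrite (_ : x - pi / 2 + S = (x + S) - pi / 2); last by ring.
by rewrite cosBpihalf cosD.
Qed.

(** Conditioning on the last summand: the cosine of the sum is expanded, each product factors
    because the partial sum and [W k] are independent, and [eD] reassembles the result. *)
Let eS k x : e k.+1 x = \int[Q]_z e k (x + s * phi z).
Proof.
have mscos (z : R) : measurable_fun [set: R] (fun a => cos (z + s * a)).
  apply: measurableT_comp; first exact: measurable_cos.
  by apply: measurable_funD => //; exact: measurable_funM.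
pose S w := \sum_(i < k) phi (W i w).
pose S' : {mfun T >-> R} := HB.pack S (isMeasurableFun.Build _ _ _ _ S (mS k)).
have ig x' y' : intg P (fun w => cos (x' + s * S w) * cos (y' + s * phi (W k w))) /\
  \int[P]_w (cos (x' + s * S w) * cos (y' + s * phi (W k w))) =
    e k x' * \int[Q]_z cos (y' + s * phi z).
  pose L : probability R R := distribution P S'.
  have if1 : intg L (fun a => cos (x' + s * a)).
    by apply: (@intg_bounded _ _ _ _ _ 1) => // z; rewrite cos_max.
  have lp A : measurable A -> P ((fun w => (S w, W k w)) @^-1` A) = (L \x Q)%E A.
    by apply: (law_pair (mS k) (mW k)) => B C mB mC; exact: (iid_partial_sum iidW).
  have mp : measurable_fun [set: T] (fun w => (S w, W k w)).
    by apply/measurable_fun_pairP; split; [exact: (mS k)|exact: mW].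
  split; first exact: (intg_law mp lp (intg_prodM if1 (icos y'))).
  transitivity (\int[(L \x Q)%E]_z (cos (x' + s * z.1) * cos (y' + s * phi z.2))).
    exact: (Rintegral_law mp lp (intg_prodM if1 (icos y'))).
  rewrite (Rintegral_prodM if1 (icos y')); congr (_ * _).
  by have := Rintegral_law (mS k) (fun A mA => erefl : P (S @^-1` A) = L A) if1.
have [i1 E1] := ig x 0; have [i2 E2] := ig (x - pi / 2) (- (pi / 2)).
transitivity (e k x * (\int[Q]_z cos (0 + s * phi z)) -
    e k (x - pi / 2) * \int[Q]_z cos (- (pi / 2) + s * phi z)).
  rewrite -E1 -E2 -RintegralB//.
  apply: eq_Rintegral => w _; rewrite big_ord_recr /= -/(S w) mulrDr.
  rewrite addrA cosD add0r (addrC (- _)) cosBpihalf.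
  rewrite (_ : x - pi / 2 + s * S w = x + s * S w - pi / 2); last by ring.
  by rewrite cosBpihalf.
rewrite -!RintegralZl// -RintegralB//; last 2 first.
- exact: intgZ.
- exact: intgZ.
apply: eq_Rintegral => z _; by rewrite [RHS]eD add0r (addrC (- _)) cosBpihalf.
Qed.

(* Lindeberg's argument, splitting off one summand at a time. *)
Lemma cos_iid_sum k x : `|e k x - gam ^+ k * cos x| <= k%:R * eta.
Proof.
elim: k x => [|k ih] x.
  rewrite mul0r expr0 mul1r /e.
  under eq_Rintegral do rewrite big_ord0 mulr0 addr0.
  by rewrite Rintegral_prob_cst subrr normr0.
have ie : intg Q (fun z => e k (x + s * phi z)).
  have e1 z : e k (x + s * phi z) = e k x * cos (0 + s * phi z) -
     e k (x - pi / 2) * cos (- (pi / 2) + s * phi z).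
    by rewrite eD add0r (addrC (- _)) cosBpihalf.
  have := intgB (intgZ (e k x) (icos 0)) (intgZ (e k (x - pi / 2)) (icos (- (pi / 2)))).
  by apply: eq_integrable => // z _ /=; rewrite e1.
rewrite eS (_ : _ - _ = (\int[Q]_z (e k (x + s * phi z) - gam ^+ k * cos (x + s * phi z)))
   + gam ^+ k * ((\int[Q]_z cos (x + s * phi z)) - gam * cos x)); last first.
  by rewrite RintegralB ?RintegralZl// ?exprSr; [ring|exact: intgZ].
rewrite (le_trans (ler_normD _ _))// -natr1 mulrDl mul1r lerD//.
  rewrite -[leRHS](Rintegral_prob_cst Q); apply: Rintegral_le_norm => //.
  - apply: measurable_funB; first exact: intg_measurable ie.
    exact: measurable_funM.
  - exact: intg_cst.
rewrite normrM (le_trans _ (one_step x))// ler_piMl//.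
have /andP[g0 g1] := gam01.
by rewrite ger0_norm ?exprn_ge0// exprn_ile1.
Qed.

End central_limit.

End iid_expectations.

Lemma cvg_invsqrt (R : realType) :
  ((Num.sqrt n%:R)^-1 : R) @[n --> \oo] --> (0 : R).
Proof.
apply/cvgrPdist_le => e e0; near=> n.
have n0 : (0 < n)%N by near: n; exact: nbhs_infty_gt.
have sn0 : 0 < Num.sqrt n%:R :> R by rewrite sqrtr_gt0 ltr0n.
rewrite sub0r normrN ger0_norm ?invr_ge0 ?(ltW sn0)//.
have ei0 : 0 <= e^-1 by rewrite invr_ge0 ltW.
rewrite -[leRHS]invrK lef_pV2 ?posrE ?invr_gt0// -(ger0_norm ei0) -sqrtr_sqr.
rewrite ler_sqrt ?ler0n//.
by near: n; exact: nbhs_infty_ger.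
Unshelve. all: by end_near.
Qed.

Section trigonometric_clt.
Context {d d'} {T : measurableType d} {T' : measurableType d'} {R : realType}.
Variables (P : probability T R) (Q : probability T' R) (W : nat -> T -> T').
Hypothesis iidW : iid P W Q.

(** With s = 1 / sqrt n one has n s^2 = 1, so the n-th power of the normal factor is exactly exp (-
    v / 2), and n times the one-step error is s m3 + s^2 (v / 2)^2, which tends to 0. *)
Lemma cvg_cos_iid_sum (phi : T' -> R) (b : R) :
  measurable_fun [set: T'] phi -> intg Q (fun z => `|phi z| ^+ 3) ->
  \int[Q]_z phi z = 0 ->
  \int[P]_w cos (b + (Num.sqrt n%:R)^-1 * \sum_(i < n) phi (W i w))
    @[n --> \oo] --> expR (- (\int[Q]_z (phi z ^+ 2)) / 2) * cos b.
Proof.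
move=> mphi phi3 phi0; set v := \int[Q]_z (phi z ^+ 2).
pose m3 := \int[Q]_z (`|phi z| ^+ 3).
pose s n : R := (Num.sqrt n%:R)^-1.
have s0 n : 0 <= s n by rewrite invr_ge0 sqrtr_ge0.
have bnd : (s n * m3 + s n * s n * (v / 2) ^+ 2) @[n --> \oo] --> (0 : R).
  rewrite [X in _ --> X](_ : _ = 0 * m3 + 0 * 0 * (v / 2) ^+ 2); last by ring.
  apply: cvgD; first by apply: cvgM; [exact: cvg_invsqrt|exact: cvg_cst].
  by apply: cvgM; [apply: cvgM; exact: cvg_invsqrt|exact: cvg_cst].
apply/cvgrPdist_le => e e0.
move/cvgrPdist_le : bnd => /(_ _ e0) bnd.
near=> n.
have n0 : (0 < n)%N by near: n; exact: nbhs_infty_gt.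
have n0' : (0 : R) < n%:R by rewrite ltr0n.
have ns2 : n%:R * s n ^+ 2 = 1.
  by rewrite /s exprVn sqr_sqrtr ?ler0n// mulfV// gt_eqF.
have := cos_iid_sum iidW mphi phi3 phi0 (s0 n) n b.
rewrite -/v -/m3 -/(s n) -expRM_natl.
rewrite (_ : n%:R * - (v * s n ^+ 2 / 2) = - v / 2); last first.
  by transitivity (- v / 2 * (n%:R * s n ^+ 2)); [ring|rewrite ns2 mulr1].
rewrite distrC => /le_trans; apply.
rewrite (_ : n%:R * _ = s n * m3 * (n%:R * s n ^+ 2)
  + s n * s n * (v / 2) ^+ 2 * (n%:R * s n ^+ 2)); last by ring.
rewrite ns2 !mulr1.
have : `|0 - (s n * m3 + s n * s n * (v / 2) ^+ 2)| <= e by near: n.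
by rewrite sub0r normrN => /(le_trans (ler_norm _)).
Unshelve. all: by end_near.
Qed.

End trigonometric_clt.

(** * Normal laws *)

Section normal.
Context {R : realType}.
Notation mu := (@lebesgue_measure R).
Local Notation gauss := (normal_prob (0 : R) 1).

Let measurable_affine (y c : R) : measurable_fun [set: R] (fun x => y + c * x).
Proof. by apply: measurable_funD => //; exact: measurable_funM. Qed.

Lemma normal_peakE (s : R) : normal_peak s = (`|s| * Num.sqrt (pi *+ 2))^-1.
Proof. by rewrite /normal_peak -mulrnAr sqrtrM ?sqr_ge0// sqrtr_sqr. Qed.

(** By uniqueness of Lebesgue measure it suffices to compare half-open intervals. For [c < 0] the
    preimage is half-open on the other side, which does not change its length. *)
Lemma integral_affine (y c : R) (f : R -> \bar R) : c != 0 ->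
  measurable_fun [set: R] f -> (forall x, 0 <= f x)%E ->
  (\int[mu]_x f x = `|c|%:E * \int[mu]_x f (y + c * x)%R)%E.
Proof.
move=> c0 mf f0; pose k : {nonneg R} := NngNum (normr_ge0 c).
pose h : measurableTypeR R -> measurableTypeR R := fun x : R => y + c * x.
have mh : measurable_fun [set: measurableTypeR R] h := measurable_affine y c.
rewrite [RHS](_ : _ = \int[mscale k (pushforward mu h)]_x f x)%E; last first.
  by rewrite ge0_integral_mscale//= ge0_integral_pushforward.
apply: eq_measure_integral => A mA _; apply: lebesgue_measure_unique => // _ [[a b]] _ <-.
change (mu `]a, b]%classic = `|c|%:E * mu (h @^-1` `]a, b]%classic))%E.
have [c_gt0|c_le0] := ltP 0 c.
  rewrite (_ : _ @^-1` _ = `](a - y) / c, (b - y) / c]%classic); last first.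
    apply/seteqP; split=> x /=; rewrite !in_itv /= /h ltr_pdivrMr// ler_pdivlMr// => /andP[? ?];
      apply/andP; split; lra.
  rewrite !lebesgue_measure_itv /= !lte_fin ltr_pM2r ?invr_gt0//.
  rewrite ltrD2r; case: ifP => ab; last by rewrite mule0.
  by rewrite -!EFinD -EFinM gtr0_norm//; congr (_%:E); field; rewrite gt_eqF.
have c_lt0 : c < 0 by rewrite lt_neqAle c0.
rewrite (_ : _ @^-1` _ = `[(b - y) / c, (a - y) / c[%classic); last first.
  apply/seteqP; split=> x /=; rewrite !in_itv /= /h ltr_ndivlMr// ler_ndivrMr// => /andP[? ?];
    apply/andP; split; lra.
rewrite !lebesgue_measure_itv /= !lte_fin ltr_nM2r ?invr_lt0//.
rewrite ltrD2r; case: ifP => ab; last by rewrite mule0.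
by rewrite -!EFinD -EFinM ltr0_norm//; congr (_%:E); field; rewrite lt_eqF.
Qed.

(** The change of variables goes through the Radon-Nikodym derivative, which equals the density
    almost everywhere because both integrate to [normal_prob m s] over every set. *)
Lemma integral_normal_prob (m s : R) (f : R -> \bar R) :
  measurable_fun [set: R] f -> (forall x, 0 <= f x)%E ->
  (\int[normal_prob m s]_x f x = \int[mu]_x (f x * (normal_pdf m s x)%:E))%E.
Proof.
move=> mf f0; have dom := @normal_prob_dominates R m s.
rewrite -(Radon_Nikodym_SigmaFinite.change_of_variables dom)//.
apply: ae_eq_integral => //.
- apply: emeasurable_funM => //.
  exact: (measurable_int mu (Radon_Nikodym_SigmaFinite.f_integrable dom)).
- apply: emeasurable_funM => //; apply/measurable_EFinP.
  exact: measurable_normal_pdf.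
- apply: ae_eqe_mul2l => /=; apply: integral_ae_eq => //=.
  + exact: (Radon_Nikodym_SigmaFinite.f_integrable dom).
  + by apply/measurable_EFinP; exact: measurable_normal_pdf.
  + by move=> E _ mE; rewrite -Radon_Nikodym_SigmaFinite.f_integral.
Qed.

Lemma normal_prob_affine (y c : R) (A : set R) : c != 0 -> measurable A ->
  gauss ((fun x => y + c * x) @^-1` A) = normal_prob y `|c| A.
Proof.
move=> c0 mA; have mh := measurable_affine y c.
have mB : measurable ((fun x => y + c * x) @^-1` A).
  by rewrite -[X in measurable X]setTI; exact: mh.
rewrite /normal_prob [LHS]integral_mkcond [RHS]integral_mkcond.
rewrite [RHS](@integral_affine y c)//; last 2 first.
- apply/(measurable_restrictT _ _).1 => //; apply/measurable_funTS/measurable_EFinP.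
  exact: measurable_normal_pdf.
- by move=> x; apply: erestrict_ge0 => z _; rewrite lee_fin normal_pdf_ge0.
rewrite -ge0_integralZl//; last 2 first.
- apply: (measurableT_comp (f := (fun x => (normal_pdf y `|c| x)%:E) \_ A)) => //.
  apply/(measurable_restrictT _ _).1 => //; apply/measurable_funTS/measurable_EFinP.
  exact: measurable_normal_pdf.
- by move=> x _; apply: erestrict_ge0 => z _; rewrite lee_fin normal_pdf_ge0.
apply: eq_integral => x _; rewrite !patchE.
have -> : (x \in (fun x => y + c * x) @^-1` A) = (y + c * x \in A).
  by apply/idP/idP; rewrite !inE.
case: ifPn => _; last by rewrite mule0.
rewrite -EFinM; congr (_%:E).
have cn0 : `|c| != 0 by rewrite normr_eq0.
rewrite !normal_pdfE ?oner_eq0// /normal_fun.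
rewrite !normal_peakE normr1 mul1r normr_id.
rewrite invfM !mulrA mulfV// mul1r; congr (_ * expR _).
rewrite (addrC y) addrK subr0 exprMn real_normK ?num_real// -mulr_natl -(mulr_natl (c ^+ 2)).
by field.
Qed.

End normal.

(** * Sums of independent normal variables *)

Section normal_convolution.
Context {R : realType}.
Notation mu := (@lebesgue_measure R).
Local Notation gauss := (normal_prob (0 : R) 1).

(** Completing the square in [y]: the joint density is rewritten as the marginal density of [x]
    times the conditional density of [y] given [x]. *)
Lemma normal_pdfM (s1 s2 x y : R) : 0 < s1 -> 0 < s2 ->
  let s := Num.sqrt (s1 ^+ 2 + s2 ^+ 2) in
  normal_pdf 0 s1 y * normal_pdf y s2 x =
  normal_pdf 0 s x * normal_pdf (x * s1 ^+ 2 / s ^+ 2) (s1 * s2 / s) y.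
Proof.
move=> s1_gt0 s2_gt0 s.
have q0 : 0 < s1 ^+ 2 + s2 ^+ 2 by rewrite addr_gt0 ?exprn_gt0.
have s_gt0 : 0 < s by rewrite sqrtr_gt0.
have s2E : s ^+ 2 = s1 ^+ 2 + s2 ^+ 2 by rewrite sqr_sqrtr// ltW.
have t_gt0 : 0 < s1 * s2 / s by rewrite divr_gt0// mulr_gt0.
rewrite !normal_pdfE ?gt_eqF// !normal_peakE /normal_fun !gtr0_norm//.
rewrite mulrACA [RHS]mulrACA -!expRD; congr (_ * expR _).
  rewrite -!invfM; congr (_^-1); rewrite mulrACA [RHS]mulrACA; congr (_ * _).
  by rewrite mulrCA mulfV ?mulr1// gt_eqF.
rewrite !subr0 -4!mulr_natl expr_div_n s2E exprMn.
have [e1 e2] : s1 != 0 /\ s2 != 0 by rewrite !gt_eqF.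
by field; rewrite e1 e2 gt_eqF.
Qed.

Let measurable_pdf2 (c : R) : c != 0 ->
  measurable_fun [set: R * R] (fun z => normal_pdf z.1 c z.2).
Proof.
move=> c0; under eq_fun do rewrite normal_pdfE// /normal_fun.
apply: measurable_funM => //; apply: measurableT_comp => //.
apply: measurable_funM => //; apply: measurableT_comp => //.
apply: measurable_funX; apply: measurable_funB.
  exact: measurable_snd.
exact: measurable_fst.
Qed.

Let normal_fun2 (c : R) (A : set R) (z : R * R) : \bar R :=
  (\1_A z.2 * normal_pdf z.1 `|c| z.2)%:E.

Let normal_fun2_ge0 c A z : (0 <= normal_fun2 c A z)%E.
Proof. by rewrite lee_fin mulr_ge0// normal_pdf_ge0. Qed.

Let measurable_normal_fun2 (c : R) (A : set R) : c != 0 -> measurable A ->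
  measurable_fun [set: R * R] (normal_fun2 c A).
Proof.
move=> c0 mA; apply/measurable_EFinP/measurable_funM.
  apply: (measurableT_comp (f := \1_A : R -> R)); last exact: measurable_snd.
  exact: measurable_indic.
by apply: measurable_pdf2; rewrite normr_eq0.
Qed.

Let normal_fun2E (c : R) (A : set R) (y : R) :
  normal_prob y `|c| A = (\int[mu]_x normal_fun2 c A (y, x))%E.
Proof.
rewrite /normal_prob integral_mkcond; apply: eq_integral => x _.
by rewrite patchE /normal_fun2 /= indicE; case: ifPn; rewrite ?mul1r ?mul0r.
Qed.

Lemma measurable_normal_prob_mean (c : R) (A : set R) : c != 0 -> measurable A ->
  measurable_fun [set: R] (fun y => normal_prob y `|c| A).
Proof.
move=> c0 mA; rewrite (_ : (fun y => _) = fubini_F mu (normal_fun2 c A)).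
  by apply: measurable_fun_fubini_tonelli_F => //; exact: measurable_normal_fun2.
exact/funext/normal_fun2E.
Qed.

(** After exchanging the integrals, the conditional density given by [normal_pdfM] integrates to 1
    and the marginal remains. *)
Lemma integral_normal_prob_mean (v c : R) (A : set R) : 0 < v -> c != 0 ->
  measurable A ->
  (\int[normal_prob 0 (Num.sqrt v)]_y normal_prob y `|c| A =
   normal_prob 0 (Num.sqrt (v + c ^+ 2)) A)%E.
Proof.
move=> v0 c0 mA; have c_gt0 : 0 < `|c| by rewrite normr_gt0.
have sv0 : 0 < Num.sqrt v by rewrite sqrtr_gt0.
pose f := normal_fun2 c A.
have f0 z : (0 <= f z)%E by exact: normal_fun2_ge0.
have mf : measurable_fun [set: R * R] f by exact: measurable_normal_fun2.
have FE y : normal_prob y `|c| A = (\int[mu]_x f (y, x))%E by exact: normal_fun2E.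
have mF := measurable_normal_prob_mean c0 mA.
rewrite integral_normal_prob//.
pose g (z : R * R) := (normal_pdf 0 (Num.sqrt v) z.1 * (\1_A z.2 * normal_pdf z.1 `|c| z.2))%:E.
have g0 z : (0 <= g z)%E by rewrite lee_fin !mulr_ge0// normal_pdf_ge0.
have mg : measurable_fun [set: R * R] g.
  apply/measurable_EFinP/measurable_funM; last exact/measurable_EFinP.
  by apply: (measurableT_comp (f := normal_pdf 0 (Num.sqrt v)));
    [exact: measurable_normal_pdf|exact: measurable_fst].
transitivity (\int[mu]_y \int[mu]_x g (y, x))%E.
  apply: eq_integral => y _; rewrite FE muleC -ge0_integralZl//.
  - exact: (measurable_fun_pair2 _ mf).
  - by rewrite lee_fin normal_pdf_ge0.
transitivity (\int[mu]_x \int[mu]_y g (y, x))%E.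
  exact: (@fubini_tonelli _ _ _ _ _ mu mu).
rewrite /normal_prob [RHS]integral_mkcond.
apply: eq_integral => x _; rewrite patchE /g /=.
rewrite indicE; case: ifPn => xA; last first.
  by under eq_integral do rewrite mul0r mulr0; rewrite integral0.
under eq_integral do rewrite mul1r normal_pdfM// EFinM.
rewrite ge0_integralZl//.
- rewrite integral_normal_pdf mule1 real_normK ?num_real// sqr_sqrtr//.
  exact: ltW.
- by apply/measurable_EFinP; exact: measurable_normal_pdf.
- by move=> y _; rewrite lee_fin normal_pdf_ge0.
- by rewrite lee_fin normal_pdf_ge0.
Qed.

Let affine2 {d} {T : measurableType d} (Y : T -> R) (c : R) (z : T * R) :=
  Y z.1 + c * z.2.

Let measurable_affine2 {d} {T : measurableType d} (Y : T -> R) (c : R) :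
  measurable_fun [set: T] Y -> measurable_fun [set: T * R] (affine2 Y c).
Proof.
move=> mY; apply: measurable_funD; first exact: measurableT_comp mY measurable_fst.
by apply: measurable_funM => //; exact: measurable_snd.
Qed.

(** Given the first coordinate, the sum is normal with mean [Y] and standard deviation |c|, so the
    convolution formula applies. If [c = 0] the law of [Y] is kept, and if [v = 0] the mean is
    almost surely 0; these degenerate cases are separate because [normal_law] is then a Dirac
    mass. *)
Lemma normal_law_add {d} {T : measurableType d} (P : probability T R)
    (Y : T -> R) (v c : R) : measurable_fun [set: T] Y -> 0 <= v ->
  (forall A, measurable A -> P (Y @^-1` A) = normal_law 0 v A) ->
  forall A, measurable A ->
  (P \x gauss)%E ((fun z => Y z.1 + c * z.2) @^-1` A) = normal_law 0 (v + c ^+ 2) A.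
Proof.
move=> mY v0 lawY A mA.
have mB : measurable (affine2 Y c @^-1` A).
  by rewrite -[X in measurable X]setTI; exact: measurable_affine2.
change ((\int[P]_t gauss (xsection (affine2 Y c @^-1` A) t))%E = normal_law 0 (v + c ^+ 2) A).
have secE t : xsection (affine2 Y c @^-1` A) t = (fun x => Y t + c * x) @^-1` A.
  by apply/seteqP; split=> x; rewrite /xsection /= inE.
have [cE|c0] := eqVneq c 0.
  have -> : v + c ^+ 2 = v by rewrite cE expr0n addr0.
  rewrite -lawY//.
  have mYA : measurable (Y @^-1` A) by rewrite -[X in measurable X]setTI; exact: mY.
  rewrite -[in RHS](setIT (Y @^-1` A)) -integral_indic//.
  apply: eq_integral => t _; rewrite indicE secE.
  have [/set_mem At|/negP At] := boolP (t \in Y @^-1` A).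
    have -> : (fun x => Y t + c * x) @^-1` A = setT.
      by apply/seteqP; split=> x //= _; rewrite cE mul0r addr0.
    exact: (@probability_setT _ _ _ gauss).
  have -> : (fun x => Y t + c * x) @^-1` A = set0.
    apply/seteqP; split=> x //=; rewrite cE mul0r addr0 => AY.
    by apply: At; exact: mem_set.
  exact: measure0.
under eq_integral do rewrite secE normal_prob_affine//.
have mF := measurable_normal_prob_mean c0 mA.
have F0 y : (0 <= normal_prob y `|c| A)%E by exact: measure_ge0.
have [vE|vn0] := eqVneq v 0.
  rewrite vE add0r /normal_law sqrf_eq0 (negbTE c0) sqrtr_sqr.
  have lawD B : measurable B -> P (Y @^-1` B) = (\d_(0 : R))%R B.
    by move=> mB'; rewrite lawY// /normal_law vE eqxx.
  by rewrite -(integral_law mY lawD mF F0) integral_dirac// diracT mul1e.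
have v_gt0 : 0 < v by rewrite lt_neqAle eq_sym vn0.
have lawN B : measurable B -> P (Y @^-1` B) = normal_prob 0 (Num.sqrt v) B.
  by move=> mB'; rewrite lawY// /normal_law (negbTE vn0).
rewrite -(@integral_law _ _ _ _ _ P (normal_prob 0 (Num.sqrt v)) Y mY lawN _ mF F0)
  integral_normal_prob_mean//.
by rewrite /normal_law gt_eqF// ltr_wpDr// sqr_ge0.
Qed.

End normal_convolution.

Lemma eq_law_Rintegral {R : realType} {d d' d0} {T : measurableType d}
    {T' : measurableType d'} {U : measurableType d0}
    (P : probability T R) (P' : probability T' R) (X : T -> U) (X' : T' -> U)
    (f : U -> R) (M : R) :
  measurable_fun [set: T] X -> measurable_fun [set: T'] X' ->
  (forall A, measurable A -> P (X @^-1` A) = P' (X' @^-1` A)) ->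
  measurable_fun [set: U] f -> (forall x, `|f x| <= M) ->
  \int[P]_w f (X w) = \int[P']_w f (X' w).
Proof.
move=> mX mX' XX' mf fM.
pose Y : {mfun T' >-> U} := HB.pack X' (isMeasurableFun.Build _ _ _ _ X' mX').
pose Q : probability U R := distribution P' Y.
have fi : intg Q f by exact: intg_bounded mf fM.
rewrite (Rintegral_law (Q := Q) mX XX' fi).
by rewrite (Rintegral_law (Q := Q) mX' (fun A mA => erefl) fi).
Qed.

(** * Moments of the standard normal law *)

Section standard_normal.
Context {R : realType}.
Notation mu := (@lebesgue_measure R).
Local Notation gauss := (normal_prob (0 : R) 1).

(** The weight that turns the density of N(0, 1) into that of N(0, 1 / u^2), up to the factor u;
    hence its mean is 1 / u. For [u < 1] it grows exponentially in x^2 and dominates every power. *)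
Let quad (u x : R) := expR (- ((u ^+ 2 - 1) / 2 * x ^+ 2)).

Let measurable_quad u : measurable_fun [set: R] (quad u).
Proof.
apply: measurableT_comp => //; apply: measurableT_comp => //.
by apply: measurable_funM => //; exact: measurable_funX.
Qed.

Let integral_quad (u : R) : 0 < u -> (\int[gauss]_x (quad u x)%:E = (u^-1)%:E)%E.
Proof.
move=> u0; rewrite integral_normal_prob//; last 2 first.
- by apply/measurable_EFinP; exact: measurable_quad.
- by move=> x; rewrite lee_fin expR_ge0.
transitivity (\int[mu]_x ((u^-1)%:E * (normal_pdf 0 u^-1 x)%:E))%E.
  apply: eq_integral => x _; rewrite -!EFinM; congr (_%:E).
  rewrite !normal_pdfE ?oner_eq0 ?invr_eq0 ?gt_eqF// !normal_peakE /normal_fun.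
  rewrite normr1 mul1r gtr0_norm ?invr_gt0// invfM invrK [RHS]mulrA.
  rewrite [in RHS]mulrA mulVf ?gt_eqF// mul1r mulrCA -expRD; congr (_ * expR _).
  rewrite !subr0 -mulr_natl -(mulr_natl (u^-1 ^+ 2)) expr1n mulr1.
  by field; rewrite gt_eqF.
rewrite ge0_integralZl//.
- by rewrite integral_normal_pdf mule1.
- by apply/measurable_EFinP; exact: measurable_normal_pdf.
- by move=> x _; rewrite lee_fin normal_pdf_ge0.
- by rewrite lee_fin invr_ge0 ltW.
Qed.

Let intg_quad (u : R) : 0 < u -> intg gauss (quad u).
Proof.
move=> u0; apply: ge0_intg => [|x|]; [exact: measurable_quad|by rewrite expR_ge0|].
by rewrite integral_quad// ltry.
Qed.

Let Rintegral_quad (u : R) : 0 < u -> \int[gauss]_x quad u x = u^-1.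
Proof. by move=> u0; rewrite /Rintegral integral_quad. Qed.

Let intg_pow4 : intg gauss (fun x : R => x ^+ 4).
Proof.
apply: (@intg_le _ _ _ gauss (fun x : R => x ^+ 4) (fun x : R => 64 * quad 2^-1 x)).
- exact: measurable_funX.
- by apply: intgZ; exact: intg_quad.
- move=> x; rewrite ger0_norm; last by rewrite exprn_even_ge0.
  (* For u = 1/2 the weight is exp (3 x^2 / 8) = exp y. Since y^2 <= 4 exp y, x^4 = 64 y^2 / 9 is
     below 64 exp y. *)
  set y := 3 / 8 * x ^+ 2; have y0 : 0 <= y by rewrite mulr_ge0 ?sqr_ge0.
  rewrite /quad (_ : - _ = y); last by rewrite /y; field.
  have h0 : x ^+ 4 = 64 / 9 * y ^+ 2 by rewrite /y; field.
  have : y ^+ 2 <= 4 * expR y.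
    have e1 : expR y = expR (y / 2) ^+ 2 by rewrite -expRM_natl; congr expR; lra.
    by have := expR_ge1Dx (y / 2); rewrite e1; nra.
  by have := expR_gt0 y; lra.
Qed.

Lemma intg_normal_sqr : intg gauss (fun x : R => x ^+ 2).
Proof.
apply: (@intg_le _ _ _ gauss (fun x : R => x ^+ 2) (fun x : R => 1 + x ^+ 4)).
- exact: measurable_funX.
- by apply: intgD => //; exact: intg_cst.
- move=> x; rewrite ger0_norm ?sqr_ge0// (exprM x 2 2).
  by have := sqr_ge0 (x ^+ 2 - 1); have := sqr_ge0 (x ^+ 2); nra.
Qed.

Lemma intg_normal_cube : intg gauss (fun x : R => `|x| ^+ 3).
Proof.
apply: (@intg_le _ _ _ gauss (fun x : R => `|x| ^+ 3) (fun x : R => x ^+ 2 + x ^+ 4)).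
- by apply: measurable_funX; exact: normr_measurable.
- by apply: intgD; [exact: intg_normal_sqr|exact: intg_pow4].
- move=> x; rewrite ger0_norm ?exprn_ge0// (exprM x 2 2).
  rewrite -(real_normK (num_real x)).
  have := normr_ge0 x; set y := `|x| => y0.
  by have : 0 <= y ^+ 2 * (y - 1) ^+ 2 by [rewrite mulr_ge0 ?sqr_ge0]; nra.
Qed.

Let m2 : R := \int[gauss]_x (x ^+ 2).

Let m2_le (u : R) : 0 < u -> 1 - m2 * ((u ^+ 2 - 1) / 2) <= u^-1.
Proof.
move=> u0; pose h := (u ^+ 2 - 1) / 2.
have i1 : intg gauss (fun x : R => h * x ^+ 2) by apply: intgZ; exact: intg_normal_sqr.
have i2 : intg gauss (fun x : R => 1 - h * x ^+ 2) by apply: intgB => //; exact: intg_cst.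
have E : \int[gauss]_x (1 - h * x ^+ 2) = 1 - m2 * h.
  rewrite RintegralB//; last exact: intg_cst.
  by rewrite Rintegral_prob_cst RintegralZl ?(mulrC h)//; exact: intg_normal_sqr.
rewrite -[leLHS]E -(Rintegral_quad u0).
apply: le_Rintegral => //; first exact: intg_quad.
by move=> x _; exact: expR_ge1Dx.
Qed.

(** The two sides of [m2_le] are equal at u = 1, where the slopes are - m2 and - 1; as the
    inequality holds on both sides of 1, the slopes must agree. The proof tests it at one explicit
    [u] on each side. *)
Lemma normal_second_moment : \int[gauss]_x (x ^+ 2) = 1.
Proof.
rewrite -/m2.
(* multiplied by [u], the bound [m2_le] reads [(u - 1) (2 - m2 u (u + 1)) <= 0] *)
have key (u : R) : 0 < u -> (u - 1) * (2 - m2 * u * (u + 1)) <= 0.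
  move=> u0; have := m2_le u0; rewrite -(ler_pM2l u0) mulfV ?gt_eqF//.
  nra.
have m20 : 0 <= m2 by apply: Rintegral_ge0 => x _; rewrite sqr_ge0.
apply/eqP; rewrite eq_le; apply/andP; split; rewrite leNgt; apply/negP => h.
(* Chosen so that [m2 * u] is affine in [m2]; [key] then yields (10 m2 - 1) (m2 - 1) <= 0. *)
- pose u := 1 - (m2 - 1) / (3 * m2).
  have m2p : 0 < m2 by lra.
  have e : u * (3 * m2) = 2 * m2 + 1 by rewrite /u; field; rewrite gt_eqF.
  have u0 : 0 < u by rewrite -(@pmulr_lgt0 _ (3 * m2)) ?e; lra.
  have u1 : u < 1 by rewrite -(@ltr_pM2r _ (3 * m2)) ?e; lra.
  have k : m2 * u * (u + 1) <= 2 by have := key u u0; nra.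
  have : (m2 * u) * (m2 * u + m2) <= 2 * m2 by nra.
  have -> : m2 * u = (2 * m2 + 1) / 3 by lra.
  nra.
(* With m2 = 4 - 3 u the second factor of [key] is divisible by u - 1, so the product contains a
   square and is positive. *)
- pose u := 1 + (1 - m2) / 3.
  have u1 : 1 < u by rewrite /u; lra.
  have u2 : u <= 4 / 3 by rewrite /u; lra.
  have e : m2 = 4 - 3 * u by rewrite /u; lra.
  have u0 : 0 < u by lra.
  have k : (u - 1) * ((u - 1) * (3 * u ^+ 2 + 2 * u - 2)) <= 0.
    by have := key u u0; rewrite e; lra.
  have : 0 < (u - 1) * ((u - 1) * (3 * u ^+ 2 + 2 * u - 2)).
    have u1' : 0 < u - 1 by lra.
    by do 2 apply: mulr_gt0 => //; nra.
  lra.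
Qed.

End standard_normal.

Lemma measurable_sin (R : realType) : measurable_fun [set: R] (@sin R).
Proof. by apply: continuous_measurable_fun; exact: continuous_sin. Qed.

(** * The cosine transform of normal laws *)

Section normal_cos.
Context {R : realType}.
Local Notation gauss := (normal_prob (0 : R) 1).

Let mscale (s : R) : measurable_fun [set: R] (fun x => s * x).
Proof. exact: measurable_funM. Qed.

Lemma normal_law_scale (s : R) (A : set R) : measurable A ->
  gauss ((fun x => s * x) @^-1` A) = normal_law 0 (s ^+ 2) A.
Proof.
move=> mA; rewrite /normal_law sqrf_eq0.
have sE : (fun x => s * x) @^-1` A = (fun x => 0 + s * x) @^-1` A.
  by apply/seteqP; split=> x /=; rewrite add0r.
case: eqVneq => [s0|s0]; last first.
  by rewrite sqrtr_sqr sE; exact: normal_prob_affine.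
rewrite diracE; have [/set_mem A0|/negP A0] := boolP (0 \in A).
  have -> : (fun x => s * x) @^-1` A = setT.
    by apply/seteqP; split=> x //= _; rewrite s0 mul0r.
  exact: (@probability_setT _ _ _ gauss).
have -> : (fun x => s * x) @^-1` A = set0.
  apply/seteqP; split=> x //=; rewrite s0 mul0r => A0'.
  by apply: A0; exact: mem_set.
exact: (@measure0 _ _ _ gauss).
Qed.

Let c (s : R) : R := \int[gauss]_x cos (s * x).

Let mcos (s : R) : measurable_fun [set: R] (fun x => cos (s * x)).
Proof. by apply: measurableT_comp; [exact: measurable_cos|exact: mscale]. Qed.

Let msin (s : R) : measurable_fun [set: R] (fun x => sin (s * x)).
Proof. by apply: measurableT_comp; [exact: measurable_sin|exact: mscale]. Qed.

Let icos s : intg gauss (fun x : R => cos (s * x)).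
Proof. by apply: (@intg_bounded _ _ _ gauss _ 1) => [|z]; [exact: mcos|exact: cos_max]. Qed.

Let isin s : intg gauss (fun x : R => sin (s * x)).
Proof. by apply: (@intg_bounded _ _ _ gauss _ 1) => [|z]; [exact: msin|exact: sin_max]. Qed.

(** A standard normal variable and its opposite have the same law, and sine is odd. *)
Let Rintegral_sin s : \int[gauss]_x sin (s * x) = 0 :> R.
Proof.
have h : \int[gauss]_x sin (s * x) = \int[gauss]_x sin (s * ((-1) * x)) :> R.
  apply: (@eq_law_Rintegral _ _ _ _ _ _ _ gauss gauss id (fun x => -1 * x)
    (fun x => sin (s * x)) 1).
  - exact: measurable_id.
  - exact: mscale.
  - move=> A mA; transitivity (normal_law 0 ((-1) ^+ 2) A); last first.
      exact/esym/(normal_law_scale (-1) mA).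
    rewrite sqrrN -(normal_law_scale 1 mA); congr (gauss _).
    by apply/seteqP; split=> x /=; rewrite mul1r.
  - exact: msin.
  - by move=> x; rewrite sin_max.
have h2 : \int[gauss]_x sin (s * ((-1) * x)) = - \int[gauss]_x sin (s * x) :> R.
  rewrite -Rintegral_Nfun//; apply: eq_Rintegral => x _.
  by rewrite mulN1r mulrN sinN.
by move: h; rewrite h2 => /eqP; rewrite -subr_eq0 opprK -mulr2n mulrn_eq0 => /eqP.
Qed.

(** For independent standard normal N and N', s N + t N' has the law of sqrt (s^2 + t^2) N. In the
    addition formula the product of sines integrates to 0. *)
Let cD (s t : R) : c (Num.sqrt (s ^+ 2 + t ^+ 2)) = c s * c t.
Proof.
have q0 : 0 <= s ^+ 2 + t ^+ 2 by rewrite addr_ge0 ?sqr_ge0.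
transitivity (\int[(gauss \x gauss)%E]_z (cos (s * z.1 + t * z.2))); last first.
  transitivity (\int[(gauss \x gauss)%E]_z
      (cos (s * z.1) * cos (t * z.2) - sin (s * z.1) * sin (t * z.2))).
    by apply: eq_Rintegral => z _; rewrite cosD.
  rewrite RintegralB//; last 2 first.
  - exact: (intg_prodM (icos s) (icos t)).
  - exact: (intg_prodM (isin s) (isin t)).
  rewrite (Rintegral_prodM (icos s) (icos t)) (Rintegral_prodM (isin s) (isin t)).
  by rewrite !Rintegral_sin mul0r subr0.
apply: (@eq_law_Rintegral _ _ _ _ _ _ _ gauss (gauss \x gauss)%E
  (fun x => Num.sqrt (s ^+ 2 + t ^+ 2) * x) (fun z => s * z.1 + t * z.2) (@cos R) 1).
- exact: mscale.
- apply: measurable_funD.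
    exact: measurableT_comp (mscale s) measurable_fst.
  exact: measurableT_comp (mscale t) measurable_snd.
- move=> A mA; apply: (etrans (normal_law_scale _ mA)); rewrite sqr_sqrtr//.
  have := @normal_law_add R _ _ gauss (fun x => s * x) (s ^+ 2) t (mscale s) (sqr_ge0 s).
  by move=> h; apply/esym/h => // B mB; exact: normal_law_scale.
- exact: measurable_cos.
- by move=> x; rewrite cos_max.
Qed.

Let c_le1 s : `|c s| <= 1.
Proof.
rewrite -[leRHS](Rintegral_prob_cst gauss); apply: Rintegral_le_norm => [||x];
  [exact: mcos|exact: intg_cst|exact: cos_max].
Qed.

Let m3 : R := \int[gauss]_x (`|x| ^+ 3).

Let c_taylor s : 0 <= s -> `|c s - (1 - s ^+ 2 / 2)| <= s ^+ 3 * m3.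
Proof.
move=> s0; rewrite /m3 -RintegralZl//; last exact: intg_normal_cube.
have i2 : intg gauss (fun x : R => s ^+ 2 / 2 * x ^+ 2) by apply: intgZ; exact: intg_normal_sqr.
have -> : c s - (1 - s ^+ 2 / 2) =
    \int[gauss]_x (cos (s * x) - (1 - s ^+ 2 / 2 * x ^+ 2)).
  rewrite RintegralB//; last by apply: intgB => //; exact: intg_cst.
  rewrite RintegralB//; last exact: intg_cst.
  by rewrite RintegralZl ?normal_second_moment ?mulr1 ?Rintegral_prob_cst//; exact: intg_normal_sqr.
apply: Rintegral_le_norm.
- apply: measurable_funB; first exact: mcos.
  apply: measurable_funB; first exact: measurable_cst.
  by apply: measurable_funM => //; exact: measurable_funX.
- by apply: intgZ; exact: intg_normal_cube.
- move=> x; have := cos_taylor 0 (s * x); rewrite add0r cos0 sin0 mulr0 subr0 mulr1.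
  rewrite (_ : (s * x) ^+ 2 / 2 = s ^+ 2 / 2 * x ^+ 2); last by field.
  by rewrite normrM exprMn (ger0_norm s0).
Qed.

Let cX (s : R) n : 0 <= s -> c (Num.sqrt n%:R * s) = c s ^+ n.
Proof.
move=> s0; elim: n => [|n ih].
  rewrite sqrtr0 mul0r expr0 /c; under eq_Rintegral do rewrite mul0r cos0.
  by rewrite Rintegral_prob_cst.
rewrite exprSr -ih -cD; congr c.
rewrite exprMn sqr_sqrtr ?ler0n//.
rewrite (_ : _ + _ = n.+1%:R * s ^+ 2); last by rewrite -natr1; ring.
by rewrite sqrtrM ?ler0n// sqrtr_sqr ger0_norm.
Qed.

Let distX (a b : R) n : `|a| <= 1 -> `|b| <= 1 -> `|a ^+ n - b ^+ n| <= n%:R * `|a - b|.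
Proof.
move=> a1 b1; elim: n => [|n ih]; first by rewrite !expr0 subrr normr0 mul0r.
rewrite !exprS (_ : _ - _ = a * (a ^+ n - b ^+ n) + (a - b) * b ^+ n); last by ring.
rewrite (le_trans (ler_normD _ _))// -natr1 [leRHS]mulrDl mul1r lerD// normrM.
  by rewrite (le_trans _ ih)// ler_piMl.
by rewrite ler_piMr// normrX exprn_ile1.
Qed.

(* [c s = E cos (s N)] satisfies [c (sqrt n s) = c s ^ n] by stability of the
   normal law, so that it is determined by its expansion at 0. *)
Lemma normal_cos (t : R) : 0 <= t ->
  \int[gauss]_x cos (t * x) = expR (- (t ^+ 2 / 2)).
Proof.
move=> t0; rewrite -/(c t); apply/eqP/negPn/negP => ne.
pose e := `|c t - expR (- (t ^+ 2 / 2))|.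
have e0 : 0 < e by rewrite normr_gt0 subr_eq0.
(* With r = 1 / sqrt n, the Taylor errors of [c] and of the exponential at r t, multiplied by n, add
   up to r t^3 m3 + r^2 t^4 / 4, at most K r. *)
pose K := t ^+ 3 * m3 + t ^+ 4 / 4.
have m30 : 0 <= m3 by apply: Rintegral_ge0 => *; rewrite exprn_ge0.
have K0 : 0 <= K by rewrite addr_ge0 ?mulr_ge0 ?exprn_ge0.
have bnd n : (0 < n)%N -> e <= K * (Num.sqrt n%:R)^-1.
  move=> n0; set r := (Num.sqrt n%:R)^-1.
  have n0' : (0 : R) < n%:R by rewrite ltr0n.
  have sn0 : 0 < Num.sqrt n%:R :> R by rewrite sqrtr_gt0.
  have r0 : 0 < r by rewrite invr_gt0.
  have nr2 : n%:R * r ^+ 2 = 1 by rewrite /r exprVn sqr_sqrtr ?ler0n// mulfV// gt_eqF.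
  have r1 : r <= 1.
    by have : (1 : R) <= n%:R by [rewrite ler1n]; nra.
  have rt0 : 0 <= r * t by rewrite mulr_ge0// ltW.
  have ctE : c t = c (r * t) ^+ n.
    by rewrite -cX// mulrA /r mulfV ?mul1r// gt_eqF.
  have etE : expR (- (t ^+ 2 / 2)) = expR (- ((r * t) ^+ 2 / 2)) ^+ n.
    rewrite -expRM_natl; congr expR.
    by transitivity (- (t ^+ 2 / 2) * (n%:R * r ^+ 2)); [rewrite nr2 mulr1|ring].
  rewrite /e ctE etE.
  have y0 : 0 <= (r * t) ^+ 2 / 2 by rewrite mulr_ge0// sqr_ge0.
  apply: (le_trans (distX _ (c_le1 _) _)).
    by rewrite ger0_norm ?expR_ge0// -[leRHS]expR0 ler_expR oppr_le0.
  have h1 := c_taylor rt0; have h2 := expRN_taylor y0.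
  have h : `|c (r * t) - expR (- ((r * t) ^+ 2 / 2))| <=
      r ^+ 2 * (r * (t ^+ 3 * m3)) + r ^+ 2 * (r * r * (t ^+ 4 / 4)).
    rewrite (_ : r ^+ 2 * (r * (t ^+ 3 * m3)) = (r * t) ^+ 3 * m3); last by ring.
    rewrite (_ : r ^+ 2 * (r * r * (t ^+ 4 / 4)) = ((r * t) ^+ 2 / 2) ^+ 2); last by field.
    rewrite (_ : _ - _ = (c (r * t) - (1 - (r * t) ^+ 2 / 2)) -
      (expR (- ((r * t) ^+ 2 / 2)) - (1 - (r * t) ^+ 2 / 2))); last by ring.
    by rewrite (le_trans (ler_normB _ _))// lerD.
  apply: (le_trans (ler_wpM2l (ltW n0') h)).
  rewrite [leLHS](_ : _ = (n%:R * r ^+ 2) * (r * (t ^+ 3 * m3) + r * r * (t ^+ 4 / 4)));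
    last by ring.
  rewrite nr2 mul1r /K.
  have t4 : 0 <= r * (t ^+ 4 / 4) by rewrite mulr_ge0 ?(ltW r0)// divr_ge0 ?exprn_ge0.
  by have := ler_wpM2r t4 r1; lra.
have [n [n0]] : exists n, (0 < n)%N /\ K * (Num.sqrt n%:R)^-1 < e.
  have : (K * (Num.sqrt n%:R)^-1) @[n --> \oo] --> K * 0.
    by apply: cvgM; [exact: cvg_cst|exact: cvg_invsqrt].
  rewrite mulr0 => /cvgr_lt /(_ _ e0) [N _ hN].
  by exists N.+1; split=> //; apply: hN => /=.
by rewrite ltNge bnd.
Qed.

Lemma normal_law_cos {d} {T : measurableType d} (P : probability T R)
    (Y : T -> R) (v b : R) : measurable_fun [set: T] Y -> 0 <= v ->
  (forall A, measurable A -> P (Y @^-1` A) = normal_law 0 v A) ->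
  \int[P]_w cos (b + Y w) = expR (- v / 2) * cos b.
Proof.
move=> mY v0 lawY.
transitivity (\int[gauss]_x cos (b + Num.sqrt v * x)).
  apply: (@eq_law_Rintegral _ _ _ _ _ _ _ P gauss Y (fun x => Num.sqrt v * x)
    (fun y => cos (b + y)) 1).
  - exact: mY.
  - exact: mscale.
  - move=> A mA; rewrite lawY//; apply/esym.
    by apply: (etrans (normal_law_scale _ mA)); rewrite sqr_sqrtr.
  - apply: (measurableT_comp (f := @cos R)); first exact: measurable_cos.
    exact: measurable_funD.
  - by move=> x; rewrite cos_max.
transitivity (\int[gauss]_x (cos b * cos (Num.sqrt v * x) - sin b * sin (Num.sqrt v * x))).
  by apply: eq_Rintegral => x _; rewrite cosD.
rewrite RintegralB//; [|exact: intgZ..].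
rewrite !RintegralZl// Rintegral_sin mulr0 subr0 normal_cos ?sqrtr_ge0//.
by rewrite sqr_sqrtr// mulrC mulNr.
Qed.

End normal_cos.

(** * Square roots of positive semidefinite matrices *)

(** Used to write a function of the eigenvalues of a matrix as a polynomial in that matrix. Repeated
    values are skipped, so the eigenvalues may have multiplicities. *)
Lemma poly_interpolation (F : fieldType) (s : seq F) (f : F -> F) :
  exists q : {poly F}, {in s, forall x, q.[x] = f x}.
Proof.
elim: s => [|a s [q qE]]; first by exists 0.
have [as_|as_] := boolP (a \in s).
  by exists q => x; rewrite inE => /predU1P[->|]; exact: qE.
pose w := \prod_(b <- s) ('X - b%:P).
have wa : w.[a] != 0.
  by rewrite -/(root w a) root_prod_XsubC.
exists (q + ((f a - q.[a]) / w.[a]) *: w) => x.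
rewrite inE !hornerE => /predU1P[->|xs].
  by rewrite divfK// addrC subrK.
have /eqP -> : w.[x] == 0 by rewrite -/(root w x) root_prod_XsubC.
by rewrite mulr0 addr0 qE.
Qed.

Lemma trmx_horner_mx (F : comNzRingType) n (A : 'M[F]_n.+1) (p : {poly F}) :
  (horner_mx A p)^T = horner_mx A^T p.
Proof.
elim/poly_ind: p => [|p c ih]; first by rewrite !rmorph0 trmx0.
rewrite !(rmorphD, rmorphM)/= !horner_mx_X !horner_mx_C linearD/= tr_scalar_mx.
rewrite trmx_mul ih; congr (_ + _).
by have := comm_horner_mx2 A^T 'X p; rewrite horner_mx_X.
Qed.

Section psd_square_root.
Variables (R : realType) (C : numClosedFieldType) (f : {rmorphism R -> C}).
Hypotheses (freal : forall x, f x \is Num.real)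
  (realf : forall z, z \is Num.real -> exists x, z = f x).

(* A is diagonalized over C; the square root is a polynomial in A, hence real
   and symmetric, and it is itself the square of a symmetric matrix. *)
Lemma psdmx_sqrt_embed n (A : 'M[R]_n) : psdmx A ->
  exists S : 'M[R]_n, psdmx S /\ S *m S = A.
Proof.
case: n A => [|n] A [Asym Apsd].
  by exists 0; split; [split=> [|u]; rewrite ?trmx0// mulmx0 mul0mx mxE|by apply/matrixP => -[]].
pose A' := map_mx f A.
have A'real : A' \is a mxOver Num.real.
  by apply/mxOverP => i j; rewrite !mxE freal.
have A'herm : A' \is hermsymmx.
  apply: realsym_hermsym => //; apply/is_hermitianmxP.
  by rewrite expr0 scale1r; apply/matrixP => i j; rewrite !mxE /= -[in LHS]Asym mxE.
have A'diag := orthomx_spectralP (hermitian_normalmx A'herm).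
have Dreal := hermitian_spectral_diag_real A'herm.
set V := spectralmx A' in A'diag; set D := spectral_diag A' in A'diag Dreal.
have Vu : V \is a GRing.unit by exact: spectral_unit.
clearbody V D.
have VA : V *m A' = diag_mx D *m V.
  by have := congr1 (mulmx V) A'diag; rewrite !mulmxA mulmxV// mul1mx.
have DE i : {x | D 0 i = f x}.
  by apply/cid/realf; move/mxOverP : Dreal; apply.
pose E : 'rV_n.+1 := \row_i sval (DE i).
have DfE : D = map_mx f E by apply/rowP => i; rewrite !mxE; case: (DE i).
(* Each diagonal entry is an eigenvalue of [A'], hence of the real matrix [A]; it therefore has a
   real eigenvector, on which the quadratic form can be tested. *)
have D0 i : 0 <= E 0 i.
  have : eigenvalue A' (D 0 i).
    apply/eigenvalueP; exists (row i V).
      by rewrite -row_mul VA; apply/rowP => j; rewrite mxE mul_diag_mx !mxE.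
    apply/eqP => r0; have := congr1 (fun M => (row i M) 0 i) (mulmxV Vu).
    by rewrite row_mul r0 mul0mx !mxE eqxx => /eqP; rewrite eq_sym oner_eq0.
  rewrite DfE mxE eigenvalue_map => /eigenvalueP[v vA v0].
  have := Apsd v^T; rewrite trmxK vA -scalemxAl mxE => h.
  have vv : 0 < (v *m v^T) 0 0.
    have vvE : (v *m v^T) 0 0 = \sum_j v 0 j ^+ 2.
      by rewrite mxE; apply: eq_bigr => j _; rewrite mxE expr2.
    have vv0 : 0 <= (v *m v^T) 0 0 by rewrite vvE sumr_ge0// => j _; rewrite sqr_ge0.
    rewrite lt_neqAle vv0 andbT eq_sym vvE; apply: contra_neq v0.
    move/eqP; rewrite psumr_eq0 => [/allP vj|j _]; last exact: sqr_ge0.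
    apply/rowP => j; rewrite mxE; apply/eqP; rewrite -sqrf_eq0.
    by apply: vj; rewrite mem_index_enum.
  by rewrite -(pmulr_lge0 _ vv).
(* Fourth roots rather than square roots: the square of the symmetric [T] is then positive
   semidefinite without a second look at eigenvalues. *)
pose fr (x : R) := Num.sqrt (Num.sqrt x).
have fr4 (x : R) : 0 <= x -> fr x ^+ 4 = x.
  by move=> x0; rewrite (exprM _ 2 2) /fr sqr_sqrtr ?sqrtr_ge0// sqr_sqrtr.
have [q qE] := poly_interpolation [seq E 0 i | i <- enum 'I_n.+1] fr.
have q4 i : (q ^+ 4).[E 0 i] = E 0 i.
  rewrite horner_exp qE; first exact: fr4.
  by apply: (map_f (fun i => E 0 i)); rewrite mem_enum.
pose T := horner_mx A q.
have T4 : T ^+ 4 = A.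
  rewrite /T -rmorphXn/=.
  apply: (@map_mx_inj _ _ f) => /=.
  rewrite map_horner_mx -/A' A'diag DfE horner_mx_uconjC// horner_mx_diag.
  congr (_ *m diag_mx _ *m _); apply/rowP => i; rewrite mxE.
  by rewrite mxE horner_map/= q4 mxE.
have Tsym : T^T = T by rewrite /T trmx_horner_mx Asym.
exists (T *m T); split.
  split; first by rewrite trmx_mul Tsym.
  move=> u; rewrite (_ : _ *m _ = (T *m u)^T *m (T *m u)); last first.
    by rewrite trmx_mul Tsym !mulmxA.
  rewrite mxE sumr_ge0// => i _; rewrite mxE.
  by rewrite -expr2 sqr_ge0.
by rewrite -[RHS]T4 (exprM T 2 2) !expr2.
Qed.

End psd_square_root.

Lemma psdmx_sqrt_exists (R : realType) n (A : 'M[R]_n) : psdmx A ->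
  exists S : 'M[R]_n, psdmx S /\ S *m S = A.
Proof.
apply: (@psdmx_sqrt_embed R (R[i])%C (real_complex R)) => [x|z zr].
  by apply/complex_realP; exists x.
by apply/complex_realP.
Qed.

Lemma sqrtmxP (R : realType) n (A : 'M[R]_n) : psdmx A ->
  psdmx (sqrtmx A) /\ sqrtmx A *m sqrtmx A = A.
Proof.
move=> /psdmx_sqrt_exists [S SA].
exact: (@xgetPex _ 0 [set S | psdmx S /\ S *m S = A] (ex_intro _ S SA)).
Qed.

(** * Normal vectors *)

Section gaussian_vectors.
Context {R : realType}.
Local Notation gauss := (normal_prob (0 : R) 1).

Lemma measurable_dot {d} {T : measurableType d} n (u : 'cV[R]_n) (Z : T -> 'cV[R]_n) :
  random_vector Z -> measurable_fun [set: T] (fun w => (u^T *m Z w) 0 0).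
Proof.
move=> mZ; under eq_fun do rewrite mxE.
by apply: measurable_sum => i; exact: measurable_funM.
Qed.

Lemma psdmx_gram n k (L : 'M[R]_(n, k)) : psdmx (L *m L^T).
Proof.
split=> [|u]; first by rewrite trmx_mul trmxK.
rewrite (_ : _ *m _ = (L^T *m u)^T *m (L^T *m u)); last first.
  by rewrite trmx_mul trmxK !mulmxA.
by rewrite mxE sumr_ge0// => i _; rewrite mxE -expr2 sqr_ge0.
Qed.

(** Induction on the columns of [L]: a column [a] contributes N a, with N standard normal on a new
    factor of the probability space. Each linear form then gains an independent normal term, handled
    by [normal_law_add]. *)
Lemma gram_normal_exists n k (L : 'M[R]_(n, k)) :
  exists (d : measure_display) (T : measurableType d) (P : probability T R)
    (Z : T -> 'cV[R]_n), multivariate_normal P Z 0 (L *m L^T).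
Proof.
elim: k L => [|k IH] L.
  exists _, _, gauss, (fun=> 0); split.
  - by move=> i; exact: measurable_cst.
  - exact: psdmx_gram.
  move=> u A mA; rewrite mulmx0 [L]thinmx0 mul0mx mulmx0 mul0mx mxE.
  rewrite /normal_law eqxx diracE.
  have [/set_mem A0|/negP A0] := boolP (0 \in A).
    rewrite (_ : [set _ | _] = setT); first exact: (@probability_setT _ _ _ gauss).
    by apply/seteqP; split=> // x.
  rewrite (_ : [set _ | _] = set0); first exact: (@measure0 _ _ _ gauss).
  by apply/seteqP; split=> // x /= h; apply: A0; exact: mem_set.
pose a : 'cV[R]_n := lsubmx (L : 'M[R]_(n, 1 + k)).
pose L0 : 'M[R]_(n, k) := rsubmx (L : 'M[R]_(n, 1 + k)).
have LE : L *m L^T = L0 *m L0^T + a *m a^T.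
  transitivity (row_mx a L0 *m (row_mx a L0)^T); first by rewrite hsubmxK.
  by rewrite tr_row_mx mul_row_col addrC.
have [d [T [P [Z [mZ _ lawZ]]]]] := IH L0.
exists _, _, (P \x gauss)%E, (fun z => Z z.1 + z.2 *: a); split.
- move=> i; under eq_fun do rewrite !mxE.
  apply: measurable_funD; first exact: measurableT_comp (mZ i) measurable_fst.
  by apply: measurable_funM => //; exact: measurable_snd.
- exact: psdmx_gram.
move=> u A mA; have v0 : 0 <= (u^T *m (L0 *m L0^T) *m u) 0 0 by have [_] := psdmx_gram L0.
have lawY B : measurable B -> P ((fun t => (u^T *m Z t) 0 0) @^-1` B) =
    normal_law 0 ((u^T *m (L0 *m L0^T) *m u) 0 0) B.
  by move=> mB; have := lawZ u B mB; rewrite mulmx0 mxE.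
have := normal_law_add ((u^T *m a) 0 0) (measurable_dot u mZ) v0 lawY mA.
have -> : (u^T *m (0 : 'cV[R]_n)) 0 0 = 0 by rewrite mulmx0 mxE.
have -> : (u^T *m (L *m L^T) *m u) 0 0 =
    (u^T *m (L0 *m L0^T) *m u) 0 0 + (u^T *m (a *m a^T) *m u) 0 0.
  by rewrite LE mulmxDr mulmxDl mxE.
have -> : (u^T *m (a *m a^T) *m u) 0 0 = (u^T *m a) 0 0 ^+ 2.
  rewrite mulmxA -(mulmxA (u^T *m a)) mxE big_ord1 expr2; congr (_ * _).
  by rewrite -[a^T *m u]trmxK trmx_mul trmxK mxE.
move=> <-; congr ((P \x gauss)%E _); apply/seteqP; split=> z /=;
  by rewrite mulmxDr -scalemxAr !mxE mulrC.
Qed.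

Lemma normal_exists n (C : 'M[R]_n) : psdmx C ->
  exists (d : measure_display) (T : measurableType d) (P : probability T R)
    (Z : T -> 'cV[R]_n), multivariate_normal P Z 0 C.
Proof.
move=> /psdmx_sqrt_exists [S [[Ssym _] SC]].
by have := gram_normal_exists S; rewrite Ssym SC.
Qed.

Lemma multivariate_normal_mulmx {d} {T : measurableType d} (P : probability T R)
    n m (Z : T -> 'cV[R]_n) (C : 'M[R]_n) (L : 'M[R]_(m, n)) :
  multivariate_normal P Z 0 C ->
  multivariate_normal P (fun w => L *m Z w) 0 (L *m C *m L^T).
Proof.
move=> [mZ [Csym Cpsd] lawZ]; split.
- move=> i; under eq_fun do rewrite mxE.
  apply: measurable_sum => j; exact: measurable_funM.
- split=> [|u]; first by rewrite !trmx_mul trmxK Csym mulmxA.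
  by have := Cpsd (L^T *m u); rewrite trmx_mul trmxK !mulmxA.
move=> u A mA; have := lawZ (L^T *m u) A mA.
rewrite trmx_mul trmxK !mulmx0 !mulmxA => <-.
by congr (P _); apply/seteqP; split=> w /=; rewrite mulmxA.
Qed.

Lemma multivariate_normal_cos {d} {T : measurableType d} (P : probability T R)
    n (Z : T -> 'cV[R]_n) (C : 'M[R]_n) (u : 'cV[R]_n) (b : R) :
  multivariate_normal P Z 0 C ->
  \int[P]_w cos (b + (u^T *m Z w) 0 0) =
  expR (- (u^T *m C *m u) 0 0 / 2) * cos b.
Proof.
move=> [mZ [Csym Cpsd] lawZ]; apply: normal_law_cos => //.
  exact: measurable_dot.
by move=> A mA; have := lawZ u A mA; rewrite mulmx0 mxE.
Qed.

End gaussian_vectors.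

(** * Convergence of cosine moments implies convergence in distribution *)

Section uniform_continuity_on_boxes.
Context {R : realType}.

(** Uniform continuity with only [x] in the compact set: later [y] is a maximizer, known only to be
    close to a point of a box. *)
Lemma near_covering_unif (V : pseudoMetricType R) (B : set V) (g : V -> R) (e : R) :
  compact B -> continuous g -> 0 < e ->
  exists2 r : R, 0 < r & forall x y, B x -> ball x r y -> `|g x - g y| <= e.
Proof.
move=> /compact_near_coveringP cB cg e0.
pose Q (r : R) (x : V) := forall y, ball x r y -> `|g x - g y| <= e.
have hB x : B x -> \forall x' \near x & r \near 0^'+, Q r x'.
  move=> Bx.
  have /cvgrPdist_le /(_ (e / 2)) := cg x; rewrite divr_gt0// => /(_ isT).
  rewrite -nbhs_ballE => -[r /= r0 hr].
  exists (ball x (r / 2), [set s | 0 < s < r / 2]) => /=.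
    split; first by apply: nbhsx_ballx; rewrite divr_gt0.
    near=> s; apply/andP; split; near: s; first exact: nbhs_right_gt.
    by apply: nbhs_right_lt; rewrite divr_gt0.
  move=> [x' s] /= [xx' /andP[s0 sr]] y x'y.
  have xx'r : ball x r x' by apply: le_ball xx'; lra.
  have xyr : ball x r y.
    rewrite [r]splitr; apply: ball_triangle xx' _.
    by apply: le_ball x'y; exact: ltW.
  rewrite (_ : g x' - g y = (g x - g y) - (g x - g x')); last by ring.
  by rewrite (le_trans (ler_normB _ _))// [leRHS]splitr lerD//; exact: hr.
have h := cB R (0^'+) Q _ hB; near (0 : R)^'+ => r.
exists r => //.
move=> x y Bx xy; have /(_ x Bx y xy) : B `<=` Q r by near: r; exact: h.
by [].
Unshelve. all: by end_near.
Qed.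

Lemma box_unif n (g : 'cV[R]_n -> R) (K e : R) : continuous g -> 0 < e ->
  exists2 r : R, 0 < r & forall x y : 'cV[R]_n, (forall k, `|x k 0| <= K) ->
    (forall k, `|x k 0 - y k 0| < r) -> `|g x - g y| <= e.
Proof.
move=> cg e0.
(* Boxes are compact as sets of row vectors, hence the transpositions. *)
have cgt : continuous (fun v : 'rV[R]_n => g v^T).
  move=> v; apply: continuous_comp; last exact: cg.
  move=> U /nbhs_ballP[s s0 sU]; apply/nbhs_ballP; exists s => // v' h.
  by apply: sU; split=> [|i j]; rewrite ?mxE; [exact: s0|have [_ h2] := h; exact: h2].
pose B : set 'rV[R]_n := [set v | forall k, `[- K, K]%classic (v ord0 k)].
have cB : compact B.
  by apply: (@rV_compact R n (fun=> `[- K, K]%classic)) => i; exact: segment_compact.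
have [r r0 hr] := near_covering_unif cB cgt e0.
exists r => // x y xK xy; have := hr x^T y^T; rewrite !trmxK; apply.
  by move=> k; rewrite /= mxE in_itv /= -ler_norml.
by split=> [|i j]; [exact: r0|rewrite !mxE ord1; exact: xy].
Unshelve. all: by end_near.
Qed.

End uniform_continuity_on_boxes.

(** * Density of trigonometric polynomials on boxes *)

Section sine_injectivity.
Context {R : realType}.

(* [sin y - sin z = 2 sin((y - z) / 2) cos((y + z) / 2)], where the arguments
   stay in [|w| <= 5 / 4] and in [|w| <= pi / 2 - 1 / 4] respectively *)
Lemma sin_dist_ge (y z : R) : `|y| <= pi / 2 -> `|z| <= 1 / 2 ->
  `|y - z| <= 10 * `|sin y - sin z|.
Proof.
have pi2 := @pihalf_lt2 R; have pi1 := @pihalf_ge1 R.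
move=> /ler_normlP[y1 y2] /ler_normlP[z1 z2].
pose a := (y - z) / 2; pose b := (y + z) / 2.
have -> : sin y - sin z = 2 * (sin a * cos b).
  have -> : y = b + a by rewrite /a /b; field.
  have -> : z = b - a by rewrite /a /b; field.
  by rewrite (sinD b a) (sinB b a); ring.
(* On [0, 5/4], w^2 / 6 <= 25/96 < 3/10. Then cos b >= sin (1/4) >= 7/40 > 17/100, and the factor 10
   in the lemma suffices because 10 * (7/10) * (17/100) > 1. *)
have sin_lb (w : R) : 0 <= w -> w <= 5 / 4 -> 7 / 10 * w <= sin w.
  move=> w0 w1; have := sin_ge_cube w0.
  have : 0 <= w * (25 / 16 - w ^+ 2) by rewrite mulr_ge0//; nra.
  by lra.
have cb : 17 / 100 <= cos b.
  rewrite -cos_norm; have nb : `|b| <= pi / 2 - 1 / 4 by rewrite ler_norml /b; lra.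
  have : sin (1 / 4) <= cos `|b|.
    rewrite (_ : sin (1 / 4) = cos (pi / 2 - 1 / 4)); last first.
      by rewrite -cosBpihalf -cosN; congr cos; ring.
    have := normr_ge0 b; rewrite le_eqVlt in nb; case/orP: nb => [/eqP ->//|nb nb0].
    by apply/ltW; rewrite ltr_cos ?in_itv//=; lra.
  by have := @sin_lb (1 / 4); lra.
have sa : 7 / 10 * `|a| <= `|sin a|.
  have na : `|a| <= 5 / 4 by rewrite ler_norml /a; lra.
  have := sin_lb _ (normr_ge0 a) na; case: (ger0P a) => _ h.
    exact: le_trans h (ler_norm _).
  by rewrite (le_trans h)// sinN -normrN ler_norm.
have -> : y - z = 2 * a by rewrite /a; field.
rewrite (normrM 2 a) (normrM 2 (_ * _)) (normrM (sin a)) normr_nat (@ger0_norm _ (cos b));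
  last by lra.
have := ler_wpM2l (normr_ge0 (sin a)) cb; have := normr_ge0 a; lra.
Qed.

End sine_injectivity.

Section bernstein_weights.
Context {R : realType}.

(** The binomial probability of [i] successes in [N] trials, defined by conditioning on one trial.
    The same recursion shows that these weights are trigonometric polynomials whenever [s] is
    one. *)
Fixpoint bernstein (s : R) (N i : nat) : R :=
  if N is N'.+1 then
    (1 - s) * bernstein s N' i + s * (if i is i'.+1 then bernstein s N' i' else 0)
  else (i == 0%N)%:R.

Lemma bernstein_ge0 s N i : 0 <= s <= 1 -> 0 <= bernstein s N i.
Proof.
move=> /andP[s0 s1]; elim: N i => [|N ih] [|i]//=.
  by rewrite mulr0 addr0 mulr_ge0// subr_ge0.
by rewrite addr_ge0// mulr_ge0// subr_ge0.
Qed.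

Lemma bernstein_eq0 s N i : (N < i)%N -> bernstein s N i = 0.
Proof.
elim: N i => [|N ih] [|i]//=; rewrite ltnS => Ni.
by rewrite !ih ?mulr0 ?addr0// ltnW.
Qed.

Lemma bernstein_sumS s N (f : nat -> R) :
  \sum_(i < N.+2) f i * bernstein s N.+1 i =
  (1 - s) * (\sum_(i < N.+1) f i * bernstein s N i) +
  s * (\sum_(i < N.+1) f i.+1 * bernstein s N i).
Proof.
rewrite !mulr_sumr big_ord_recl /= mulr0 addr0.
under [X in _ + X = _]eq_bigr do rewrite /= mulrDr.
rewrite big_split /= addrA; congr (_ + _); last by apply: eq_bigr => i _; rewrite mulrCA.
rewrite [RHS]big_ord_recl /= mulrCA; congr (_ + _).
rewrite big_ord_recr /= bernstein_eq0 ?ltnSn// !mulr0 addr0.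
by apply: eq_bigr => i _; rewrite mulrCA.
Qed.

Lemma bernstein_sum1 s N : \sum_(i < N.+1) bernstein s N i = 1.
Proof.
elim: N => [|N ih]; first by rewrite big_ord1.
have := bernstein_sumS s N (fun=> 1); under eq_bigr do rewrite mul1r.
by move=> ->; under eq_bigr do rewrite mul1r; rewrite ih; ring.
Qed.

(** The center [c] is arbitrary because a success in the removed trial shifts it to [c - 1] in the
    induction. *)
Lemma bernstein_variance s N (c : R) :
  \sum_(i < N.+1) (i%:R - c) ^+ 2 * bernstein s N i =
  N%:R * (s * (1 - s)) + (N%:R * s - c) ^+ 2.
Proof.
elim: N c => [|N ih] c; first by rewrite big_ord1 /=; ring.
rewrite (bernstein_sumS s N (fun i => (i%:R - c) ^+ 2)) ih.
have -> : \sum_(i < N.+1) (i.+1%:R - c) ^+ 2 * bernstein s N i =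
    \sum_(i < N.+1) (i%:R - (c - 1)) ^+ 2 * bernstein s N i.
  by apply: eq_bigr => i _; rewrite -natr1; congr (_ ^+ 2 * _); ring.
rewrite ih -natr1; ring.
Qed.

End bernstein_weights.

Section trigonometric_polynomials.
Context {R : realType} {n : nat}.
Implicit Types (p q : 'cV[R]_n -> R) (u x : 'cV[R]_n).

(** The triples are coefficient, frequency vector and phase. Phases include the sines and make the
    class stable under products; frequencies are arbitrary, so no period is imposed. *)
Definition trigpoly p := exists s : seq (R * 'cV[R]_n * R),
  forall x, p x = \sum_(t <- s) t.1.1 * cos (t.2 + (t.1.2^T *m x) 0 0).

Lemma trigpoly_cos u b : trigpoly (fun x => cos (b + (u^T *m x) 0 0)).
Proof. by exists [:: (1, u, b)] => x; rewrite big_seq1 mul1r. Qed.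

Lemma trigpolyZ c p : trigpoly p -> trigpoly (fun x => c * p x).
Proof.
move=> [s sE]; exists [seq (c * t.1.1, t.1.2, t.2) | t <- s] => x.
by rewrite sE big_map mulr_sumr; apply: eq_bigr => t _ /=; rewrite mulrA.
Qed.

Lemma trigpolyD p q : trigpoly p -> trigpoly q -> trigpoly (fun x => p x + q x).
Proof. by move=> [s sE] [t tE]; exists (s ++ t) => x; rewrite sE tE big_cat. Qed.

Lemma trigpoly_cst c : trigpoly (fun=> c).
Proof.
by exists [:: (c, 0, 0)] => x; rewrite big_seq1 /= trmx0 mul0mx mxE addr0 cos0 mulr1.
Qed.

Lemma trigpoly_sum I (s : seq I) (f : I -> 'cV[R]_n -> R) :
  (forall i, trigpoly (f i)) -> trigpoly (fun x => \sum_(i <- s) f i x).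
Proof.
move=> fT; elim: s => [|i s ih].
  by have := trigpoly_cst 0; congr trigpoly; apply/funext => x; rewrite big_nil.
have := trigpolyD (fT i) ih.
by congr trigpoly; apply/funext => x; rewrite big_cons.
Qed.

Lemma trigpolyM p q : trigpoly p -> trigpoly q -> trigpoly (fun x => p x * q x).
Proof.
move=> [s sE] [t tE].
have -> : (fun x => p x * q x) = fun x => \sum_(i <- s) \sum_(j <- t)
    (i.1.1 * cos (i.2 + (i.1.2^T *m x) 0 0)) * (j.1.1 * cos (j.2 + (j.1.2^T *m x) 0 0)).
  apply/funext => x; rewrite sE tE mulr_suml; apply: eq_bigr => i _.
  by rewrite mulr_sumr.
apply: trigpoly_sum => i; apply: trigpoly_sum => j.
have := trigpolyZ (i.1.1 * j.1.1 / 2) (trigpolyD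
  (trigpoly_cos (i.1.2 + j.1.2) (i.2 + j.2)) (trigpoly_cos (i.1.2 - j.1.2) (i.2 - j.2))).
congr trigpoly; apply/funext => x.
set a := (i.1.2^T *m x) 0 0; set b := (j.1.2^T *m x) 0 0.
have -> : ((i.1.2 + j.1.2)^T *m x) 0 0 = a + b by rewrite linearD mulmxDl mxE.
have -> : ((i.1.2 - j.1.2)^T *m x) 0 0 = a - b.
  by rewrite linearB mulmxBl [LHS]mxE [X in _ + X]mxE.
rewrite (_ : i.2 + j.2 + (a + b) = (i.2 + a) + (j.2 + b)); last by ring.
rewrite (_ : i.2 - j.2 + (a - b) = (i.2 + a) - (j.2 + b)); last by ring.
by rewrite cosD cosB; field.
Qed.

Lemma trigpoly_prod I (s : seq I) (f : I -> 'cV[R]_n -> R) :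
  (forall i, trigpoly (f i)) -> trigpoly (fun x => \prod_(i <- s) f i x).
Proof.
move=> fT; elim: s => [|i s ih].
  by have := trigpoly_cst 1; congr trigpoly; apply/funext => x; rewrite big_nil.
have := trigpolyM (fT i) ih.
by congr trigpoly; apply/funext => x; rewrite big_cons.
Qed.

Lemma trigpoly_bernstein p N i : trigpoly p -> trigpoly (fun x => bernstein (p x) N i).
Proof.
move=> pT; elim: N i => [|N ih] i /=; first exact: trigpoly_cst.
have p1 : trigpoly (fun x => 1 - p x).
  have := trigpolyD (trigpoly_cst 1) (trigpolyZ (-1) pT).
  by congr trigpoly; apply/funext => x; rewrite mulN1r.
apply: trigpolyD; first exact: trigpolyM.
by case: i => [|i]; apply: trigpolyM => //; exact: trigpoly_cst.
Qed.

Section approximation.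
Variables (g : 'cV[R]_n -> R) (M K : R).
Hypotheses (cg : continuous g) (gM : forall x, `|g x| <= M) (K0 : 0 < K).

(** A coordinate with values in [0, 1] that is itself a trigonometric polynomial. On the box the
    argument of the sine stays in [-1/2, 1/2], well inside the interval where sine is injective. *)
Let t (k : 'I_n) x : R := (1 + sin (x k 0 / (2 * K))) / 2.

Let t01 k x : 0 <= t k x <= 1.
Proof. by have := sin_le1 (x k 0 / (2 * K)); have := sin_geN1 (x k 0 / (2 * K)); rewrite /t;
  lra. Qed.

Let trigpoly_t k : trigpoly (t k).
Proof.
have := trigpolyD (trigpoly_cst (1 / 2))
  (trigpolyZ (1 / 2) (trigpoly_cos ((2 * K)^-1 *: delta_mx k 0) (- (pi / 2)))).
congr trigpoly; apply/funext => x.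
have -> : (((2 * K)^-1 *: delta_mx k 0 : 'cV[R]_n)^T *m x) 0 0 = x k 0 / (2 * K).
  by rewrite [X in X *m _]linearZ /= trmx_delta -scalemxAl -rowE !mxE mulrC.
by rewrite (addrC (- _)) cosBpihalf /t; field.
Qed.

Variable N : nat.
Let J := {ffun 'I_n -> 'I_N.+2}.
Let w (j : J) x := \prod_k bernstein (t k x) N.+1 (j k).
(** The point whose [t]-coordinates are the fractions j_k / (N + 1). It may lie outside the box,
    since asin reaches pi / 2; this is why [sin_dist_ge] treats its arguments asymmetrically. *)
Let node (j : J) : 'cV[R]_n :=
  \col_k (2 * K * asin (2 * ((j k)%:R / N.+1%:R) - 1)).
Let p x := \sum_j g (node j) * w j x.

Let w0 j x : 0 <= w j x.
Proof. by apply: prodr_ge0 => k _; exact: bernstein_ge0. Qed.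

Let w1 x : \sum_j w j x = 1.
Proof.
rewrite -(bigA_distr_bigA (fun (k : 'I_n) (i : 'I_N.+2) => bernstein (t k x) N.+1 i)) /=.
by rewrite big1// => k _; exact: bernstein_sum1.
Qed.

(** The weight is a product over coordinates: all factors but the [k]-th sum to 1, and the [k]-th
    gives the variance of a binomial frequency. *)
Let w_var k x : \sum_(j : J) ((j k)%:R / N.+1%:R - t k x) ^+ 2 * w j x <= N.+1%:R^-1.
Proof.
have N0 : (0 : R) < N.+1%:R by rewrite ltr0n.
pose c (i : 'I_N.+2) := (i%:R / N.+1%:R - t k x) ^+ 2.
pose F (k' : 'I_n) (i : 'I_N.+2) := (if k' == k then c i else 1) * bernstein (t k' x) N.+1 i.
have -> : \sum_(j : J) ((j k)%:R / N.+1%:R - t k x) ^+ 2 * w j x = \prod_k' \sum_i F k' i.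
  rewrite bigA_distr_bigA; apply: eq_bigr => j _; rewrite /F big_split /=.
  by rewrite -big_mkcond big_pred1_eq.
rewrite (bigD1 k)//= [X in _ * X]big1 ?mulr1; last first.
  move=> k' /negbTE kk'; rewrite /F kk'; under eq_bigr do rewrite mul1r.
  exact: bernstein_sum1.
rewrite /F eqxx.
have -> : \sum_i c i * bernstein (t k x) N.+1 i = (N.+1%:R ^+ 2)^-1 *
    \sum_(i < N.+2) (i%:R - N.+1%:R * t k x) ^+ 2 * bernstein (t k x) N.+1 i.
  rewrite mulr_sumr; apply: eq_bigr => i _; rewrite /c mulrA; congr (_ * _).
  by field; rewrite gt_eqF.
rewrite bernstein_variance subrr expr0n addr0.
have /andP[? ?] := t01 k x.
have : t k x * (1 - t k x) <= 1 by nra.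
rewrite -(ler_pM2l (_ : 0 < N.+1%:R^-1)) ?invr_gt0// mulr1 => h; rewrite (le_trans _ h)//.
by rewrite le_eqVlt; apply/orP; left; apply/eqP; field; rewrite gt_eqF.
Qed.

Let trigpoly_p : trigpoly p.
Proof.
apply: trigpoly_sum => j; apply: trigpolyZ; apply: trigpoly_prod => k.
exact: trigpoly_bernstein.
Qed.

(** [p] is a convex combination of values of [g]. The bound holds on the whole space, which is what
    controls the approximation outside the box. *)
Let p_le x : `|p x| <= M.
Proof.
rewrite (le_trans (ler_norm_sum _ _ _))// -[M]mulr1 -(w1 x) mulr_sumr ler_sum// => j _.
by rewrite normrM (ger0_norm (w0 _ _)) ler_wpM2r.
Qed.

(** The constant is 2 K from the scaling, times 10 from [sin_dist_ge], times 2 because [t] halves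
    the sine. *)
Let node_dist j k x : `|x k 0| <= K ->
  `|x k 0 - node j k 0| <= 40 * K * `|(j k)%:R / N.+1%:R - t k x|.
Proof.
move=> xK; rewrite mxE; set a := (j k)%:R / _; pose z := x k 0 / (2 * K).
have N0 : (0 : R) < N.+1%:R by rewrite ltr0n.
have K2 : 0 < 2 * K by rewrite mulr_gt0.
have a0 : 0 <= a by rewrite divr_ge0.
have a1 : a <= 1 by rewrite ler_pdivrMr// mul1r ler_nat -ltnS ltn_ord.
have a11 : -1 <= 2 * a - 1 <= 1 by lra.
have z1 : `|z| <= 1 / 2.
  rewrite /z normrM normfV (gtr0_norm K2) ler_pdivrMr// mulrA mul1r.
  by rewrite mulVf ?mul1r// pnatr_eq0.
have y1 : `|asin (2 * a - 1)| <= pi / 2.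
  by rewrite ler_norml asin_geNpi2// asin_lepi2.
have := sin_dist_ge y1 z1; rewrite asinK ?in_itv//= => h.
have -> : x k 0 - 2 * K * asin (2 * a - 1) = - (2 * K) * (asin (2 * a - 1) - z).
  by rewrite /z; field; rewrite gt_eqF.
have aE : 2 * a - 1 - sin z = 2 * (a - t k x) by rewrite /t -/z; field.
rewrite aE (normrM 2) normr_nat in h.
rewrite normrM normrN (gtr0_norm K2).
have : 2 * K * `|asin (2 * a - 1) - z| <= 2 * K * (10 * (2 * `|a - t k x|)).
  by rewrite ler_wpM2l// ltW.
lra.
Qed.

(** Chebyshev's argument: nodes within [r] of [x] cost [e]; at a farther node some (40 K / r)^2
    times a squared deviation is at least 1, so the trivial bound 2 M is dominated by the
    variance. *)
Lemma bernstein_error (e r : R) : 0 < r ->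
  (forall x y : 'cV[R]_n, (forall k, `|x k 0| <= K) -> (forall k, `|x k 0 - y k 0| < r) ->
    `|g x - g y| <= e) ->
  exists q, [/\ trigpoly q, forall x, `|q x| <= M &
    forall x, (forall k, `|x k 0| <= K) ->
      `|g x - q x| <= e + 2 * M * (40 * K / r) ^+ 2 * n%:R / N.+1%:R].
Proof.
move=> r0 gr; exists p; split=> // x xK.
have M0 : 0 <= M by exact: le_trans (normr_ge0 _) (gM 0).
have e0 : 0 <= e.
  by have := gr x x xK; rewrite subrr normr0; apply => k; rewrite subrr normr0.
pose D := 2 * M * (40 * K / r) ^+ 2.
have D0 : 0 <= D by apply: mulr_ge0; [rewrite mulr_ge0|exact: sqr_ge0].
pose c (j : J) k := ((j k)%:R / N.+1%:R - t k x) ^+ 2.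
have gj j : `|g x - g (node j)| <= e + D * \sum_k c j k.
  have S0 : 0 <= \sum_k c j k by apply: sumr_ge0 => k _; exact: sqr_ge0.
  have [near_|] := boolP [forall k, `|x k 0 - node j k 0| < r].
    have DS0 : 0 <= D * \sum_k c j k by exact: mulr_ge0.
    have := gr _ _ xK (forallP near_); lra.
  move=> /forallPn[k]; rewrite -leNgt => far.
  have h := le_trans far (node_dist j (xK k)).
  have : r ^+ 2 <= (40 * K) ^+ 2 * c j k.
    rewrite /c -(real_normK (num_real (_ - t k x))) -exprMn.
    apply: lerXn2r; rewrite ?nnegrE; [exact: ltW| |exact: h].
    by rewrite mulr_ge0// mulr_ge0// ltW.
  move=> h2; have h3 : 1 <= (40 * K / r) ^+ 2 * c j k.
    by rewrite expr_div_n mulrAC ler_pdivlMr ?mul1r ?exprn_gt0.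
  have cS : c j k <= \sum_k c j k.
    by rewrite (bigD1 k)//= lerDl sumr_ge0// => ? _; exact: sqr_ge0.
  have h4 : 2 * M <= D * \sum_k c j k.
    have M20 : 0 <= 2 * M by exact: mulr_ge0.
    have := ler_wpM2l M20 h3; rewrite mulr1 mulrA -/D => h5.
    exact: le_trans h5 (ler_wpM2l D0 cS).
  have := ler_normB (g x) (g (node j)); have := gM x; have := gM (node j); lra.
have -> : g x - p x = \sum_j (g x - g (node j)) * w j x.
  rewrite /p -[in LHS](mulr1 (g x)) -(w1 x) mulr_sumr -sumrB.
  by apply: eq_bigr => j _; rewrite mulrBl.
rewrite (le_trans (ler_norm_sum _ _ _))//.
apply: (@le_trans _ _ (\sum_j (e + D * \sum_k c j k) * w j x)).
  by apply: ler_sum => j _; rewrite normrM (ger0_norm (w0 _ _)) ler_wpM2r.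
under eq_bigr do rewrite mulrDl.
rewrite big_split /= -mulr_sumr w1 mulr1 lerD2l.
have -> : \sum_j D * (\sum_k c j k) * w j x = D * \sum_k \sum_j c j k * w j x.
  rewrite exchange_big mulr_sumr; apply: eq_bigr => j _.
  by rewrite -mulrA mulr_suml.
rewrite -[leRHS]mulrA ler_wpM2l//.
rewrite (_ : n%:R / _ = \sum_(k < n) N.+1%:R^-1); last first.
  by rewrite sumr_const card_ord mulr_natl.
by apply: ler_sum => k _; exact: w_var.
Qed.

End approximation.

Lemma trigpoly_dense (g : 'cV[R]_n -> R) (M K e : R) : continuous g ->
  (forall x, `|g x| <= M) -> 0 < K -> 0 < e ->
  exists q, [/\ trigpoly q, forall x, `|q x| <= M &
    forall x, (forall k, `|x k 0| <= K) -> `|g x - q x| <= e].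
Proof.
move=> cg gM K0 e0.
have e2 : 0 < e / 2 by rewrite divr_gt0.
have [r r0 gr] := box_unif K cg e2.
pose D := 2 * M * (40 * K / r) ^+ 2 * n%:R.
pose N := Num.truncn (D / (e / 2)).
have [q [qT qM qg]] := bernstein_error gM K0 N r0 gr.
exists q; split=> // x xK; apply: (le_trans (qg x xK)).
rewrite -/D [leRHS]splitr lerD2l ler_pdivrMr ?ltr0n//.
rewrite -ler_pdivrMl// mulrC; apply/ltW; exact: truncnS_gt.
Qed.

End trigonometric_polynomials.

Section measurability_of_continuous_functions.
Context {d} {T : measurableType d} {R : realType} {n : nat}.
Variable U : T -> 'cV[R]_n.
Hypothesis mU : random_vector U.

Lemma measurable_trigpoly (q : 'cV[R]_n -> R) : trigpoly q ->
  measurable_fun [set: T] (fun w => q (U w)).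
Proof.
move=> [s sE]; under eq_fun do rewrite sE.
apply: measurable_sum => t; apply: measurable_funM => //.
apply: measurableT_comp; first exact: measurable_cos.
by apply: measurable_funD => //; exact: measurable_dot.
Qed.

(** Only the coordinates of [U] are known to be measurable. The function is the pointwise limit of
    trigonometric polynomials accurate to 1 / (m + 1) on the box of size m + 1. *)
Lemma measurable_continuous_bounded (g : 'cV[R]_n -> R) (M : R) : continuous g ->
  (forall x, `|g x| <= M) -> measurable_fun [set: T] (fun w => g (U w)).
Proof.
move=> cg gM.
have K0 (m : nat) : (0 : R) < m.+1%:R by rewrite ltr0n.
have e0 (m : nat) : (0 : R) < m.+1%:R^-1 by rewrite invr_gt0.
have dense m := cid (trigpoly_dense cg gM (K0 m) (e0 m)).
pose q m := sval (dense m).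
have qT m : trigpoly (q m) by rewrite /q; case: (dense m) => ? [].
have qg m (x : 'cV[R]_n) : (forall k, `|x k 0| <= m.+1%:R) -> `|g x - q m x| <= m.+1%:R^-1.
  by rewrite /q; case: (dense m) => ? [_ _ h] /=; exact: h.
apply: (@measurable_fun_cvg _ _ _ _ (fun m w => q m (U w))) => //.
  by move=> m; exact: measurable_trigpoly.
move=> w _; apply/cvgrPdist_le => e e_gt0; near=> m.
have mx : forall k, `|U w k 0| <= m.+1%:R.
  move=> k; rewrite (@le_trans _ _ (\sum_i `|U w i 0|))//.
    by rewrite (bigD1 k)//= lerDl sumr_ge0.
  rewrite (@le_trans _ _ m%:R)// ?ler_nat//.
  by near: m; exact: nbhs_infty_ger.
apply: (le_trans (qg _ _ mx)).
rewrite -[leRHS]invrK lef_pV2 ?posrE ?invr_gt0//.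
by rewrite (@le_trans _ _ m%:R)// ?ler_nat//; near: m; exact: nbhs_infty_ger.
Unshelve. all: by end_near.
Qed.

End measurability_of_continuous_functions.

Section weak_convergence.
Context {R : realType} {n : nat} {d d'} {T : measurableType d}
  {T' : measurableType d'}.
Variables (P : probability T R) (P' : probability T' R).
Variables (U : nat -> T -> 'cV[R]_n) (Z : T' -> 'cV[R]_n).
Hypotheses (mU : forall m, random_vector (U m)) (mZ : random_vector Z).
Hypothesis cvg_cos : forall (u : 'cV[R]_n) (b : R),
  \int[P]_w cos (b + (u^T *m U m w) 0 0) @[m --> \oo] -->
  \int[P']_w cos (b + (u^T *m Z w) 0 0).
Variable C : R.
Hypothesis U2 : forall m k, intg P (fun w => U m w k 0 ^+ 2) /\
  \int[P]_w (U m w k 0 ^+ 2) <= C.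
Hypothesis Z2 : forall k, intg P' (fun w => Z w k 0 ^+ 2) /\
  \int[P']_w (Z w k 0 ^+ 2) <= C.

Let intg_cos {d0} {T0 : measurableType d0} (P0 : probability T0 R)
    (V : T0 -> 'cV[R]_n) (u : 'cV[R]_n) b : random_vector V ->
  intg P0 (fun w => cos (b + (u^T *m V w) 0 0)).
Proof.
move=> mV; apply: (@intg_bounded _ _ _ _ _ 1) => [|w]; last exact: cos_max.
apply: measurableT_comp; first exact: measurable_cos.
by apply: measurable_funD => //; exact: measurable_dot.
Qed.

Let cvg_trigpoly (q : 'cV[R]_n -> R) : trigpoly q ->
  \int[P]_w q (U m w) @[m --> \oo] --> \int[P']_w q (Z w).
Proof.
move=> [s sE].
have intE d0 (T0 : measurableType d0) (P0 : probability T0 R) (V : T0 -> 'cV[R]_n) :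
    random_vector V -> \int[P0]_w q (V w) =
    \sum_(t <- s) t.1.1 * \int[P0]_w cos (t.2 + (t.1.2^T *m V w) 0 0).
  move=> mV; under eq_Rintegral do rewrite sE.
  rewrite Rintegral_sum; last by move=> t _; apply: intgZ; exact: intg_cos.
  by apply: eq_bigr => t _; rewrite RintegralZl//; exact: intg_cos.
rewrite intE// (_ : (fun m => _) = fun m =>
    \sum_(t <- s) t.1.1 * \int[P]_w cos (t.2 + (t.1.2^T *m U m w) 0 0)); last first.
  by apply/funext => m; exact: intE.
clear sE intE; elim: s => [|t s ih].
  rewrite big_nil (_ : (fun m => _) = fun=> 0); first exact: cvg_cst.
  by apply/funext => m; rewrite big_nil.
rewrite big_cons (_ : (fun m => _) = fun m =>
    t.1.1 * \int[P]_w cos (t.2 + (t.1.2^T *m U m w) 0 0) +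
    \sum_(t <- s) t.1.1 * \int[P]_w cos (t.2 + (t.1.2^T *m U m w) 0 0)); last first.
  by apply/funext => m; rewrite big_cons.
by apply: cvgD ih; apply: cvgM; [exact: cvg_cst|exact: cvg_cos].
Qed.

(** Outside the box some squared coordinate exceeds K^2, so the indicator of the complement is at
    most the sum of squares divided by K^2. *)
Let tail_bound {d0} {T0 : measurableType d0} (P0 : probability T0 R)
    (V : T0 -> 'cV[R]_n) (f : 'cV[R]_n -> R) (M K e : R) : random_vector V ->
  (forall k, intg P0 (fun w => V w k 0 ^+ 2) /\ \int[P0]_w (V w k 0 ^+ 2) <= C) ->
  measurable_fun [set: T0] (fun w => f (V w)) ->
  0 < K -> 0 <= e -> (forall x, `|f x| <= M) ->
  (forall x : 'cV[R]_n, (forall k, `|x k 0| <= K) -> `|f x| <= e) ->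
  `|\int[P0]_w f (V w)| <= e + M / K ^+ 2 * (n%:R * C).
Proof.
move=> mV V2 mf K0 e0 fM fe.
have M0 : 0 <= M by exact: le_trans (normr_ge0 _) (fM 0).
have MK0 : 0 <= M / K ^+ 2 by rewrite divr_ge0// sqr_ge0.
have iS : intg P0 (fun w => M / K ^+ 2 * \sum_k V w k 0 ^+ 2).
  by apply: intgZ; apply: intg_sum => k _; have [] := V2 k.
apply: (@le_trans _ _ (\int[P0]_w (e + M / K ^+ 2 * \sum_k V w k 0 ^+ 2))).
  apply: Rintegral_le_norm => // [|w]; first by apply: intgD => //; exact: intg_cst.
  have S0 : 0 <= \sum_k V w k 0 ^+ 2 by apply: sumr_ge0 => k _; exact: sqr_ge0.
  have [/forallP h|/forallPn[k]] := boolP [forall k, `|V w k 0| <= K].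
    by rewrite (le_trans (fe _ h))// lerDl mulr_ge0.
  rewrite -ltNge => Kk; rewrite (le_trans (fM _))// -[leLHS]add0r lerD//.
  rewrite mulrAC ler_pdivlMr ?exprn_gt0// ler_wpM2l//.
  rewrite (@le_trans _ _ (V w k 0 ^+ 2))//.
    rewrite -(real_normK (num_real (V w k 0))).
    by apply: lerXn2r; rewrite ?nnegrE; [exact: ltW|exact: normr_ge0|exact: ltW].
  by rewrite (bigD1 k)//= lerDl sumr_ge0// => ? _; exact: sqr_ge0.
rewrite RintegralD//; last exact: intg_cst.
rewrite Rintegral_prob_cst lerD2l RintegralZl//; last first.
  by apply: intg_sum => k _; have [] := V2 k.
rewrite ler_wpM2l// Rintegral_sum; last by move=> k _; have [] := V2 k.
rewrite (_ : n%:R * C = \sum_(k < n) C); last by rewrite sumr_const card_ord mulr_natl.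
by apply: ler_sum => k _; have [] := V2 k.
Qed.

(* Second moments bound the mass outside a box; inside it [g] is uniformly close
   to a trigonometric polynomial. *)
Lemma weak_cvg_of_cos (g : 'cV[R]_n -> R) (M : R) : continuous g ->
  (forall x, `|g x| <= M) ->
  \int[P]_w g (U m w) @[m --> \oo] --> \int[P']_w g (Z w).
Proof.
move=> cg gM; apply/cvgrPdist_le => e e0.
have M0 : 0 <= M by exact: le_trans (normr_ge0 _) (gM 0).
pose D := 2 * M * (n%:R * `|C|) + 1.
have D0 : 0 < D by rewrite ltr_wpDl// !mulr_ge0.
(* Each of the two tails costs 2 e' and the trigonometric moments cost e'. Below, [K] is at least 1
   and at least D / e', so that D / K^2 <= e'. *)
pose e' := e / 5; have e'0 : 0 < e' by rewrite divr_gt0.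
pose K := 1 + D / e'.
have K1 : 1 <= K by rewrite lerDl divr_ge0// ltW.
have K0 : 0 < K by rewrite (lt_le_trans _ K1).
have KD : D / K ^+ 2 <= e'.
  have KK : K <= K ^+ 2 by rewrite ler_eXnr.
  rewrite ler_pdivrMr ?exprn_gt0//; apply: (@le_trans _ _ (e' * K)).
    by rewrite /K mulrDr mulr1 mulrCA mulfV ?mulr1 ?gt_eqF// lerDr ltW.
  by rewrite ler_wpM2l// ltW.
have [q [qT qM qg]] := trigpoly_dense cg gM K0 e'0.
pose f x := g x - q x.
have fM x : `|f x| <= 2 * M.
  have := ler_normB (g x) (q x); have := gM x; have := qM x; rewrite -/(f x); lra.
have mg d0 (T0 : measurableType d0) (V : T0 -> 'cV[R]_n) : random_vector V ->
    measurable_fun [set: T0] (fun w => g (V w)).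
  by move=> mV; exact: (measurable_continuous_bounded mV cg gM).
have mf d0 (T0 : measurableType d0) (V : T0 -> 'cV[R]_n) : random_vector V ->
    measurable_fun [set: T0] (fun w => f (V w)).
  by move=> mV; apply: measurable_funB; [exact: mg|exact: measurable_trigpoly].
have split_int d0 (T0 : measurableType d0) (P0 : probability T0 R) (V : T0 -> 'cV[R]_n) :
    random_vector V -> \int[P0]_w f (V w) = \int[P0]_w g (V w) - \int[P0]_w q (V w).
  move=> mV; rewrite RintegralB//.
    by apply: (@intg_bounded _ _ _ _ _ M) => [|w]; [exact: mg|exact: gM].
  by apply: (@intg_bounded _ _ _ _ _ M) => [|w]; [exact: measurable_trigpoly|exact: qM].
have small : 2 * M / K ^+ 2 * (n%:R * C) <= e'.
  apply: le_trans KD; rewrite mulrAC ler_wpM2r ?invr_ge0 ?sqr_ge0//.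
  rewrite /D (@le_trans _ _ (2 * M * (n%:R * `|C|)))//; last by rewrite lerDl.
  by rewrite !ler_wpM2l// ?mulr_ge0// ler_norm.
have tZ : `|\int[P']_w f (Z w)| <= e' + e'.
  by apply: (le_trans (tail_bound mZ Z2 (mf _ _ _ mZ) K0 (ltW e'0) fM qg)); rewrite lerD2l.
have tU m : `|\int[P]_w f (U m w)| <= e' + e'.
  by apply: (le_trans (tail_bound (mU m) (U2 m) (mf _ _ _ (mU m)) K0 (ltW e'0) fM qg));
    rewrite lerD2l.
move/cvgrPdist_le : (cvg_trigpoly qT) => /(_ _ e'0) cq.
near=> m.
have cqm : `|\int[P']_w q (Z w) - \int[P]_w q (U m w)| <= e' by near: m.
have := tU m; rewrite split_int// => tUm.
move: tZ; rewrite split_int// => tZ.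
rewrite (_ : _ - _ = (\int[P']_w g (Z w) - \int[P']_w q (Z w)) +
  (\int[P']_w q (Z w) - \int[P]_w q (U m w)) -
  (\int[P]_w g (U m w) - \int[P]_w q (U m w))); last by ring.
rewrite (le_trans (ler_normB _ _))//.
rewrite (@le_trans _ _ ((e' + e' + e') + (e' + e')))//; last by rewrite /e'; lra.
by rewrite lerD// (le_trans (ler_normD _ _))// lerD.
Unshelve. all: by end_near.
Qed.

End weak_convergence.

(** * Maximizers of perturbed quadratic functions *)

Section concave_argmax.
Context {R : realType} {m : nat}.
Implicit Types (s t u : 'cV[R]_m).

(** With [Q] the symmetric square root of [S], the form is |Q x|^2 and x = Q^-1 (Q x). The bound is
    per coordinate because closeness is measured in the max norm. *)
Lemma psd_unit_coercive (S : 'M[R]_m) : psdmx S -> S \in unitmx ->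
  exists2 c : R, 0 < c & forall (x : 'cV[R]_m) k, c * x k 0 ^+ 2 <= (x^T *m S *m x) 0 0.
Proof.
move=> Spsd Su; have [[Qsym _] QQ] := sqrtmxP Spsd; set Q := sqrtmx S in Qsym QQ.
have Qu : Q \in unitmx by move: Su; rewrite -QQ unitmx_mul => /andP[].
pose b : R := 1 + \sum_k \sum_j `|invmx Q k j|.
have b0 : 0 < b by rewrite ltr_pwDl// sumr_ge0// => k _; rewrite sumr_ge0.
exists (b ^+ 2)^-1 => [|x k]; first by rewrite invr_gt0 exprn_gt0.
pose y := Q *m x.
have -> : (x^T *m S *m x) 0 0 = \sum_j y j 0 ^+ 2.
  have yT : y^T = x^T *m Q by rewrite trmx_mul Qsym.
  rewrite -QQ mulmxA -mulmxA -/y -yT mxE.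
  by apply: eq_bigr => j _; rewrite mxE expr2.
set Y2 := \sum_j _; pose Y := Num.sqrt Y2.
have Y20 : 0 <= Y2 by apply: sumr_ge0 => j _; exact: sqr_ge0.
have Y0 : 0 <= Y by exact: sqrtr_ge0.
have yY j : `|y j 0| <= Y.
  by rewrite /Y -sqrtr_sqr ler_sqrt// /Y2 (bigD1 j)//= lerDl sumr_ge0// => ? _; exact: sqr_ge0.
have xk : `|x k 0| <= b * Y.
  have -> : x = invmx Q *m y by rewrite /y mulmxA mulVmx// mul1mx.
  rewrite mxE (le_trans (ler_norm_sum _ _ _))//.
  apply: (@le_trans _ _ (\sum_j `|invmx Q k j| * Y)).
    by apply: ler_sum => j _; rewrite normrM ler_wpM2l.
  rewrite -mulr_suml ler_wpM2r// /b ler_wpDl// [leRHS](bigD1 k)//= lerDl sumr_ge0// => i _.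
  by rewrite sumr_ge0.
rewrite mulrC ler_pdivrMr ?exprn_gt0// mulrC -(sqr_sqrtr Y20) -/Y -exprMn.
rewrite -(real_normK (num_real (x k 0))).
by apply: lerXn2r; rewrite ?nnegrE// mulr_ge0// ltW.
Qed.

Variables (A : 'cV[R]_m -> R) (S : 'M[R]_m) (U : 'cV[R]_m) (K eta rho c : R).
Hypothesis A_concave : forall s t (l : R), 0 <= l <= 1 ->
  l * A s + (1 - l) * A t <= A (l *: s + (1 - l) *: t).
Hypotheses (Ssym : S^T = S) (Su : S \in unitmx).
Hypotheses (c0 : 0 < c) (Sc : forall (x : 'cV[R]_m) k, c * x k 0 ^+ 2 <= (x^T *m S *m x) 0 0).
Hypothesis Aq : forall s, (forall k, `|s k 0| <= K) ->
  `|A s - ((s^T *m U) 0 0 - (s^T *m S *m s) 0 0 / 2)| <= eta.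
Let s0 := invmx S *m U.
(** The margin 1, with [rho <= 1], keeps the ball of radius [rho] around [s0] inside the box where
    [Aq] holds. The condition on [eta] says that the drop c rho^2 / 2 of the quadratic at distance
    [rho] exceeds twice the error. *)
Hypothesis s0K : forall k, `|s0 k 0| <= K - 1.
Hypotheses (rho0 : 0 < rho) (rho1 : rho <= 1) (eta_rho : 4 * eta < c * rho ^+ 2).

Let q s : R := (s^T *m U) 0 0 - (s^T *m S *m s) 0 0 / 2.
Let V : R := (U^T *m invmx S *m U) 0 0.

(** Completing the square around [s0], where S s0 = U. *)
Let qE s : q s = V / 2 - ((s - s0)^T *m S *m (s - s0)) 0 0 / 2.
Proof.
have SU : S *m s0 = U by rewrite /s0 mulmxA mulmxV// mul1mx.
have s0S : s0^T *m S = U^T by rewrite -[in LHS]Ssym -trmx_mul SU.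
have e1 : (s0^T *m S *m s) 0 0 = (s^T *m U) 0 0.
  by rewrite s0S -[U^T *m s]trmxK trmx_mul trmxK mxE.
have e2 : (s^T *m S *m s0) 0 0 = (s^T *m U) 0 0 by rewrite -mulmxA SU.
have e3 : (s0^T *m S *m s0) 0 0 = V by rewrite s0S /V /s0 mulmxA.
have -> : ((s - s0)^T *m S *m (s - s0)) 0 0 = (s^T *m S *m s) 0 0
   - (s^T *m S *m s0) 0 0 - (s0^T *m S *m s) 0 0 + (s0^T *m S *m s0) 0 0.
  have sub00 (M N : 'M[R]_1) : (M - N) 0 0 = M 0 0 - N 0 0 by rewrite !mxE.
  have -> : (s - s0)^T = s^T - s0^T by rewrite linearB.
  by rewrite !mulmxBl !mulmxBr !sub00; ring.
rewrite e1 e2 e3 /q; lra.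
Qed.

Let q_le s : q s <= V / 2.
Proof.
rewrite qE gerBl divr_ge0//.
have [k|no] := pickP 'I_m.
  by rewrite (le_trans _ (Sc _ k))// mulr_ge0 ?sqr_ge0// ltW.
by rewrite mxE big1// => k; have := no k.
Qed.

Let q_s0 : q s0 = V / 2.
Proof. by rewrite qE subrr trmx0 !mul0mx mxE mul0r subr0. Qed.

Let s0K' k : `|s0 k 0| <= K.
Proof. by rewrite (le_trans (s0K k))// gerBl. Qed.

Let As0 : V / 2 - eta <= A s0.
Proof. by have := Aq s0K'; rewrite -/(q s0) q_s0 ler_norml => /andP[]; lra. Qed.

(* If [sh] were farther than [rho] from [s0], then by concavity [A] would be at
   least [A s0] at a point at distance [rho], where the quadratic is too small. *)
Lemma concave_argmax (sh : 'cV[R]_m) : A s0 <= A sh ->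
  (forall k, `|sh k 0 - s0 k 0| <= rho) /\ `|A sh - V / 2| <= eta.
Proof.
move=> Ash.
have near_s0 k : `|sh k 0 - s0 k 0| <= rho.
  rewrite leNgt; apply/negP => far.
  pose x := sh - s0.
  (* [i] realizes the max norm [r] of [sh - s0]; shrinking by rho / r gives a point of the segment
     at distance exactly [rho], at which coordinate [i] forces the drop of the quadratic. *)
  have [i _ imax] := @Order.TotalTheory.arg_maxP _ _ 'I_m k xpredT (fun i => `|x i 0|) isT.
  pose r := `|x i 0|.
  have xr j : `|x j 0| <= r by exact: imax.
  have r_rho : rho < r by rewrite (lt_le_trans far)//; have := xr k; rewrite !mxE.
  have r0 : 0 < r by exact: lt_trans r_rho.
  pose l := rho / r.
  have l01 : 0 <= l <= 1.
    by rewrite divr_ge0 ?(ltW rho0) ?(ltW r0)//= ler_pdivrMr// mul1r ltW.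
  have [l0 l1] := andP l01.
  pose st := l *: sh + (1 - l) *: s0.
  have stE : st - s0 = l *: x.
    by rewrite /st /x scalerBl scale1r scalerBr addrA addrAC addrK.
  have lr : l * r = rho by rewrite /l divfK// gt_eqF.
  have stK j : `|st j 0| <= K.
    have -> : st j 0 = s0 j 0 + l * x j 0.
      by rewrite /st /x !mxE; ring.
    rewrite (le_trans (ler_normD _ _))// normrM (ger0_norm l0).
    have lx : l * `|x j 0| <= rho by rewrite -lr ler_wpM2l.
    by apply: (le_trans (lerD (s0K j) lx)); rewrite -addrA gerDl addrC subr_le0.
  have Ast : A s0 <= A st.
    apply: le_trans (A_concave sh s0 l01).
    have e : l * A s0 + (1 - l) * A s0 = A s0 by ring.
    by rewrite -[leLHS]e lerD2r ler_wpM2l.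
  have qst : q st <= V / 2 - c * rho ^+ 2 / 2.
    rewrite qE lerD2l lerN2 ler_wpM2r// stE.
    apply: le_trans (Sc _ i).
    rewrite mxE exprMn -(real_normK (num_real (x i 0))) -exprMn -/r.
    by rewrite lr.
  have := Aq stK; rewrite -/(q st) ler_norml lerBlDl => /andP[_ h].
  have := le_trans As0 (le_trans Ast (le_trans h (lerD qst (lexx eta)))).
  by move: eta_rho; set a := V / 2; set b := c * rho ^+ 2; clearbody a b; lra.
split=> //.
have shK k : `|sh k 0| <= K.
  have -> : sh k 0 = s0 k 0 + (sh k 0 - s0 k 0) by ring.
  rewrite (le_trans (ler_normD _ _))//.
  by apply: (le_trans (lerD (s0K k) (near_s0 k))); rewrite -addrA gerDl addrC subr_le0.
have := Aq shK; rewrite -/(q sh) !ler_norml => /andP[h1 h2].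
have := q_le sh; have := le_trans As0 Ash; move: h2.
by set a := V / 2; set b := q sh; clearbody a b => *; apply/andP; split; lra.
Qed.

End concave_argmax.

(** * Moments *)

Section moments.
Context {d} {T : measurableType d} {R : realType}.
Implicit Types f g : T -> R.

Definition moments (Q : {measure set T -> \bar R}) f :=
  measurable_fun [set: T] f /\ forall p, intg Q (fun x => `|f x| ^+ p).

(** The integral of a nonnegative function is a supremum over simple functions below it, so
    monotonicity needs no measurability. This matters for the suprema over the uncountable set
    [Theta]. *)
Lemma nneg_le_integral (Q : {measure set T -> \bar R}) (f g : T -> \bar R) :
  (forall x, 0 <= f x)%E -> (forall x, f x <= g x)%E ->
  (\int[Q]_x f x <= \int[Q]_x g x)%E.
Proof.
move=> f0 fg; have g0 x : (0 <= g x)%E by exact: le_trans (f0 x) (fg x).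
rewrite !ge0_integralTE//; apply: le_ereal_sup => _ [h hf <-] /=.
by exists h => // x; exact: le_trans (hf x) (fg x).
Qed.

Section closure.
Variable Q : probability T R.

Let mpow f p : measurable_fun [set: T] f -> measurable_fun [set: T] (fun x => `|f x| ^+ p).
Proof. by move=> mf; apply: measurable_funX; exact: measurableT_comp. Qed.

Lemma momentsD f g : moments Q f -> moments Q g -> moments Q (fun x => f x + g x).
Proof.
move=> [mf fi] [mg gi]; have mfg : measurable_fun [set: T] (fun x => f x + g x).
  exact: measurable_funD.
split=> // p.
apply: (@intg_le _ _ _ Q _ (fun x => 2 ^+ p * (`|f x| ^+ p + `|g x| ^+ p))).
- exact: mpow.
- by apply: intgZ; apply: intgD.
move=> x; rewrite ger0_norm ?exprn_ge0//.
wlog fg : f g {mf mg mfg fi gi} / `|f x| <= `|g x|.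
  have [fg|/ltW gf] := leP `|f x| `|g x|; first by apply.
  by move=> /(_ g f gf); rewrite addrC [X in _ * X]addrC.
apply: (@le_trans _ _ ((2 * `|g x|) ^+ p)).
  by apply: lerXn2r; rewrite ?nnegrE// ?mulr_ge0// (le_trans (ler_normD _ _))//
    mulr2n mulrDl mul1r lerD2r.
by rewrite exprMn ler_wpM2l ?exprn_ge0// lerDr exprn_ge0.
Qed.

Lemma momentsM f g : moments Q f -> moments Q g -> moments Q (fun x => f x * g x).
Proof.
move=> [mf fi] [mg gi]; have mfg : measurable_fun [set: T] (fun x => f x * g x).
  exact: measurable_funM.
split=> // p.
apply: (@intg_le _ _ _ Q _ (fun x => `|f x| ^+ (p * 2) + `|g x| ^+ (p * 2))).
- exact: mpow.
- exact: intgD.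
move=> x; rewrite ger0_norm ?exprn_ge0// normrM exprMn !exprM.
have := exprn_ge0 p (normr_ge0 (f x)); have := exprn_ge0 p (normr_ge0 (g x)).
set a := _ ^+ p; set b := _ ^+ p => a0 b0.
have := sqr_ge0 (a - b); rewrite sqrrB; have := mulr_ge0 a0 b0; lra.
Qed.

Lemma moments_cst c : moments Q (fun=> c).
Proof. by split=> [|p]; [exact: measurable_cst|exact: intg_cst]. Qed.

Lemma momentsB f g : moments Q f -> moments Q g -> moments Q (fun x => f x - g x).
Proof.
move=> fm gm; have := momentsD fm (momentsM (moments_cst (-1)) gm).
by congr moments; apply/funext => x; rewrite mulN1r.
Qed.

Lemma moments_sum I (s : seq I) (f : I -> T -> R) : (forall i, moments Q (f i)) ->
  moments Q (fun x => \sum_(i <- s) f i x).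
Proof.
move=> fm; elim: s => [|i s ih].
  by have := moments_cst 0; congr moments; apply/funext => x; rewrite big_nil.
have := momentsD (fm i) ih.
by congr moments; apply/funext => x; rewrite big_cons.
Qed.

Lemma moments_measurable f : moments Q f -> measurable_fun [set: T] f.
Proof. by case. Qed.

Lemma moments_intg f : moments Q f -> intg Q f.
Proof.
by move=> [mf /(_ 1%N) h]; apply: (intg_le mf h) => x; rewrite expr1.
Qed.

Lemma moments_intg_sqr f : moments Q f -> intg Q (fun x => f x ^+ 2).
Proof. by move=> fm; apply: moments_intg; exact: momentsM. Qed.

End closure.
End moments.

Lemma moments_comp {d d'} {T : measurableType d} {T' : measurableType d'} {R : realType}
    (P : probability T R) (Q : probability T' R) (X : T -> T') (f : T' -> R) :
  measurable_fun [set: T] X -> (forall A, measurable A -> P (X @^-1` A) = Q A) ->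
  moments Q f -> moments P (fun w => f (X w)).
Proof.
move=> mX XQ [mf fi]; split=> [|p]; first exact: measurableT_comp mf mX.
exact: (intg_law mX XQ (fi p)).
Qed.

Section moments_of_factors.
Context {d1 d2} {T1 : measurableType d1} {T2 : measurableType d2} {R : realType}.
Variables (P1 : probability T1 R) (P2 : probability T2 R).
Variables (a : T1 -> R) (b : T2 -> R).
Hypotheses (ma : measurable_fun [set: T1] a) (mb : measurable_fun [set: T2] b).

Let power_integral {d} {T : measurableType d} (Q : probability T R) (f : T -> R) p :=
  (\int[Q]_x (`|f x| ^+ p)%:E)%E.

Let mpow {d} {T : measurableType d} (f : T -> R) p : measurable_fun [set: T] f ->
  measurable_fun [set: T] (fun x => (`|f x| ^+ p)%:E).
Proof.
by move=> mf; apply/measurable_EFinP/measurable_funX; exact: measurableT_comp.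
Qed.

Let power_ge0 {d} {T : measurableType d} (Q : probability T R) (f : T -> R) p :
  (0 <= power_integral Q f p)%E.
Proof. by apply: integral_ge0 => x _; rewrite lee_fin exprn_ge0. Qed.

Let power_prod p :
  (\int[(P1 \x P2)%E]_z (`|a z.1 * b z.2| ^+ p)%:E =
   power_integral P1 a p * power_integral P2 b p)%E.
Proof.
have mab : measurable_fun [set: T1 * T2] (fun z => a z.1 * b z.2).
  apply: measurable_funM; first exact: measurableT_comp ma measurable_fst.
  exact: measurableT_comp mb measurable_snd.
rewrite fubini_tonelli1; [|exact: mpow|by move=> z; rewrite lee_fin exprn_ge0].
transitivity (\int[P1]_x ((`|a x| ^+ p)%:E * power_integral P2 b p))%E.
  apply: eq_integral => x _; rewrite /fubini_F /= -ge0_integralZl//.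
  - by apply: eq_integral => y _; rewrite -EFinM normrM exprMn.
  - exact: mpow.
by rewrite ge0_integralZr//; exact: mpow.
Qed.

(** A vanishing integral of |f|^p forces f = 0 almost everywhere. The exponent [q] is positive
    because 0^0 = 1. *)
Let power_eq0 {d} {T : measurableType d} (Q : probability T R) (f : T -> R) p q :
  measurable_fun [set: T] f -> (0 < q)%N ->
  power_integral Q f p = 0%E -> power_integral Q f q = 0%E.
Proof.
move=> mf q0 fp.
have fae : ae_eq Q [set: T] (fun x => (`|f x| ^+ p)%:E) (cst 0%E).
  apply/ae_eq_integral_abs => //; first exact: mpow.
  by rewrite -[RHS]fp; apply: eq_integral => x _; rewrite /= ger0_norm ?exprn_ge0.
have : ae_eq Q [set: T] (fun x => (`|f x| ^+ q)%:E) (cst 0%E).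
  move: fae; apply: filterS => x /(_ I)/= [] /eqP; rewrite expf_eq0 => /andP[_ /eqP ->] _.
  by rewrite expr0n eqn0Ngt q0.
move=> /ae_eq_integral_abs => /(_ measurableT (mpow _ mf)) <-.
symmetry; by apply: eq_integral => x _; rewrite /= ger0_norm ?exprn_ge0.
Qed.

Let moments_of_power {d} {T : measurableType d} (Q : probability T R) (f : T -> R) :
  measurable_fun [set: T] f -> (forall p, power_integral Q f p < +oo)%E -> moments Q f.
Proof.
move=> mf fp; split=> // p; apply: ge0_intg; last exact: fp.
  by apply: measurable_funX; exact: measurableT_comp.
by move=> x; rewrite exprn_ge0.
Qed.

(* By Tonelli, [E |ab|^p = E |a|^p E |b|^p]; as neither factor is 0, both are
   finite. *)
Lemma moments_factors : moments (P1 \x P2)%E (fun z => a z.1 * b z.2) ->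
  \int[(P1 \x P2)%E]_z ((a z.1 * b z.2) ^+ 2) != 0 ->
  moments P1 a /\ moments P2 b.
Proof.
move=> [mab abp] ab2.
have fin p : (power_integral P1 a p * power_integral P2 b p < +oo)%E.
  rewrite -power_prod; have /integrableP[_] := abp p.
  apply: le_lt_trans; apply: nneg_le_integral => z; first by rewrite lee_fin exprn_ge0.
  by rewrite /= lee_fin ler_norm.
have ne0 : (power_integral P1 a 2 * power_integral P2 b 2 != 0)%E.
  apply: contra ab2 => /eqP ab0; rewrite /Rintegral.
  rewrite (_ : integral _ _ _ = 0%E)//; rewrite -[RHS]ab0 -power_prod.
  by apply: eq_integral => z _; rewrite real_normK// num_real.
have a0 p : (0 < power_integral P1 a p)%E.
  rewrite lt_neqAle power_ge0 andbT eq_sym; apply: contra ne0 => /eqP h.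
  by rewrite (power_eq0 (q := 2) ma _ h)// mul0e.
have b0 p : (0 < power_integral P2 b p)%E.
  rewrite lt_neqAle power_ge0 andbT eq_sym; apply: contra ne0 => /eqP h.
  by rewrite (power_eq0 (q := 2) mb _ h)// mule0.
split; apply: moments_of_power => // p; rewrite ltey; apply/eqP => oo; have := fin p; rewrite oo.
  by rewrite gt0_mulye// ltxx.
by rewrite gt0_muley// ltxx.
Qed.

End moments_of_factors.

Section exponential_moments.
Context {d} {T : measurableType d} {R : realType} (Q : probability T R).
Variables (f : T -> R) (delta : R).
Hypotheses (mf : measurable_fun [set: T] f) (delta0 : 0 < delta).
Hypotheses (fp : intg Q (fun x => expR (delta * f x)))
  (fn : intg Q (fun x => expR (- delta * f x))).

Lemma intg_expR_norm : intg Q (fun x => expR (delta * `|f x|)).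
Proof.
apply: (@intg_le _ _ _ Q _ (fun x => expR (delta * f x) + expR (- delta * f x))).
- by apply: measurableT_comp => //; apply: measurable_funM => //; exact: measurableT_comp.
- exact: intgD.
move=> x; rewrite ger0_norm ?expR_ge0//; case: (ger0P (f x)) => _.
  by rewrite lerDl expR_ge0.
by rewrite mulrN -mulNr lerDr expR_ge0.
Qed.

(** One term of the exponential series, y^p / p! <= exp y, bounds every power. *)
Lemma moments_expR : moments Q f.
Proof.
split=> // p.
apply: (@intg_le _ _ _ Q _ (fun x => (p`!%:R / delta ^+ p) * expR (delta * `|f x|))).
- by apply: measurable_funX; exact: measurableT_comp.
- by apply: intgZ; exact: intg_expR_norm.
move=> x; rewrite ger0_norm ?exprn_ge0//.
have y0 : 0 <= delta * `|f x| by rewrite mulr_ge0// ltW.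
have : (delta * `|f x|) ^+ p / p`!%:R <= expR (delta * `|f x|).
  case: p => [|p]; first by rewrite expr0 divr1 -[leLHS]expR0 ler_expR.
  by rewrite (le_trans _ (expR_ge1Dxn p y0))// lerDr.
rewrite exprMn ler_pdivrMr ?ltr0n ?fact_gt0// => h2.
rewrite mulrAC ler_pdivlMr ?exprn_gt0//; rewrite mulrC.
by rewrite (le_trans h2)// mulrC.
Qed.

End exponential_moments.

(** * Products of empirical means *)

Section product_sample.
Context {dX dY dO} {TX : measurableType dX} {TY : measurableType dY}
  {Omega : measurableType dO} {R : realType}.
Variables (P1 : probability TX R) (P2 : probability TY R).
Variables (P : probability (TX * TY)%type R) (Pr : probability Omega R).
Hypothesis PE : forall A, measurable A -> P A = (P1 \x P2)%E A.
Variables (X : nat -> Omega -> TX) (Y : nat -> Omega -> TY).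
Hypothesis iidXY : iid Pr (fun i w => (X i w, Y i w)) P.

Let mXY i : measurable_fun [set: Omega] (fun w => (X i w, Y i w)).
Proof. by have [] := iidXY. Qed.

Lemma sample_measurable_fst i : measurable_fun [set: Omega] (X i).
Proof. exact: measurableT_comp measurable_fst (mXY i). Qed.

Lemma sample_measurable_snd i : measurable_fun [set: Omega] (Y i).
Proof. exact: measurableT_comp measurable_snd (mXY i). Qed.

Let P_fst A : measurable A -> P (@fst TX TY @^-1` A) = P1 A.
Proof.
move=> mA; have -> : @fst TX TY @^-1` A = A `*` setT by apply/seteqP; split=> z //= [].
rewrite PE; last exact: measurableX.
by rewrite product_measure1E//; have /= -> := @probability_setT _ _ _ P2; rewrite mule1.
Qed.

Let P_snd A : measurable A -> P (@snd TX TY @^-1` A) = P2 A.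
Proof.
move=> mA; have -> : @snd TX TY @^-1` A = setT `*` A by apply/seteqP; split=> z //= [].
rewrite PE; last exact: measurableX.
by rewrite product_measure1E//; have /= -> := @probability_setT _ _ _ P1; rewrite mul1e.
Qed.

Lemma moments_fst (f : TX -> R) : moments P1 f -> moments P (fun z => f z.1).
Proof. exact: (moments_comp measurable_fst P_fst). Qed.

Lemma moments_snd (f : TY -> R) : moments P2 f -> moments P (fun z => f z.2).
Proof. exact: (moments_comp measurable_snd P_snd). Qed.

Lemma Rintegral_fst (f : TX -> R) : intg P1 f -> \int[P]_z f z.1 = \int[P1]_x f x.
Proof. exact: (Rintegral_law measurable_fst P_fst). Qed.

Lemma Rintegral_snd (f : TY -> R) : intg P2 f -> \int[P]_z f z.2 = \int[P2]_y f y.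
Proof. exact: (Rintegral_law measurable_snd P_snd). Qed.

Lemma Rintegral_fstsnd (f : TX -> R) (g : TY -> R) : intg P1 f -> intg P2 g ->
  \int[P]_z (f z.1 * g z.2) = (\int[P1]_x f x) * \int[P2]_y g y.
Proof.
move=> fi gi; rewrite -Rintegral_prodM// /Rintegral; congr fine.
by apply: eq_measure_integral => A mA _; exact: PE.
Qed.

(** For i <> j this is independence within the sample, for i = j independence of X and Y. All n^2
    pairs of the double sum thus have the law [P]. *)
Lemma cross_law i j A : measurable A ->
  Pr ((fun w => (X i w, Y j w)) @^-1` A) = P A.
Proof.
move=> mA; have [_ lawXY _] := iidXY.
case: (eqVneq i j) => [<-|ij]; first exact: lawXY.
rewrite PE//; apply: (law_pair (sample_measurable_fst i) (sample_measurable_snd j)) => // B C mB mC.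
have := iid_pair iidXY ij (measurableX mB measurableT) (measurableX measurableT mC).
rewrite -P_fst// -P_snd//.
have <- : B `*` setT = @fst TX TY @^-1` B by apply/seteqP; split=> z //= [].
have <- : setT `*` C = @snd TX TY @^-1` C by apply/seteqP; split=> z //= [].
by move=> <-; congr (Pr (_ `&` _)); apply/seteqP; split=> w //= [].
Qed.

Let mcross i j : measurable_fun [set: Omega] (fun w => (X i w, Y j w)).
Proof.
by apply/measurable_fun_pairP; split; [exact: sample_measurable_fst|exact: sample_measurable_snd].
Qed.

Lemma intg_cross_sample i j (f : TX * TY -> R) : intg P f ->
  intg Pr (fun w => f (X i w, Y j w)).
Proof. exact: (intg_law (mcross i j) (@cross_law i j)). Qed.

Lemma Rintegral_cross_sample i j (f : TX * TY -> R) : intg P f ->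
  \int[Pr]_w f (X i w, Y j w) = \int[P]_z f z.
Proof. exact: (Rintegral_law (mcross i j) (@cross_law i j)). Qed.

Definition sample_mean (n : nat) {T : Type} (f : T -> R) (x : nat -> T) : R :=
  n%:R^-1 * \sum_(i < n) f (x i).

Section second_moments.
Variables (n : nat) (n0 : (0 < n)%N).

Let nR0 : (0 : R) < n%:R. Proof. by rewrite ltr0n. Qed.

Let mean_sqrE T (f : T -> R) x :
  sample_mean n f x ^+ 2 = (n%:R ^+ 2)^-1 * (\sum_(i < n) f (x i)) ^+ 2.
Proof. by rewrite /sample_mean exprMn exprVn. Qed.

Let mean_fst (f : TX -> R) : moments P1 f -> \int[P1]_x f x = 0 ->
  intg Pr (fun w => sample_mean n f (X ^~ w) ^+ 2) /\
  \int[Pr]_w (sample_mean n f (X ^~ w) ^+ 2) = (\int[P1]_x (f x ^+ 2)) / n%:R.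
Proof.
move=> fm f0; have fP := moments_fst fm.
have fi := moments_intg fP; have f2 := moments_intg_sqr fP.
have f0' : \int[P]_z f z.1 = 0 by rewrite Rintegral_fst//; exact: moments_intg.
have iS := intg_sqr_iid_sum iidXY n fi f2.
split.
  have := intgZ (n%:R ^+ 2)^-1 iS.
  by apply: eq_integrable => // w _ /=; rewrite mean_sqrE.
under eq_Rintegral do rewrite mean_sqrE.
rewrite RintegralZl// (Rintegral_sqr_iid_sum iidXY n fi f2 f0').
rewrite (Rintegral_fst (f := fun x => f x ^+ 2)); last exact: moments_intg_sqr.
by field; rewrite gt_eqF.
Qed.

Let mean_snd (f : TY -> R) : moments P2 f -> \int[P2]_x f x = 0 ->
  intg Pr (fun w => sample_mean n f (Y ^~ w) ^+ 2) /\
  \int[Pr]_w (sample_mean n f (Y ^~ w) ^+ 2) = (\int[P2]_x (f x ^+ 2)) / n%:R.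
Proof.
move=> fm f0; have fP := moments_snd fm.
have fi := moments_intg fP; have f2 := moments_intg_sqr fP.
have f0' : \int[P]_z f z.2 = 0 by rewrite Rintegral_snd//; exact: moments_intg.
have iS := intg_sqr_iid_sum iidXY n fi f2.
split.
  have := intgZ (n%:R ^+ 2)^-1 iS.
  by apply: eq_integrable => // w _ /=; rewrite mean_sqrE.
under eq_Rintegral do rewrite mean_sqrE.
rewrite RintegralZl// (Rintegral_sqr_iid_sum iidXY n fi f2 f0').
rewrite (Rintegral_snd (f := fun x => f x ^+ 2)); last exact: moments_intg_sqr.
by field; rewrite gt_eqF.
Qed.

Let measurable_mean_fst (f : TX -> R) : measurable_fun [set: TX] f ->
  measurable_fun [set: Omega] (fun w => sample_mean n f (X ^~ w)).
Proof.
move=> mf; apply: measurable_funM => //; apply: measurable_sum => i.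
by apply: measurableT_comp mf _; exact: sample_measurable_fst.
Qed.

Let measurable_mean_snd (f : TY -> R) : measurable_fun [set: TY] f ->
  measurable_fun [set: Omega] (fun w => sample_mean n f (Y ^~ w)).
Proof.
move=> mf; apply: measurable_funM => //; apply: measurable_sum => i.
by apply: measurableT_comp mf _; exact: sample_measurable_snd.
Qed.

Let r : R := Num.sqrt n%:R.
Let r0 : 0 < r. Proof. by rewrite sqrtr_gt0. Qed.
Let r2 : n%:R = r ^+ 2. Proof. by rewrite sqr_sqrtr// ltW. Qed.

(** Each centered mean has variance O(1 / n); the product is bounded by the sum of the squares, and
    the factor sqrt n leaves O(1 / sqrt n). *)
Lemma product_of_centered_means (f : TX -> R) (g : TY -> R) :
  moments P1 f -> moments P2 g -> \int[P1]_x f x = 0 -> \int[P2]_y g y = 0 ->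
  let D w := r * `|sample_mean n f (X ^~ w) * sample_mean n g (Y ^~ w)| in
  intg Pr D /\
  \int[Pr]_w D w <= (\int[P1]_x (f x ^+ 2) + \int[P2]_y (g y ^+ 2)) / r.
Proof.
move=> fm gm f0 g0 D; have [fi fE] := mean_fst fm f0; have [gi gE] := mean_snd gm g0.
pose G w := r * (sample_mean n f (X ^~ w) ^+ 2 + sample_mean n g (Y ^~ w) ^+ 2).
have Gi : intg Pr G by apply: intgZ; exact: intgD.
have mD : measurable_fun [set: Omega] D.
  apply: measurable_funM => //; apply: measurableT_comp => //; apply: measurable_funM.
    by apply: measurable_mean_fst; exact: moments_measurable fm.
  by apply: measurable_mean_snd; exact: moments_measurable gm.
have DG w : `|D w| <= G w.
  rewrite /D /G normrM normr_id gtr0_norm// ler_wpM2l//; first exact: ltW.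
  rewrite normrM -(real_normK (num_real (sample_mean n f _))).
  rewrite -(real_normK (num_real (sample_mean n g _))).
  set a := `|_|; set b := `|_|; have a0 : 0 <= a := normr_ge0 _; have b0 : 0 <= b := normr_ge0 _.
  by have := sqr_ge0 (a - b); rewrite sqrrB; have := mulr_ge0 a0 b0; lra.
split; first exact: intg_le mD Gi DG.
apply: (le_trans (le_trans (ler_norm _) (Rintegral_le_norm mD Gi DG))).
rewrite /G RintegralZl//; last exact: intgD.
rewrite RintegralD// fE gE r2 le_eqVlt; apply/orP; left; apply/eqP; field.
by rewrite gt_eqF.
Qed.

(** With centered means A and B the difference is A B + e B + h A. The linear terms, of order 1 /
    sqrt n in mean, dominate. *)
Lemma product_of_means (f : TX -> R) (g : TY -> R) :
  moments P1 f -> moments P2 g ->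
  let e := \int[P1]_x f x in let h := \int[P2]_y g y in
  let D w := `|sample_mean n f (X ^~ w) * sample_mean n g (Y ^~ w) - e * h| in
  intg Pr D /\
  \int[Pr]_w D w <= ((\int[P1]_x ((f x - e) ^+ 2) + \int[P2]_y ((g y - h) ^+ 2)) *
    (1 + `|e| + `|h|) + `|e| + `|h|) / r.
Proof.
move=> fm gm e h D.
pose fc x := f x - e; pose gc y := g y - h.
have fcm : moments P1 fc by apply: momentsB => //; exact: moments_cst.
have gcm : moments P2 gc by apply: momentsB => //; exact: moments_cst.
have fc0 : \int[P1]_x fc x = 0.
  rewrite RintegralB//; [|exact: moments_intg|exact: intg_cst].
  by rewrite Rintegral_prob_cst subrr.
have gc0 : \int[P2]_y gc y = 0.
  rewrite RintegralB//; [|exact: moments_intg|exact: intg_cst].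
  by rewrite Rintegral_prob_cst subrr.
have mean_c T (k : T -> R) c x : sample_mean n (fun z => k z - c) x = sample_mean n k x - c.
  rewrite /sample_mean sumrB sumr_const card_ord -[c *+ n]mulr_natl.
  by field; rewrite gt_eqF.
have [fi fE] := mean_fst fcm fc0; have [gi gE] := mean_snd gcm gc0.
set vf := \int[P1]_x (fc x ^+ 2) in fE; set vg := \int[P2]_y (gc y ^+ 2) in gE.
pose A w := sample_mean n fc (X ^~ w); pose B w := sample_mean n gc (Y ^~ w).
have vf0 : 0 <= vf by apply: Rintegral_ge0 => x _; exact: sqr_ge0.
have vg0 : 0 <= vg by apply: Rintegral_ge0 => x _; exact: sqr_ge0.
pose L := 1 + `|e| + `|h|; have L1 : 1 <= L by rewrite /L -addrA lerDl addr_ge0.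
pose G w := r * L * (A w ^+ 2 + B w ^+ 2) + (`|e| + `|h|) / r.
have Gi : intg Pr G.
  by apply: intgD; [apply: intgZ; exact: intgD|exact: intg_cst].
have mD : measurable_fun [set: Omega] D.
  apply: measurableT_comp => //; apply: measurable_funB => //; apply: measurable_funM.
    by apply: measurable_mean_fst; exact: moments_measurable fm.
  by apply: measurable_mean_snd; exact: moments_measurable gm.
have r1 : 1 <= r.
  by rewrite -[leLHS]sqrtr1 ler_sqrt// ler1n.
have DG w : `|D w| <= G w.
  have -> : D w = `|A w * B w + e * B w + h * A w|.
    by rewrite /D /A /B /fc /gc !mean_c; congr `|_|; ring.
  rewrite normr_id (le_trans (ler_normD _ _))// (le_trans (lerD (ler_normD _ _) (lexx _)))//.
  rewrite (normrM (A w)) (normrM e) (normrM h) /G -(real_normK (num_real (A w)))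
    -(real_normK (num_real (B w))).
  have := normr_ge0 (A w); have := normr_ge0 (B w).
  set x := `|A w|; set y := `|B w| => y0 x0.
  (* [x <= r x^2 + 1/r], and [x y <= r (x^2 + y^2)] as [r >= 1] *)
  have amgm z : 0 <= z -> z <= r * z ^+ 2 + r^-1.
    move=> z0; rewrite -(@ler_pM2r _ r)// mulrDl mulVf ?gt_eqF//.
    have := sqr_ge0 (r * z - 1); rewrite sqrrB1 exprMn; have := mulr_ge0 (ltW r0) z0; lra.
  have hx := ler_wpM2l (normr_ge0 h) (amgm x x0).
  have hy := ler_wpM2l (normr_ge0 e) (amgm y y0).
  have xy : x * y <= r * (x ^+ 2 + y ^+ 2).
    have h1 : x * y <= x ^+ 2 + y ^+ 2.
      by have := sqr_ge0 (x - y); rewrite sqrrB; have := mulr_ge0 x0 y0; lra.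
    by rewrite (le_trans h1)// ler_peMl// addr_ge0// sqr_ge0.
  have q1 : 0 <= `|h| * (r * y ^+ 2) by rewrite !mulr_ge0 ?(ltW r0)// sqr_ge0.
  have q2 : 0 <= `|e| * (r * x ^+ 2) by rewrite !mulr_ge0 ?(ltW r0)// sqr_ge0.
  apply: (le_trans (lerD (lerD xy hy) hx)); rewrite -subr_ge0.
  rewrite (_ : _ - _ = `|h| * (r * y ^+ 2) + `|e| * (r * x ^+ 2)); first exact: addr_ge0.
  by rewrite /L; ring.
split; first exact: intg_le mD Gi DG.
apply: (le_trans (le_trans (ler_norm _) (Rintegral_le_norm mD Gi DG))).
rewrite /G RintegralD//; [|by apply: intgZ; exact: intgD|exact: intg_cst].
rewrite RintegralZl//; last exact: intgD.
rewrite RintegralD// /A /B fE gE Rintegral_prob_cst r2 -/L.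
rewrite -[\int[P1]_x ((f x - e) ^+ 2)]/vf -[\int[P2]_y ((g y - h) ^+ 2)]/vg.
by rewrite le_eqVlt; apply/orP; left; apply/eqP; field; rewrite gt_eqF.
Qed.

Lemma cross_mean (f : TX * TY -> R) : intg P f -> (forall z, 0 <= f z) ->
  let D w := r^-1 * ((n%:R ^+ 2)^-1 * \sum_(i < n) \sum_(j < n) f (X i w, Y j w)) in
  intg Pr D /\ \int[Pr]_w D w = (\int[P]_z f z) / r.
Proof.
move=> fi f0 D.
have iS : intg Pr (fun w => \sum_(i < n) \sum_(j < n) f (X i w, Y j w)).
  by apply: intg_sum => i _; apply: intg_sum => j _; exact: intg_cross_sample.
split; first by apply: intgZ; exact: intgZ.
rewrite /D RintegralZl//; last exact: intgZ.
rewrite RintegralZl// Rintegral_sum; last first.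
  by move=> i _; apply: intg_sum => j _; exact: intg_cross_sample.
have -> : \sum_(i < n) \int[Pr]_w (\sum_(j < n) f (X i w, Y j w)) =
    \sum_(i < n) \sum_(j < n) \int[P]_z f z.
  apply: eq_bigr => i _; rewrite Rintegral_sum; last by move=> j _; exact: intg_cross_sample.
  by apply: eq_bigr => j _; exact: Rintegral_cross_sample.
set c := \int[P]_z f z; rewrite !sumr_const !card_ord.
rewrite -(mulr_natl c) -(mulr_natl (n%:R * c)); field.
by rewrite !gt_eqF.
Qed.

End second_moments.

End product_sample.

(** * Taylor expansion of the criterion *)

Section exponential_taylor.
Context {R : realType}.

Let is_derive_expRN (x : R) : is_derive x (1 : R) (fun x => expR (- x)) (- expR (- x)).
Proof. by apply: is_derive_eq; rewrite mulrN1. Qed.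

Let is_derive_quad (x : R) :
  is_derive x (1 : R) (fun x : R => 1 - x + x ^+ 2 / 2) (- 1 + x).
Proof.
have d1 : is_derive x (1 : R) (fun x : R => 1 - x) (- 1).
  by rewrite (_ : (fun x => _) = cst 1 - (@id R))//; apply: is_derive_eq; rewrite add0r.
have d2 : is_derive x (1 : R) (fun x : R => x ^+ 2 / 2) x.
  rewrite (_ : (fun x => _) = 2^-1 *: (@id R ^+ 2)); last first.
    by apply/funext => y /=; rewrite !fctE/= /GRing.scale/= mulrC.
  by apply: is_derive_eq; rewrite /GRing.scale/= expr1; lra.
exact: is_deriveD.
Qed.

Let is_derive_cubic (x : R) : is_derive x (1 : R) (fun x : R => x ^+ 3 / 6) (x ^+ 2 / 2).
Proof.
rewrite (_ : (fun x => _) = 6^-1 *: (@id R ^+ 3)); last first.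
  by apply/funext => y /=; rewrite !fctE/= /GRing.scale/= mulrC.
by apply: is_derive_eq; rewrite /GRing.scale/=; lra.
Qed.

Let expRN_le2 (z : R) : 0 <= z -> expR (- z) <= 1 - z + z ^+ 2 / 2.
Proof.
apply: (@le_of_derivative R _ _ _ _ is_derive_expRN is_derive_quad) => [|x x0].
  by rewrite !oppr0 expR0 expr0n /=; lra.
by have := expR_ge1Dx (- x); lra.
Qed.

Let expRN_ge3 (z : R) : 0 <= z -> 1 - z + z ^+ 2 / 2 - z ^+ 3 / 6 <= expR (- z).
Proof.
apply: (@le_of_derivative R _ _ _ _ (fun x => is_deriveB (is_derive_quad x)
  (is_derive_cubic x)) is_derive_expRN) => [|x x0].
  by rewrite /= !fctE !oppr0 expR0 !expr0n /=; lra.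
by have := expRN_le2 x0; lra.
Qed.

Let expR_quad (y : R) : 0 <= y -> 1 + y + y ^+ 2 / 2 <= expR y.
Proof.
have dq (x : R) : is_derive x (1 : R) (fun x : R => 1 + x + x ^+ 2 / 2) (1 + x).
  have d1 : is_derive x (1 : R) (fun x : R => 1 + x) 1.
    by rewrite (_ : (fun x => _) = cst 1 + (@id R))//; apply: is_derive_eq; rewrite add0r.
  have d2 : is_derive x (1 : R) (fun x : R => x ^+ 2 / 2) x.
    rewrite (_ : (fun x => _) = 2^-1 *: (@id R ^+ 2)); last first.
      by apply/funext => z /=; rewrite !fctE/= /GRing.scale/= mulrC.
    by apply: is_derive_eq; rewrite /GRing.scale/= expr1; lra.
  exact: is_deriveD.
apply: (@le_of_derivative R _ _ _ _ dq (@is_derive_expR R)) => [|x x0].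
  by rewrite expR0 expr0n /=; lra.
exact: expR_ge1Dx.
Qed.

(** After multiplication by exp (- y) the left side is 1 - exp (- y) (1 + y + y^2 / 2): at most 1,
    which suffices for y >= 1, while for y < 1 the cubic lower bound of exp (- y) is used. *)
Let expR_taylor_pos (y : R) : 0 <= y -> expR y - 1 - y - y ^+ 2 / 2 <= y ^+ 3 * expR y.
Proof.
move=> y0; have h := expRN_ge3 y0.
have yy : expR (- y) * expR y = 1 by rewrite -expRD addrC subrr expR0.
rewrite -(ler_pM2l (expR_gt0 (- y))) mulrCA yy mulr1.
have -> : expR (- y) * (expR y - 1 - y - y ^+ 2 / 2) =
    1 - expR (- y) * (1 + y + y ^+ 2 / 2) by rewrite -yy; ring.
have c0 : 0 <= 1 + y + y ^+ 2 / 2 by rewrite addr_ge0 ?divr_ge0 ?sqr_ge0// addr_ge0.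
have h1 := ler_wpM2r c0 h.
have h0 := mulr_ge0 (expR_ge0 (- y)) c0.
have y3 : 0 <= y ^+ 3 by rewrite exprn_ge0.
have [y1|y1] := leP 1 y.
  by have : 1 <= y ^+ 3 by [rewrite exprn_ege1]; lra.
have : 0 <= y ^+ 4 * (1 - y) by rewrite mulr_ge0 ?exprn_ge0//; lra.
have e : (1 - y + y ^+ 2 / 2 - y ^+ 3 / 6) * (1 + y + y ^+ 2 / 2) =
  1 - y ^+ 3 / 6 + y ^+ 4 * (1 - y) / 12 by field.
by move: h1; rewrite e; lra.
Qed.

Lemma expR_taylor2 (y : R) :
  `|expR y - 1 - y - y ^+ 2 / 2| <= `|y| ^+ 3 * expR `|y|.
Proof.
have ge (x : R) : 0 <= x -> 0 <= expR x - 1 - x - x ^+ 2 / 2.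
  move=> x0; have := @expR_quad x x0; lra.
have [y0|y0] := leP 0 y.
  by rewrite (ger0_norm y0) ger0_norm ?expR_taylor_pos// ge.
pose z := - y; have z0 : 0 <= z by rewrite /z; lra.
have -> : y = - z by rewrite /z opprK.
rewrite normrN (ger0_norm z0) sqrrN ler_norml.
have h1 := expRN_ge3 z0; have h2 := expRN_le2 z0.
have z3 : 0 <= z ^+ 3 by rewrite exprn_ge0.
have e1 : 1 <= expR z by rewrite -[leLHS]expR0 ler_expR.
have := ler_wpM2l z3 e1; rewrite mulr1 => h3; apply/andP; split; lra.
Qed.

End exponential_taylor.

(** * The criterion as a quadratic plus three errors *)

Section criterion_expansion.
Context {R : realType} {TX TY : Type} {m : nat}.
Variables (a : 'I_m -> TX -> R) (b : 'I_m -> TY -> R).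
Implicit Types (s : 'cV[R]_m) (x : nat -> TX) (y : nat -> TY).

Definition vdot s u v : R := \sum_k s k 0 * (a k u * b k v).

Definition crit (n : nat) x y s : R :=
  n%:R^-1 * (\sum_(i < n) vdot s (x i) (y i)) -
  (n%:R ^+ 2)^-1 * \sum_(i < n) \sum_(j < n) (expR (vdot s (x i) (y j)) - 1).

Definition vnorm1 u v : R := \sum_k `|a k u * b k v|.

(** Dominates the Taylor remainder of the exponential at s / sqrt n, up to the factor (K / sqrt
    n)^3, for all |s| <= K at once as soon as K / sqrt n <= c. *)
Definition taylor_rest (c : R) u v : R := vnorm1 u v ^+ 3 * expR (c * vnorm1 u v).

Lemma vnorm1_ge0 u v : 0 <= vnorm1 u v.
Proof. by apply: sumr_ge0 => k _. Qed.

Lemma vdotZ (c : R) s u v : vdot (c *: s) u v = c * vdot s u v.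
Proof. by rewrite /vdot mulr_sumr; apply: eq_bigr => k _; rewrite mxE -mulrA. Qed.

Lemma vdotD s t u v : vdot (s + t) u v = vdot s u v + vdot t u v.
Proof. by rewrite /vdot -big_split; apply: eq_bigr => k _ /=; rewrite mxE mulrDl. Qed.

Lemma vdot_le (K : R) s u v : (forall k, `|s k 0| <= K) -> `|vdot s u v| <= K * vnorm1 u v.
Proof.
move=> sK; apply: (le_trans (ler_norm_sum _ _ _)); rewrite mulr_sumr.
by apply: ler_sum => k _; rewrite normrM ler_wpM2r.
Qed.

Variables (e f : 'I_m -> R) (S : 'M[R]_m).

Definition centered_sum (n : nat) x y : 'cV[R]_m :=
  \col_k ((Num.sqrt n%:R)^-1 * \sum_(i < n) (a k (x i) - e k) * (b k (y i) - f k)).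

(** The cost of replacing the empirical means by [e] and [f] in the empirical covariance. *)
Definition centered_error (n : nat) x y : R :=
  \sum_k Num.sqrt n%:R * `|sample_mean n (fun u => a k u - e k) x *
                           sample_mean n (fun v => b k v - f k) y|.

Definition quadratic_error (n : nat) x y : R :=
  \sum_k \sum_l `|sample_mean n (fun u => a k u * a l u) x *
                  sample_mean n (fun v => b k v * b l v) y - S k l|.

Definition rest_error (c : R) (n : nat) x y : R :=
  (Num.sqrt n%:R)^-1 *
  ((n%:R ^+ 2)^-1 * \sum_(i < n) \sum_(j < n) taylor_rest c (x i) (y j)).

Variables (n : nat) (n0 : (0 < n)%N).

Let nR0 : (0 : R) < n%:R. Proof. by rewrite ltr0n. Qed.
Let r : R := Num.sqrt n%:R.
Let r0 : 0 < r. Proof. by rewrite sqrtr_gt0. Qed.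
Let r2 : n%:R = r ^+ 2. Proof. by rewrite sqr_sqrtr// ltW. Qed.

Let sum_prod (F : nat -> R) (G : nat -> R) :
  \sum_(i < n) \sum_(j < n) F i * G j = (\sum_(i < n) F i) * \sum_(j < n) G j.
Proof. by rewrite mulr_suml; apply: eq_bigr => i _; rewrite mulr_sumr. Qed.

(* The empirical covariance does not depend on the centering. *)
Let linear_term s x y :
  r^-1 * (\sum_(i < n) vdot s (x i) (y i)) -
    r^-1 * n%:R^-1 * (\sum_(i < n) \sum_(j < n) vdot s (x i) (y j)) =
  (s^T *m centered_sum n x y) 0 0 -
  \sum_k s k 0 * (r * (sample_mean n (fun u => a k u - e k) x *
                      sample_mean n (fun v => b k v - f k) y)).
Proof.
rewrite mxE -sumrB.
have -> : \sum_(i < n) vdot s (x i) (y i) =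
    \sum_k s k 0 * \sum_(i < n) a k (x i) * b k (y i).
  by rewrite exchange_big; apply: eq_bigr => k _; rewrite mulr_sumr.
have -> : \sum_(i < n) \sum_(j < n) vdot s (x i) (y j) =
    \sum_k s k 0 * ((\sum_(i < n) a k (x i)) * \sum_(j < n) b k (y j)).
  have row (i : 'I_n) : \sum_(j < n) vdot s (x i) (y j) =
      \sum_k \sum_(j < n) s k 0 * (a k (x i) * b k (y j)) by rewrite exchange_big.
  rewrite (eq_bigr _ (fun i _ => row i)) exchange_big; apply: eq_bigr => k _ /=.
  rewrite -(sum_prod (fun i => a k (x i)) (fun j => b k (y j))) mulr_sumr.
  by apply: eq_bigr => i _; rewrite mulr_sumr.
rewrite !mulr_sumr -sumrB; apply: eq_bigr => k _; rewrite !mxE /sample_mean.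
have -> : \sum_(i < n) (a k (x i) - e k) * (b k (y i) - f k) =
   \sum_(i < n) a k (x i) * b k (y i) - e k * (\sum_(i < n) b k (y i)) -
   f k * (\sum_(i < n) a k (x i)) + n%:R * (e k * f k).
  have -> : n%:R * (e k * f k) = \sum_(i < n) e k * f k.
    by rewrite sumr_const card_ord -[RHS]mulr_natl.
  by rewrite !mulr_sumr -!sumrB -big_split; apply: eq_bigr => i _ /=; ring.
rewrite !sumrB !sumr_const !card_ord -(mulr_natl (e k)) -(mulr_natl (f k)) -/r r2.
by field; rewrite gt_eqF.
Qed.

(** For fixed indices k and l the double sum over the sample splits into a function of [x] times a
    function of [y]. *)
Let quadratic_term s x y :
  \sum_(i < n) \sum_(j < n) vdot s (x i) (y j) ^+ 2 =
  n%:R ^+ 2 * \sum_k \sum_l s k 0 * s l 0 *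
    (sample_mean n (fun u => a k u * a l u) x * sample_mean n (fun v => b k v * b l v) y).
Proof.
have -> : \sum_(i < n) \sum_(j < n) vdot s (x i) (y j) ^+ 2 =
    \sum_k \sum_l s k 0 * s l 0 * ((\sum_(i < n) a k (x i) * a l (x i)) *
      \sum_(j < n) b k (y j) * b l (y j)).
  have sqr (i j : 'I_n) : vdot s (x i) (y j) ^+ 2 =
      \sum_k \sum_l s k 0 * (a k (x i) * b k (y j)) * (s l 0 * (a l (x i) * b l (y j))).
    by rewrite expr2 {1}/vdot mulr_suml; apply: eq_bigr => k _; rewrite mulr_sumr.
  rewrite (eq_bigr _ (fun i _ => eq_bigr _ (fun j _ => sqr i j))).
  have row (i : 'I_n) : \sum_(j < n) \sum_k \sum_l
        s k 0 * (a k (x i) * b k (y j)) * (s l 0 * (a l (x i) * b l (y j))) =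
      \sum_k \sum_l \sum_(j < n)
        s k 0 * (a k (x i) * b k (y j)) * (s l 0 * (a l (x i) * b l (y j))).
    by rewrite exchange_big; apply: eq_bigr => k _; rewrite exchange_big.
  rewrite (eq_bigr _ (fun i _ => row i)) exchange_big; apply: eq_bigr => k _ /=.
  rewrite exchange_big; apply: eq_bigr => l _ /=.
  rewrite -(sum_prod (fun i => a k (x i) * a l (x i)) (fun j => b k (y j) * b l (y j))).
  rewrite mulr_sumr; apply: eq_bigr => i _; rewrite mulr_sumr.
  by apply: eq_bigr => j _; ring.
rewrite mulr_sumr; apply: eq_bigr => k _; rewrite mulr_sumr; apply: eq_bigr => l _.
by rewrite /sample_mean; field; rewrite gt_eqF.
Qed.

(** The exponential is expanded at s / sqrt n: first-order terms give [linear_term] with error [E1],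
    second-order ones the quadratic form with error [E2], and [E3] collects the remainders. As K >=
    1, all three errors share the factor K^3. *)
Lemma crit_expansion (K c : R) s x y : 1 <= K -> K * r^-1 <= c ->
  (forall k, `|s k 0| <= K) ->
  `|n%:R * crit n x y (r^-1 *: s) -
     ((s^T *m centered_sum n x y) 0 0 - (s^T *m S *m s) 0 0 / 2)| <=
  K ^+ 3 * (centered_error n x y + quadratic_error n x y + rest_error c n x y).
Proof.
move=> K1 Kc sK; have K0 : 0 <= K by lra.
pose rho z := expR z - 1 - z - z ^+ 2 / 2 : R.
pose E3 := n%:R^-1 * \sum_(i < n) \sum_(j < n) rho (r^-1 * vdot s (x i) (y j)).
pose E1 := \sum_k s k 0 * (r * (sample_mean n (fun u => a k u - e k) x *
                      sample_mean n (fun v => b k v - f k) y)).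
pose E2 := \sum_k \sum_l s k 0 * s l 0 *
    (sample_mean n (fun u => a k u * a l u) x *
     sample_mean n (fun v => b k v * b l v) y - S k l).
have sSs : (s^T *m S *m s) 0 0 = \sum_k \sum_l s k 0 * s l 0 * S k l.
  rewrite mxE exchange_big; apply: eq_bigr => l _; rewrite mxE mulr_suml.
  by apply: eq_bigr => k _; rewrite !mxE; ring.
have -> : n%:R * crit n x y (r^-1 *: s) -
     ((s^T *m centered_sum n x y) 0 0 - (s^T *m S *m s) 0 0 / 2) =
     - E1 - E2 / 2 - E3.
  have -> : E2 = (n%:R ^+ 2)^-1 * (\sum_(i < n) \sum_(j < n) vdot s (x i) (y j) ^+ 2) -
      (s^T *m S *m s) 0 0.
    rewrite quadratic_term mulKf ?expf_neq0 ?gt_eqF// sSs -sumrB; apply: eq_bigr => k _.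
    by rewrite -sumrB; apply: eq_bigr => l _; rewrite -mulrBr.
  have -> : (s^T *m centered_sum n x y) 0 0 = r^-1 * (\sum_(i < n) vdot s (x i) (y i)) -
    r^-1 * n%:R^-1 * (\sum_(i < n) \sum_(j < n) vdot s (x i) (y j)) + E1.
    by rewrite linear_term subrK.
  rewrite /crit.
  have -> : \sum_(i < n) vdot (r^-1 *: s) (x i) (y i) =
      r^-1 * \sum_(i < n) vdot s (x i) (y i).
    by rewrite mulr_sumr; apply: eq_bigr => i _; rewrite vdotZ.
  have -> : \sum_(i < n) \sum_(j < n) (expR (vdot (r^-1 *: s) (x i) (y j)) - 1) =
     r^-1 * (\sum_(i < n) \sum_(j < n) vdot s (x i) (y j)) +
     (r^-1 ^+ 2 / 2) * (\sum_(i < n) \sum_(j < n) vdot s (x i) (y j) ^+ 2) +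
     \sum_(i < n) \sum_(j < n) rho (r^-1 * vdot s (x i) (y j)).
    rewrite !mulr_sumr -!big_split; apply: eq_bigr => i _ /=.
    rewrite !mulr_sumr -!big_split; apply: eq_bigr => j _ /=.
    by rewrite vdotZ /rho; ring.
  by rewrite /E3 r2; field; rewrite gt_eqF.
have KK : K <= K ^+ 3.
  by rewrite exprS ler_peMr// exprn_ege1.
have KK2 : K ^+ 2 <= K ^+ 3.
  by rewrite [leRHS]exprSr ler_peMr// exprn_ge0.
have b1 : `|E1| <= K ^+ 3 * centered_error n x y.
  apply: (le_trans (ler_norm_sum _ _ _)); rewrite /centered_error mulr_sumr.
  apply: ler_sum => k _; rewrite normrM normrM (gtr0_norm r0).
  by apply: ler_wpM2r; [rewrite mulr_ge0// ltW|exact: le_trans KK].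
have b2 : `|E2| <= K ^+ 3 * quadratic_error n x y.
  apply: (le_trans (ler_norm_sum _ _ _)); rewrite /quadratic_error mulr_sumr.
  apply: ler_sum => k _; apply: (le_trans (ler_norm_sum _ _ _)); rewrite mulr_sumr.
  apply: ler_sum => l _; rewrite normrM normrM; apply: ler_wpM2r => //.
  by apply: le_trans KK2; rewrite expr2 ler_pM.
have b3 : `|E3| <= K ^+ 3 * rest_error c n x y.
  rewrite /E3 normrM ger0_norm ?invr_ge0 ?(ltW nR0)//.
  have -> : K ^+ 3 * rest_error c n x y =
     n%:R^-1 * \sum_(i < n) \sum_(j < n) ((K / r) ^+ 3 * taylor_rest c (x i) (y j)).
    under eq_bigr do rewrite -mulr_sumr.
    by rewrite -mulr_sumr /rest_error -/r r2; field; rewrite gt_eqF.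
  rewrite ler_wpM2l ?invr_ge0 ?(ltW nR0)//.
  apply: (le_trans (ler_norm_sum _ _ _)); apply: ler_sum => i _.
  apply: (le_trans (ler_norm_sum _ _ _)); apply: ler_sum => j _.
  apply: (le_trans (expR_taylor2 _)).
  rewrite /taylor_rest mulrA -exprMn.
  have hv : `|r^-1 * vdot s (x i) (y j)| <= K / r * vnorm1 (x i) (y j).
    rewrite normrM gtr0_norm ?invr_gt0// mulrC mulrAC ler_wpM2r ?invr_ge0 ?(ltW r0)//.
    exact: vdot_le.
  have v0 := vnorm1_ge0 (x i) (y j).
  apply: ler_pM; rewrite ?exprn_ge0 ?expR_ge0//.
    by apply: lerXn2r; rewrite ?nnegrE// (le_trans _ hv).
  by rewrite ler_expR (le_trans hv)// ler_wpM2r.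
have q0 : 0 <= K ^+ 3 * quadratic_error n x y by exact: le_trans b2.
rewrite !mulrDr ler_norml; move: b1 b2 b3; rewrite !ler_norml.
move=> /andP[? ?] /andP[? ?] /andP[? ?]; apply/andP; split; lra.
Qed.

Let expR_convex (t u v : R) : 0 <= t <= 1 ->
  expR (t * u + (1 - t) * v) <= t * expR u + (1 - t) * expR v.
Proof.
move=> /andP[t0 t1]; set w := t * u + (1 - t) * v.
have tangent z : expR w * (1 + (z - w)) <= expR z.
  have -> : expR z = expR w * expR (z - w) by rewrite -expRD addrC subrK.
  by rewrite ler_wpM2l ?expR_ge0// expR_ge1Dx.
have hu := ler_wpM2l t0 (tangent u).
have t1' : 0 <= 1 - t by lra.
have hv := ler_wpM2l t1' (tangent v).
apply: le_trans (lerD hu hv).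
by rewrite le_eqVlt; apply/orP; left; apply/eqP; rewrite /w; ring.
Qed.

(** The criterion is a linear function minus a sum of exponentials of linear functions. *)
Lemma crit_concave x y (t : R) s s' : 0 <= t <= 1 ->
  t * crit n x y s + (1 - t) * crit n x y s' <= crit n x y (t *: s + (1 - t) *: s').
Proof.
move=> t01; rewrite /crit !mulrBr addrACA -!opprD; apply: lerB.
  rewrite le_eqVlt; apply/orP; left; apply/eqP.
  have -> : \sum_(i < n) vdot (t *: s + (1 - t) *: s') (x i) (y i) =
     t * (\sum_(i < n) vdot s (x i) (y i)) + (1 - t) * \sum_(i < n) vdot s' (x i) (y i).
    by rewrite !mulr_sumr -big_split; apply: eq_bigr => i _; rewrite vdotD !vdotZ.
  by ring.
rewrite mulrCA (mulrCA (1 - t)) -mulrDr ler_wpM2l ?invr_ge0 ?sqr_ge0//.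
rewrite !mulr_sumr -big_split; apply: ler_sum => i _.
rewrite !mulr_sumr -big_split; apply: ler_sum => j _ /=.
by rewrite vdotD !vdotZ; have := expR_convex (vdot s (x i) (y j)) (vdot s' (x i) (y j)) t01; lra.
Qed.

End criterion_expansion.

(** * Approximation in probability *)

Lemma quad_delta_mx {R : realType} n (C : 'M[R]_n) (k : 'I_n) (u : 'cV[R]_n) :
  u = delta_mx k 0 -> (u^T *m C *m u) 0 0 = C k k.
Proof.
move=> ->; rewrite -mulmxA trmx_delta -rowE mxE mxE (bigD1 k)//= mxE !eqxx mulr1.
by rewrite big1 ?addr0// => i ik; rewrite mxE (negbTE ik) mulr0.
Qed.

(** The coordinate has the law of sqrt (C k k) times a standard normal variable, whose second moment
    is known. *)
Lemma multivariate_normal_sqr {R : realType} {d} {T : measurableType d}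
    (P : probability T R) n (Z : T -> 'cV[R]_n) (C : 'M[R]_n) (k : 'I_n) :
  multivariate_normal P Z 0 C ->
  intg P (fun w => Z w k 0 ^+ 2) /\ \int[P]_w (Z w k 0 ^+ 2) = C k k.
Proof.
move=> [mZ [_ Cpsd] lawZ].
pose u : 'cV[R]_n := delta_mx k 0.
have dotk m (A : 'M[R]_(n, m)) j : (u^T *m A) 0 j = A k j.
  by rewrite trmx_delta -rowE mxE.
have Ckk : (u^T *m C *m u) 0 0 = C k k by exact: quad_delta_mx.
have Ck0 : 0 <= C k k by rewrite -Ckk; exact: Cpsd.
set s : R := Num.sqrt (C k k).
have ms : measurable_fun [set: measurableTypeR R] (fun x : measurableTypeR R => s * x : R).
  exact: measurable_funM.
pose Y : {mfun measurableTypeR R >-> R} := HB.pack (fun x : measurableTypeR R => s * x : R)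
  (isMeasurableFun.Build _ _ _ _ _ ms).
pose Q : probability R R := distribution (normal_prob (0 : R) 1) Y.
have msq : measurable_fun [set: R] (fun x : R => x ^+ 2) by exact: measurable_funX.
have sq : (fun x : R => s ^+ 2 * x ^+ 2) = (fun x : R => x ^+ 2) \o (fun x : R => s * x).
  by apply/funext => x /=; rewrite exprMn.
have gi : intg (normal_prob (0 : R) 1) (fun x : R => s ^+ 2 * x ^+ 2).
  by apply: intgZ; exact: intg_normal_sqr.
have Qi : intg Q (fun x : R => x ^+ 2).
  apply: integrable_pushforward => //; first by apply/measurable_EFinP.
  by rewrite preimage_setT; move: gi; rewrite sq.
have lawQ (A : set R) : measurable A -> P ((fun w => Z w k 0) @^-1` A) = Q A.
  move=> mA; have := lawZ u A mA.
  rewrite mulmx0 mxE Ckk -(sqr_sqrtr Ck0) -/s -normal_law_scale// => h.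
  by apply: etrans h; congr (P _); apply/seteqP; split=> w /=; rewrite dotk.
split; first exact: (intg_law (mZ k) lawQ Qi).
rewrite (Rintegral_law (mZ k) lawQ Qi).
rewrite -(Rintegral_law (Q := Q) ms (fun A mA => erefl) Qi).
transitivity (\int[normal_prob (0 : R) 1]_x (s ^+ 2 * x ^+ 2)).
  by apply: eq_Rintegral => x _ /=; rewrite exprMn.
rewrite RintegralZl//; last exact: intg_normal_sqr.
by rewrite normal_second_moment mulr1 sqr_sqrtr.
Qed.

Section approximation.
Context {R : realType} {m : nat} {d} {T : measurableType d} (P : probability T R).
Variables (U : nat -> T -> 'cV[R]_m) (D Err : nat -> T -> R) (G : 'cV[R]_m -> R).
Variables (M C : R).
Hypotheses (M0 : 0 <= M) (C0 : 0 <= C).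
Hypothesis mU : forall n, random_vector (U n).
Hypothesis U2 : forall n k, intg P (fun w => U n w k 0 ^+ 2) /\
  \int[P]_w (U n w k 0 ^+ 2) <= C.
Hypothesis Err0 : forall n w, 0 <= Err n w.
Hypothesis ErrC : forall n, (0 < n)%N ->
  intg P (Err n) /\ \int[P]_w Err n w <= C / Num.sqrt n%:R.
Hypothesis mD : forall n, (0 < n)%N -> measurable_fun [set: T] (D n).
Hypothesis DM : forall n w, (0 < n)%N -> `|D n w| <= M.
Hypothesis mG : forall n, measurable_fun [set: T] (fun w => G (U n w)).
Hypothesis GM : forall x, `|G x| <= M.
Hypothesis close : forall e K : R, 0 < e -> 0 < K -> exists2 eta, 0 < eta &
  \forall n \near \oo, forall w, (forall k, `|U n w k 0| <= K) -> Err n w <= eta ->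
    `|D n w - G (U n w)| <= e.

(** Slutsky's lemma in L^1 form. The difference is at most 2 M always and small when [U] stays in a
    box and [Err] is below [eta]; the exceptional events are dominated by multiples of the squares
    of [U] and of [Err]. *)
Lemma cvg_of_close (L : R) : \int[P]_w G (U n w) @[n --> \oo] --> L ->
  \int[P]_w D n w @[n --> \oo] --> L.
Proof.
move=> GL; apply/cvgrPdist_le => e e0.
(* Makes 2 M m C equal to (e / 4) B; with K = 1 + B one has K^2 >= B, so leaving the box costs at
   most e / 4. The other quarters go to [close], to [Err] and to the convergence of G (U n). *)
pose B : R := 8 * M * m%:R * C / e.
have B0 : 0 <= B by rewrite /B divr_ge0 ?(ltW e0)// !mulr_ge0.
pose K : R := 1 + B; have K1 : 1 <= K by rewrite /K lerDl.
have K0 : 0 < K by lra.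
have [|//|eta eta0 hclose] := @close (e / 4) K; first lra.
have K2 : 0 < K ^+ 2 by rewrite exprn_gt0.
have KB : 2 * M / K ^+ 2 * (m%:R * C) <= e / 4.
  rewrite mulrAC ler_pdivrMr//.
  have h1 : 2 * M * (m%:R * C) = e / 4 * B by rewrite /B; field; rewrite gt_eqF.
  rewrite h1; apply: ler_wpM2l; first lra.
  by rewrite (le_trans _ (_ : K <= K ^+ 2))// ?expr2 ?ler_peMl ?(ltW K0)// /K lerDr.
have small : (2 * M / eta * C * (Num.sqrt n%:R)^-1) @[n --> \oo] --> (0 : R).
  rewrite [X in _ --> X](_ : _ = 2 * M / eta * C * 0); last by rewrite mulr0.
  by apply: cvgM; [exact: cvg_cst|exact: cvg_invsqrt].
have e4 : 0 < e / 4 by lra.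
move/cvgrPdist_le : small => /(_ _ e4) small; move/cvgrPdist_le : GL => /(_ _ e4) GL.
near=> n.
have n0 : (0 < n)%N by near: n; exact: nbhs_infty_gt.
have [Erri ErrE] := ErrC n0.
pose F w := (e / 4 + 2 * M / K ^+ 2 * \sum_k U n w k 0 ^+ 2) + 2 * M / eta * Err n w.
have Ui : intg P (fun w => \sum_k U n w k 0 ^+ 2).
  by apply: intg_sum => k _; have [] := U2 n k.
have F1i : intg P (fun w => e / 4 + 2 * M / K ^+ 2 * \sum_k U n w k 0 ^+ 2).
  by apply: intgD; [exact: intg_cst|exact: intgZ].
have F2i : intg P (fun w => 2 * M / eta * Err n w) by exact: intgZ.
have Fi : intg P F by exact: intgD.
have DF w : `|D n w - G (U n w)| <= F w.
  have S0 : 0 <= \sum_k U n w k 0 ^+ 2 by apply: sumr_ge0 => k _; exact: sqr_ge0.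
  have t1 : 0 <= 2 * M / K ^+ 2 * \sum_k U n w k 0 ^+ 2.
    by rewrite mulr_ge0// divr_ge0 ?(ltW K2)// mulr_ge0.
  have t2 : 0 <= 2 * M / eta * Err n w.
    by rewrite mulr_ge0 ?Err0// divr_ge0 ?(ltW eta0)// mulr_ge0.
  have D2 : `|D n w - G (U n w)| <= 2 * M.
    by rewrite (le_trans (ler_normB _ _))//; have := DM w n0; have := GM (U n w); lra.
  have M2 : 0 <= 2 * M by rewrite mulr_ge0.
  rewrite /F; case: (pselect (forall k, `|U n w k 0| <= K)) => [UK|/existsNP[k /negP]].
    have [Ee|Ee] := leP (Err n w) eta.
      have hc : forall w, (forall k, `|U n w k 0| <= K) -> Err n w <= eta ->
        `|D n w - G (U n w)| <= e / 4 by near: n.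
      by rewrite (le_trans (hc w UK Ee))// -addrA lerDl addr_ge0.
    have : 2 * M <= 2 * M / eta * Err n w.
      by rewrite mulrAC ler_pdivlMr// ler_wpM2l// ltW.
    lra.
  rewrite -ltNge => Kk.
  have : 2 * M <= 2 * M / K ^+ 2 * \sum_k U n w k 0 ^+ 2.
    rewrite mulrAC ler_pdivlMr// ler_wpM2l// (bigD1 k)//=.
    rewrite -(real_normK (num_real (U n w k 0))) (@le_trans _ _ (`|U n w k 0| ^+ 2))//.
      by apply: lerXn2r; rewrite ?nnegrE ?(ltW K0)// ltW.
    by rewrite lerDl; apply: sumr_ge0 => i _; exact: sqr_ge0.
  lra.
have mDG : measurable_fun [set: T] (fun w => D n w - G (U n w)).
  by apply: measurable_funB => //; exact: mD.
have Di : intg P (D n) by apply: (@intg_bounded _ _ _ _ _ M) => //; [exact: mD|move=> w; exact: DM].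
have Gi : intg P (fun w => G (U n w)) by apply: (@intg_bounded _ _ _ _ _ M).
have := Rintegral_le_norm mDG Fi DF; rewrite RintegralB//.
have FE : \int[P]_w F w <= e / 4 + e / 4 + 2 * M / eta * C * (Num.sqrt n%:R)^-1.
  rewrite /F RintegralD// RintegralD//; [|exact: intg_cst|exact: intgZ].
  rewrite Rintegral_prob_cst RintegralZl// RintegralZl// Rintegral_sum; last first.
    by move=> k _; have [] := U2 n k.
  apply: lerD; first apply: lerD => //.
    apply: le_trans KB; apply: ler_wpM2l; first by rewrite divr_ge0 ?(ltW K2)// mulr_ge0.
    rewrite mulr_natl -[X in _ <= _ *+ X](card_ord m) -sumr_const.
    by apply: ler_sum => k _; have [] := U2 n k.
  by rewrite -[leRHS]mulrA; apply: ler_wpM2l => //; rewrite divr_ge0 ?(ltW eta0)// mulr_ge0.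
have hs : `|0 - 2 * M / eta * C * (Num.sqrt n%:R)^-1| <= e / 4 by near: n.
have hG : `|L - \int[P]_w G (U n w)| <= e / 4 by near: n.
move: hs; rewrite sub0r normrN => /(le_trans (ler_norm _)) hs hDG.
rewrite -(subrKA (\int[P]_w G (U n w))) (le_trans (ler_normD _ _))//.
rewrite [X in _ + X]distrC; have := le_trans hDG FE.
by move: hG hs; set p := `|L - _|; set q := `|_ - _|; set r := 2 * M / eta * C * _; lra.
Unshelve. all: by end_near.
Qed.

End approximation.

(** * The limit of the score *)

Section exponential_integrability.
Context {d} {T : measurableType d} {R : realType} (Q : probability T R) {m : nat}.
Variables (v : 'I_m -> T -> R) (k0 : 'I_m).
Hypothesis mv : forall k, measurable_fun [set: T] (v k).

Let N x := \sum_k `|v k x|.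

Let mN : measurable_fun [set: T] N.
Proof. by apply: measurable_sum => k; exact: measurableT_comp (mv k). Qed.

Lemma intg_taylor_rest (delta : R) : 0 < delta ->
  (forall k, intg Q (fun x => expR (delta * `|v k x|))) ->
  exists2 c, 0 < c & intg Q (fun x => N x ^+ 3 * expR (c * N x)).
Proof.
move=> delta0 vi; have m0 : (0 : R) < m%:R by rewrite ltr0n (leq_ltn_trans _ (ltn_ord k0)).
(* (c N)^3 exp (c N) <= exp (4 c N), and N is at most [m] times its largest term, so the exponent
   becomes [delta] times that term. *)
pose c := delta / (4 * m%:R).
have c0 : 0 < c by rewrite divr_gt0// mulr_gt0.
exists c => //.
apply: (@intg_le _ _ _ Q _ (fun x => (c ^- 3) * \sum_k expR (delta * `|v k x|))).
- apply: measurable_funM; first exact: measurable_funX.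
  by apply: measurableT_comp => //; exact: measurable_funM.
- by apply: intgZ; exact: intg_sum.
move=> x; have N0 : 0 <= N x by exact: sumr_ge0.
rewrite ger0_norm ?mulr_ge0 ?exprn_ge0 ?expR_ge0//.
have cN0 : 0 <= c * N x by rewrite mulr_ge0// ltW.
have h1 : c * N x <= expR (c * N x) by have := expR_ge1Dx (c * N x); lra.
have h3 : c ^+ 3 * N x ^+ 3 <= expR (c * N x) ^+ 3.
  by rewrite -exprMn; apply: lerXn2r; rewrite ?nnegrE ?expR_ge0.
have [k Nk] : exists k, N x <= m%:R * `|v k x|.
  have := Order.TotalTheory.arg_maxP (fun k => `|v k x|) (erefl : predT k0).
  case=> k _ hk; exists k; rewrite /N mulr_natl -[X in _ <= _ *+ X](card_ord m) -sumr_const.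
  by apply: ler_sum => i _; exact: hk.
rewrite [leRHS]mulrC ler_pdivlMr ?exprn_gt0//.
apply: (@le_trans _ _ (expR (delta * `|v k x|))); last first.
  by rewrite (bigD1 k)//= lerDl; apply: sumr_ge0 => i _; exact: expR_ge0.
rewrite mulrC; apply: (@le_trans _ _ (expR (c * N x) ^+ 4)).
  by rewrite mulrA [leRHS]exprSr ler_wpM2r ?expR_ge0.
rewrite -expRM_natl ler_expR.
apply: (@le_trans _ _ (4 * (c * (m%:R * `|v k x|)))).
  by rewrite ler_wpM2l// ler_wpM2l// ltW.
by rewrite le_eqVlt; apply/orP; left; apply/eqP; rewrite /c; field; rewrite gt_eqF.
Qed.

End exponential_integrability.

Section sample_limit.
Context {dX dY dO} {TX : measurableType dX} {TY : measurableType dY}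
  {Omega : measurableType dO} {R : realType} {m : nat}.
Variables (P1 : probability TX R) (P2 : probability TY R).
Variables (P : probability (TX * TY)%type R) (Pr : probability Omega R).
Hypothesis PE : forall A, measurable A -> P A = (P1 \x P2)%E A.
Variables (X : nat -> Omega -> TX) (Y : nat -> Omega -> TY).
Hypothesis iidXY : iid Pr (fun i w => (X i w, Y i w)) P.
Variables (a : 'I_m -> TX -> R) (b : 'I_m -> TY -> R).
Hypotheses (am : forall k, moments P1 (a k)) (bm : forall k, moments P2 (b k)).

Let e k := \int[P1]_x a k x.
Let f k := \int[P2]_y b k y.

(** Under independence this is Sigma1 at 0. The factored form is what products of empirical second
    moments approach. *)
Definition product_second_moments : 'M[R]_m :=
  \matrix_(k, l) ((\int[P1]_x (a k x * a l x)) * \int[P2]_y (b k y * b l y)).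

Let S := product_second_moments.

Definition sample_error (c : R) n w : R :=
  centered_error a b e f n (X ^~ w) (Y ^~ w) +
  quadratic_error a b S n (X ^~ w) (Y ^~ w) +
  rest_error a b c n (X ^~ w) (Y ^~ w).

Lemma sample_error_ge0 c n w : 0 <= sample_error c n w.
Proof.
apply: addr_ge0; first apply: addr_ge0.
- by apply: sumr_ge0 => k _; rewrite mulr_ge0// sqrtr_ge0.
- by apply: sumr_ge0 => k _; apply: sumr_ge0.
- rewrite mulr_ge0 ?invr_ge0 ?sqrtr_ge0// mulr_ge0 ?invr_ge0 ?sqr_ge0//.
  apply: sumr_ge0 => i _; apply: sumr_ge0 => j _.
  by rewrite mulr_ge0 ?expR_ge0// exprn_ge0// vnorm1_ge0.
Qed.

Let center_intg {d} {T : measurableType d} (Q : probability T R) (g : T -> R) :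
  moments Q g -> moments Q (fun x => g x - \int[Q]_x g x) /\
  \int[Q]_x (g x - \int[Q]_x g x) = 0.
Proof.
move=> gm; split; first by apply: momentsB => //; exact: moments_cst.
by rewrite RintegralB ?Rintegral_prob_cst ?subrr//; [exact: moments_intg|exact: intg_cst].
Qed.

Lemma sample_error_le (c : R) :
  intg P (fun z => taylor_rest a b c z.1 z.2) ->
  exists2 B, 0 <= B & forall n, (0 < n)%N ->
    intg Pr (sample_error c n) /\ \int[Pr]_w sample_error c n w <= B / Num.sqrt n%:R.
Proof.
move=> ci.
pose B1 := \sum_k (\int[P1]_x ((a k x - e k) ^+ 2) + \int[P2]_y ((b k y - f k) ^+ 2)).
pose A2 k l x := a k x * a l x; pose C2 k l y := b k y * b l y.
pose eh k l := \int[P1]_x A2 k l x; pose fh k l := \int[P2]_y C2 k l y.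
pose B2 := \sum_k \sum_l
  ((\int[P1]_x ((A2 k l x - eh k l) ^+ 2) + \int[P2]_y ((C2 k l y - fh k l) ^+ 2)) *
    (1 + `|eh k l| + `|fh k l|) + `|eh k l| + `|fh k l|).
pose B3 := \int[P]_z taylor_rest a b c z.1 z.2.
have B30 : 0 <= B3.
  apply: Rintegral_ge0 => z _.
  by rewrite mulr_ge0 ?expR_ge0// exprn_ge0// vnorm1_ge0.
exists (`|B1| + `|B2| + B3) => [|n n0]; first by rewrite !addr_ge0.
have h1 : intg Pr (fun w => centered_error a b e f n (X ^~ w) (Y ^~ w)) /\
    \int[Pr]_w centered_error a b e f n (X ^~ w) (Y ^~ w) <= B1 / Num.sqrt n%:R.
  have hk k := product_of_centered_means PE iidXY n0 (center_intg (am k)).1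
    (center_intg (bm k)).1 (center_intg (am k)).2 (center_intg (bm k)).2.
  split; first by apply: intg_sum => k _; exact: (hk k).1.
  rewrite Rintegral_sum; last by move=> k _; exact: (hk k).1.
  by rewrite /B1 mulr_suml; apply: ler_sum => k _; exact: (hk k).2.
have h2 : intg Pr (fun w => quadratic_error a b S n (X ^~ w) (Y ^~ w)) /\
    \int[Pr]_w quadratic_error a b S n (X ^~ w) (Y ^~ w) <= B2 / Num.sqrt n%:R.
  have hkl k l : intg Pr (fun w => `|sample_mean n (A2 k l) (X ^~ w) *
      sample_mean n (C2 k l) (Y ^~ w) - S k l|) /\ \int[Pr]_w `|sample_mean n (A2 k l) (X ^~ w) *
      sample_mean n (C2 k l) (Y ^~ w) - S k l| <=
      ((\int[P1]_x ((A2 k l x - eh k l) ^+ 2) + \int[P2]_y ((C2 k l y - fh k l) ^+ 2)) *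
    (1 + `|eh k l| + `|fh k l|) + `|eh k l| + `|fh k l|) / Num.sqrt n%:R.
    rewrite /S mxE.
    exact: (product_of_means PE iidXY n0 (momentsM (am k) (am l)) (momentsM (bm k) (bm l))).
  split.
    by apply: intg_sum => k _; apply: intg_sum => l _; exact: (hkl k l).1.
  rewrite Rintegral_sum; last by move=> k _; apply: intg_sum => l _; exact: (hkl k l).1.
  rewrite /B2 mulr_suml; apply: ler_sum => k _.
  rewrite Rintegral_sum; last by move=> l _; exact: (hkl k l).1.
  by rewrite mulr_suml; apply: ler_sum => l _; exact: (hkl k l).2.
have h3 : intg Pr (fun w => rest_error a b c n (X ^~ w) (Y ^~ w)) /\
    \int[Pr]_w rest_error a b c n (X ^~ w) (Y ^~ w) = B3 / Num.sqrt n%:R.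
  apply: (cross_mean PE iidXY n0 ci) => z.
  by rewrite mulr_ge0 ?expR_ge0// exprn_ge0// vnorm1_ge0.
have i12 := intgD h1.1 h2.1.
split; first by apply: intgD => //; exact: h3.1.
rewrite RintegralD//; last exact: h3.1.
rewrite RintegralD//; [|exact: h1.1|exact: h2.1].
rewrite h3.2 !mulrDl lerD2r; apply: lerD.
  by apply: (le_trans h1.2); rewrite ler_wpM2r ?invr_ge0 ?sqrtr_ge0// ler_norm.
by apply: (le_trans h2.2); rewrite ler_wpM2r ?invr_ge0 ?sqrtr_ge0// ler_norm.
Qed.

Definition centered_product (k : 'I_m) (z : TX * TY) : R :=
  (a k z.1 - e k) * (b k z.2 - f k).

Definition centered_product_cov : 'M[R]_m :=
  \matrix_(k, l) \int[P]_z (centered_product k z * centered_product l z).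

Let wm k : moments P (centered_product k).
Proof.
apply: momentsM.
  by apply: (moments_fst PE (f := fun x => a k x - e k)); exact: (center_intg (am k)).1.
by apply: (moments_snd PE (f := fun y => b k y - f k)); exact: (center_intg (bm k)).1.
Qed.

Let w0 k : \int[P]_z centered_product k z = 0.
Proof.
rewrite (Rintegral_fstsnd PE (f := fun x => a k x - e k) (g := fun y => b k y - f k)).
- by rewrite (center_intg (am k)).2 mul0r.
- exact: moments_intg (center_intg (am k)).1.
- exact: moments_intg (center_intg (bm k)).1.
Qed.

Let U n w := centered_sum a b e f n (X ^~ w) (Y ^~ w).

Let UE n w k : U n w k 0 =
  (Num.sqrt n%:R)^-1 * \sum_(i < n) centered_product k (X i w, Y i w).
Proof. by rewrite mxE. Qed.

Lemma centered_sum_random_vector n : random_vector (U n).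
Proof.
move=> k; under eq_fun do rewrite UE.
apply: measurable_funM => //; apply: measurable_sum => i.
have [mXY _ _] := iidXY.
exact: measurableT_comp (moments_measurable (wm k)) (mXY i).
Qed.

Lemma centered_sum_sqr n k : intg Pr (fun w => U n w k 0 ^+ 2) /\
  \int[Pr]_w (U n w k 0 ^+ 2) <= centered_product_cov k k.
Proof.
have wi := moments_intg (wm k); have w2 := moments_intg_sqr (wm k).
have iS := intg_sqr_iid_sum iidXY n wi w2.
have E w : U n w k 0 ^+ 2 =
   (Num.sqrt n%:R)^-1 ^+ 2 * (\sum_(i < n) centered_product k (X i w, Y i w)) ^+ 2.
  by rewrite UE exprMn.
split.
  have := intgZ ((Num.sqrt n%:R)^-1 ^+ 2) iS.
  by apply: eq_integrable => // w _ /=; rewrite E.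
under eq_Rintegral do rewrite E.
rewrite RintegralZl// (Rintegral_sqr_iid_sum iidXY n wi w2 (w0 k)).
rewrite mxE exprVn sqr_sqrtr// mulrA -[leRHS]mul1r.
have w20 : 0 <= \int[P]_z centered_product k z ^+ 2.
  by apply: Rintegral_ge0 => z _; exact: sqr_ge0.
(* For n = 0 the empty sum gives 0, hence an inequality rather than an equality. *)
rewrite ler_wpM2r//; case: n {iS E} => [|n]; first by rewrite mulr0.
by rewrite mulVf.
Qed.

Lemma centered_product_quad (u : 'cV[R]_m) :
  moments P (fun z => \sum_k u k 0 * centered_product k z) /\
  \int[P]_z (\sum_k u k 0 * centered_product k z) ^+ 2 =
    (u^T *m centered_product_cov *m u) 0 0.
Proof.
split.
  by apply: moments_sum => k; apply: momentsM => //; exact: moments_cst.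
have E z : (\sum_k u k 0 * centered_product k z) ^+ 2 =
  \sum_k \sum_l (u k 0 * u l 0) * (centered_product k z * centered_product l z).
  rewrite expr2 mulr_suml; apply: eq_bigr => k _; rewrite mulr_sumr.
  by apply: eq_bigr => l _; ring.
have wwi k l : intg P (fun z => centered_product k z * centered_product l z).
  by apply: moments_intg; exact: momentsM.
under eq_Rintegral do rewrite E.
rewrite Rintegral_sum; last first.
  by move=> k _; apply: intg_sum => l _; exact: intgZ.
transitivity (\sum_k \sum_l u k 0 * u l 0 * centered_product_cov k l).
  apply: eq_bigr => k _; rewrite Rintegral_sum; last by move=> l _; exact: intgZ.
  by apply: eq_bigr => l _; rewrite RintegralZl// mxE.
rewrite [RHS]mxE exchange_big; apply: eq_bigr => l _; rewrite mxE mulr_suml.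
by apply: eq_bigr => k _; rewrite !mxE; ring.
Qed.

Lemma centered_product_cov_psd : psdmx centered_product_cov.
Proof.
split; first by apply/matrixP => k l; rewrite !mxE; apply: eq_Rintegral => z _; rewrite mulrC.
by move=> u; rewrite -(centered_product_quad u).2; apply: Rintegral_ge0 => z _; exact: sqr_ge0.
Qed.

(** In each direction [u] the linear form of [U n] is a normalized sum of centered i.i.d. variables
    with a third moment, to which the one-dimensional cosine limit applies. *)
Lemma centered_sum_cvg {d'} {T' : measurableType d'} (P' : probability T' R)
    (Z : T' -> 'cV[R]_m) (g : 'cV[R]_m -> R) (M : R) :
  multivariate_normal P' Z 0 centered_product_cov ->
  continuous g -> (forall x, `|g x| <= M) ->
  \int[Pr]_w g (U n w) @[n --> \oo] --> \int[P']_w g (Z w).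
Proof.
move=> NZ cg gM; have [mZ _ _] := NZ.
pose C := \sum_k centered_product_cov k k.
have cov0 k : 0 <= centered_product_cov k k.
  by rewrite mxE; apply: Rintegral_ge0 => z _; rewrite -expr2 sqr_ge0.
have covC k : centered_product_cov k k <= C.
  by rewrite /C (bigD1 k)//= lerDl; exact: sumr_ge0.
apply: (weak_cvg_of_cos (C := C) centered_sum_random_vector mZ _ _ _ cg gM).
- move=> u t; rewrite (multivariate_normal_cos u t NZ).
  have [um uE] := centered_product_quad u.
  rewrite -uE.
  have := cvg_cos_iid_sum (b := t) iidXY (moments_measurable um) (um.2 3).
  have -> : \int[P]_z (\sum_k u k 0 * centered_product k z) = 0.
    rewrite Rintegral_sum; last first.
      by move=> k _; apply: intgZ; exact: moments_intg.
    by rewrite big1// => k _; rewrite RintegralZl ?w0 ?mulr0//; exact: moments_intg.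
  move=> /(_ erefl); apply: cvg_trans; apply: near_eq_cvg; apply: nearW => n.
  apply: eq_Rintegral => w _; congr (cos (t + _)).
  rewrite [RHS]mxE mulr_sumr.
  under [RHS]eq_bigr do rewrite mxE UE mulrCA mulr_sumr mulr_sumr.
  by rewrite exchange_big; apply: eq_bigr => i _; rewrite mulr_sumr.
- by move=> n k; have [h1 h2] := centered_sum_sqr n k; split; rewrite ?(le_trans h2).
- by move=> k; have [h1 h2] := multivariate_normal_sqr k NZ; split; rewrite ?h2.
Qed.

End sample_limit.

(** * Limits of the estimators *)

Section continuity_of_matrix_maps.
Context {R : realType} {V : topologicalType}.

Lemma continuous_bigsum I (s : seq I) (F : I -> V -> R) :
  (forall i, continuous (F i)) -> continuous (fun x => \sum_(i <- s) F i x).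
Proof.
move=> cF; elim: s => [|i s ih] x.
  by under eq_fun do rewrite big_nil; exact: cst_continuous.
under eq_fun do rewrite big_cons.
by apply: continuousD; [exact: cF|exact: ih].
Qed.

Lemma continuous_col n (f : V -> 'cV[R]_n) :
  (forall i, continuous (fun x => f x i 0)) -> continuous f.
Proof.
move=> cf x U /nbhs_ballP[e e0 eU].
have h : \forall y \near x, forall i : 'I_n, ball (f x i 0) e (f y i 0).
  by apply: filter_forall => i; exact: cvg_ball (cf i x) _ e0.
apply: (filterS (F := nbhs x)) h => y hy; apply: eU; split => // i j.
by rewrite (ord1 j); exact: hy.
Qed.

End continuity_of_matrix_maps.

Lemma continuous_mulmx {R : realType} n k (L : 'M[R]_(k, n)) :
  continuous (fun x : 'cV[R]_n => L *m x).
Proof.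
apply: continuous_col => i; under eq_fun do rewrite mxE.
apply: continuous_bigsum => j x; apply: continuousM; first exact: cst_continuous.
exact: coord_continuous.
Qed.

Lemma continuous_quad {R : realType} n (L : 'M[R]_n) :
  continuous (fun x : 'cV[R]_n => (x^T *m L *m x) 0 0).
Proof.
have -> : (fun x : 'cV[R]_n => (x^T *m L *m x) 0 0) =
    (fun x => \sum_j x j 0 * \sum_i L j i * x i 0).
  apply/funext => x; rewrite -mulmxA mxE; apply: eq_bigr => j _.
  by rewrite !mxE.
apply: continuous_bigsum => j x; apply: continuousM; first exact: coord_continuous.
move: x; apply: continuous_bigsum => i x; apply: continuousM; first exact: cst_continuous.
exact: coord_continuous.
Qed.

Section argmax_limit.
Context {dX dY dO} {TX : measurableType dX} {TY : measurableType dY}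
  {Omega : measurableType dO} {R : realType} {m : nat}.
Variables (P1 : probability TX R) (P2 : probability TY R).
Variables (P : probability (TX * TY)%type R) (Pr : probability Omega R).
Hypothesis PE : forall A, measurable A -> P A = (P1 \x P2)%E A.
Variables (X : nat -> Omega -> TX) (Y : nat -> Omega -> TY).
Hypothesis iidXY : iid Pr (fun i w => (X i w, Y i w)) P.
Variables (a : 'I_m -> TX -> R) (b : 'I_m -> TY -> R).
Hypotheses (am : forall k, moments P1 (a k)) (bm : forall k, moments P2 (b k)).
Variables (k0 : 'I_m) (delta : R).
Hypothesis delta0 : 0 < delta.
Hypothesis abi : forall k, intg P (fun z => expR (delta * `|a k z.1 * b k z.2|)).

Local Notation S := (product_second_moments P1 P2 a b).
Local Notation Sinv := (invmx (product_second_moments P1 P2 a b)).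
Hypotheses (Spsd : psdmx S) (Su : S \in unitmx).

Variables (Theta : set 'cV[R]_m) (r : R) (that : nat -> Omega -> 'cV[R]_m).
Hypothesis r0 : 0 < r.
Hypothesis Theta_box : forall t : 'cV[R]_m, (forall k, `|t k 0| <= r) -> Theta t.
Hypothesis mthat : forall n, (0 < n)%N -> random_vector (that n).
Local Notation A n w := (crit a b n (X ^~ w) (Y ^~ w)).
Hypothesis thatP : forall n w t, (0 < n)%N -> Theta t -> A n w t <= A n w (that n w).

Let U n w := centered_sum a b (fun k => \int[P1]_x a k x) (fun k => \int[P2]_y b k y)
  n (X ^~ w) (Y ^~ w).

Let box_linear (L : 'M[R]_m) (K : R) : 0 <= K -> exists2 B, 0 <= B &
  forall x : 'cV[R]_m, (forall k, `|x k 0| <= K) -> forall k, `|(L *m x) k 0| <= B.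
Proof.
move=> K0; exists (\sum_i \sum_j `|L i j| * K).
  by apply: sumr_ge0 => i _; apply: sumr_ge0 => j _; exact: mulr_ge0.
move=> x xK k; rewrite mxE (le_trans (ler_norm_sum _ _ _))// [leRHS](bigD1 k)//=.
rewrite (@le_trans _ _ (\sum_j `|L k j| * K))//.
  by apply: ler_sum => j _; rewrite normrM ler_wpM2l.
by rewrite lerDl; apply: sumr_ge0 => i _; apply: sumr_ge0 => j _; exact: mulr_ge0.
Qed.

Section closeness.
Variable c : R.
Hypothesis c0 : 0 < c.

(** A statement for each fixed outcome: once the score is bounded and the error small,
    [concave_argmax] applies to the rescaled criterion. *)
Lemma argmax_close (rho K : R) : 0 < rho -> rho <= 1 -> 0 < K ->
  exists2 eta, 0 < eta & \forall n \near \oo, forall w,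
    (forall k, `|U n w k 0| <= K) -> sample_error P1 P2 X Y a b c n w <= eta ->
    (forall k, `|(Num.sqrt n%:R *: that n w) k 0 - (Sinv *m U n w) k 0| <= rho) /\
    `|2 * n%:R * A n w (that n w) - ((U n w)^T *m Sinv *m U n w) 0 0| <= rho.
Proof.
move=> rho0 rho1 K0; have [B B0 KB] := box_linear Sinv (ltW K0).
have [cc cc0 hcc] := psd_unit_coercive Spsd Su.
pose K1 := 1 + B; have K11 : 1 <= K1 by rewrite lerDl.
have K10 : 0 < K1 by lra.
(* The first bound meets the gap condition 4 eta < c rho^2; the second is halved because the maximum
   is multiplied by 2. Division by K1^3 below undoes the factor of [crit_expansion]. *)
pose etaJ := Num.min (cc * rho ^+ 2 / 8) (rho / 2).
have etaJ0 : 0 < etaJ by rewrite lt_min !divr_gt0// mulr_gt0// exprn_gt0.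
have eta1 : etaJ <= cc * rho ^+ 2 / 8 by rewrite ge_min lexx.
have eta2 : etaJ <= rho / 2 by rewrite ge_min lexx orbT.
have ccr : 0 < cc * rho ^+ 2 by rewrite mulr_gt0// exprn_gt0.
exists (etaJ / K1 ^+ 3); first by rewrite divr_gt0// exprn_gt0.
have small : (K1 * (Num.sqrt n%:R)^-1) @[n --> \oo] --> (0 : R).
  rewrite [X in _ --> X](_ : _ = K1 * 0); last by rewrite mulr0.
  by apply: cvgM; [exact: cvg_cst|exact: cvg_invsqrt].
(* K1 / sqrt n <= c is required by the expansion, K1 / sqrt n <= r puts Sinv U / sqrt n in
   [Theta]. *)
have cr0 : 0 < Num.min c r by rewrite lt_min c0.
move/cvgrPdist_le : small => /(_ _ cr0) small.
near=> n => w UK Ee.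
have n0 : (0 < n)%N by near: n; exact: nbhs_infty_gt.
have nR0 : (0 : R) < n%:R by rewrite ltr0n.
have s0 : 0 < Num.sqrt n%:R :> R by rewrite sqrtr_gt0.
have : `|0 - K1 * (Num.sqrt n%:R)^-1| <= Num.min c r by near: n.
rewrite sub0r normrN ger0_norm ?divr_ge0 ?(ltW K10) ?(ltW s0)// le_min => /andP[Kc Kr].
pose nu : R := (Num.sqrt n%:R)^-1.
have nu0 : 0 < nu by rewrite invr_gt0.
pose F s := n%:R * A n w (nu *: s).
have Fcon (s t : 'cV[R]_m) (l : R) : 0 <= l <= 1 -> l * F s + (1 - l)
  * F t <= F (l *: s + (1 - l) *: t).
  move=> l01; rewrite /F scalerDr !scalerA (mulrC nu l) (mulrC nu (1 - l)) -!scalerA.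
  rewrite mulrCA (mulrCA (1 - l)) -mulrDr; apply: ler_wpM2l; first exact: ltW.
  exact: crit_concave.
have Fq (s : 'cV[R]_m) : (forall k, `|s k 0| <= K1) ->
    `|F s - ((s^T *m U n w) 0 0 - (s^T *m S *m s) 0 0 / 2)| <= etaJ.
  move=> sK; apply: (le_trans (crit_expansion _ _ _ _ _ n0 _ _ K11 Kc sK)).
  by rewrite mulrC -ler_pdivlMr ?exprn_gt0.
have s0K k : `|(Sinv *m U n w) k 0| <= K1 - 1 by rewrite /K1 addrC addKr; exact: KB.
have eta_rho : 4 * etaJ < cc * rho ^+ 2 by lra.
have FE : F (Num.sqrt n%:R *: that n w) = n%:R * A n w (that n w).
  by rewrite /F scalerA mulVf ?gt_eqF// scale1r.
have Fmax : F (Sinv *m U n w) <= F (Num.sqrt n%:R *: that n w).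
  rewrite FE; apply: ler_wpM2l; first exact: ltW.
  apply: thatP => //; apply: Theta_box => k.
  rewrite mxE normrM gtr0_norm// mulrC (le_trans _ Kr)// ler_wpM2r ?(ltW nu0)//.
  by rewrite (le_trans (s0K k))// gerBl.
have [h1 h2] := concave_argmax Fcon Spsd.1 Su cc0 hcc Fq s0K rho0 rho1 eta_rho Fmax.
split=> //; move: h2; rewrite FE.
set V := (_ *m _) 0 0; set D := A n w _ => h2.
rewrite (_ : _ - V = 2 * (n%:R * D - V / 2)); last by field.
by rewrite normrM ger0_norm//; lra.
Unshelve. all: by end_near.
Qed.

End closeness.

Lemma measurable_crit n (t : Omega -> 'cV[R]_m) : random_vector t ->
  measurable_fun [set: Omega] (fun w => A n w (t w)).
Proof.
move=> mt.
have mv i j : measurable_fun [set: Omega] (fun w => vdot a b (t w) (X i w) (Y j w)).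
  apply: measurable_sum => k; apply: measurable_funM; first exact: mt.
  apply: measurable_funM.
    exact: measurableT_comp (moments_measurable (am k)) (sample_measurable_fst iidXY i).
  exact: measurableT_comp (moments_measurable (bm k)) (sample_measurable_snd iidXY j).
apply: measurable_funB; apply: measurable_funM => //; apply: measurable_sum => i //.
apply: measurable_sum => j; apply: measurable_funB => //.
exact: measurableT_comp (mv i j).
Qed.

Variables (d' : measure_display) (T' : measurableType d') (P' : probability T' R).
Variable Z : T' -> 'cV[R]_m.
Hypothesis NZ : multivariate_normal P' Z 0 (centered_product_cov P1 P2 P a b).

Let cvg_of_argmax (D : nat -> Omega -> R) (G : 'cV[R]_m -> R) (M : R) :
  continuous G -> (forall x, `|G x| <= M) ->
  (forall n, (0 < n)%N -> measurable_fun [set: Omega] (D n)) ->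
  (forall n w, `|D n w| <= M) ->
  (forall e K : R, 0 < e -> 0 < K -> exists2 rho, 0 < rho <= 1 &
    forall n w, (forall k, `|U n w k 0| <= K) ->
      (forall k, `|(Num.sqrt n%:R *: that n w) k 0 - (Sinv *m U n w) k 0| <= rho) ->
      `|2 * n%:R * A n w (that n w) - ((U n w)^T *m Sinv *m U n w) 0 0| <= rho ->
      `|D n w - G (U n w)| <= e) ->
  \int[Pr]_w D n w @[n --> \oo] --> \int[P']_w G (Z w).
Proof.
move=> cG GM mD DM close.
have mv k : measurable_fun [set: TX * TY] (fun z => a k z.1 * b k z.2).
  apply: measurable_funM.
    exact: measurableT_comp (moments_measurable (am k)) measurable_fst.
  exact: measurableT_comp (moments_measurable (bm k)) measurable_snd.
have [c c0 ci] := intg_taylor_rest k0 mv delta0 abi.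
have [B B0 hB] := sample_error_le PE iidXY am bm ci.
pose C := B + \sum_k centered_product_cov P1 P2 P a b k k.
have cov0 k : 0 <= centered_product_cov P1 P2 P a b k k.
  by rewrite mxE; apply: Rintegral_ge0 => z _; rewrite -expr2 sqr_ge0.
have cov_le k : centered_product_cov P1 P2 P a b k k <= C.
  by rewrite /C (bigD1 k)//= addrCA lerDl addr_ge0//; exact: sumr_ge0.
have BC : B <= C by rewrite lerDl; exact: sumr_ge0.
have M0 : 0 <= M by exact: le_trans (GM 0).
have mU n : random_vector (U n) by exact: (centered_sum_random_vector PE iidXY am bm n).
apply: (cvg_of_close (U := U) (Err := sample_error P1 P2 X Y a b c) (G := G) (C := C) M0).
- exact: le_trans BC.
- move=> n k; have [h1 h2] := centered_sum_sqr PE iidXY am bm n k.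
  by split=> //; rewrite (le_trans h2).
- by move=> n w; exact: sample_error_ge0.
- move=> n n0; have [h1 h2] := hB n n0; split=> //.
  by rewrite (le_trans h2)// ler_wpM2r// invr_ge0 sqrtr_ge0.
- exact: mD.
- by move=> n w _; exact: DM.
- by move=> n; exact (measurable_continuous_bounded (mU n) cG GM).
- exact: GM.
- move=> e K e0 K0; have [rho /andP[rho0 rho1] hrho] := close e K e0 K0.
  have [eta eta0 heta] := argmax_close c0 rho0 rho1 K0.
  exists eta => //; apply: filterS heta => n hn w UK Ee.
  by have [h1 h2] := hn w UK Ee; exact: hrho.
- exact: (centered_sum_cvg PE iidXY am bm NZ cG GM).
Qed.

Lemma cvg_argmax (g : 'cV[R]_m -> R) (M : R) : continuous g -> (forall x, `|g x| <= M) ->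
  \int[Pr]_w g (Num.sqrt n%:R *: that n w) @[n --> \oo] --> \int[P']_w g (Sinv *m Z w).
Proof.
move=> cg gM.
apply: (cvg_of_argmax (D := fun n w => g (Num.sqrt n%:R *: that n w))
  (G := fun x => g (Sinv *m x)) (M := M)).
- by move=> x; apply: continuous_comp; [exact: continuous_mulmx|exact: cg].
- by move=> x; exact: gM.
- move=> n n0.
  suff mt : random_vector (fun w => Num.sqrt n%:R *: that n w).
    exact (measurable_continuous_bounded mt cg gM).
  move=> k; under eq_fun do rewrite mxE.
  by apply: measurable_funM => //; exact: mthat.
- by move=> n w; exact: gM.
move=> e K e0 K0; have [B B0 KB] := box_linear Sinv (ltW K0).
have [s s0 hs] := box_unif B cg e0.
exists (Num.min 1 (s / 2)); first by rewrite lt_min ltr01 divr_gt0// ge_min lexx.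
move=> n w UK h1 _; rewrite distrC; apply: hs => k; first exact: KB.
rewrite distrC (le_lt_trans (h1 k))// gt_min; apply/orP; right; lra.
Qed.

Lemma cvg_max (g : R -> R) (M : R) : continuous g -> (forall x, `|g x| <= M) ->
  \int[Pr]_w g (2 * n%:R * A n w (that n w)) @[n --> \oo] -->
  \int[P']_w g (((Z w)^T *m Sinv *m Z w) 0 0).
Proof.
move=> cg gM.
pose q (x : 'cV[R]_m) : R := (x^T *m Sinv *m x) 0 0.
(* Scalars are seen as vectors of size 1, so that [box_unif] applies to them. *)
have cgc : continuous (fun x : 'cV[R]_1 => g (x 0 0)).
  by move=> x; apply: continuous_comp; [exact: coord_continuous|exact: cg].
apply: (cvg_of_argmax (D := fun n w => g (2 * n%:R * A n w (that n w)))
  (G := fun x => g (q x)) (M := M)).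
- by move=> x; apply: continuous_comp; [exact: continuous_quad|exact: cg].
- by move=> x; exact: gM.
- move=> n n0; apply: measurableT_comp; first exact: continuous_measurable_fun.
  by apply: measurable_funM => //; apply: measurable_crit; exact: mthat.
- by move=> n w; exact: gM.
move=> e K e0 K0; have [B B0 KB] := box_linear Sinv (ltW K0).
pose Q := \sum_(k < m) K * B.
have qQ (x : 'cV[R]_m) : (forall k, `|x k 0| <= K) -> `|q x| <= Q.
  move=> xK; rewrite /q -mulmxA mxE (le_trans (ler_norm_sum _ _ _))//.
  by apply: ler_sum => k _; rewrite mxE normrM ler_pM//; exact: KB.
have [s s0 hs] := box_unif Q cgc e0.
exists (Num.min 1 (s / 2)); first by rewrite lt_min ltr01 divr_gt0// ge_min lexx.
move=> n w UK _ h2; rewrite distrC.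
have := hs (const_mx (q (U n w))) (const_mx (2 * n%:R * A n w (that n w))).
rewrite !mxE; apply => k; rewrite !mxE; first exact: qQ.
rewrite distrC (le_lt_trans h2)// gt_min; apply/orP; right; lra.
Qed.

End argmax_limit.

(** * The model *)

(** Reduces a directional derivative to a derivative in one real variable, where the usual rules are
    available. *)
Lemma derive_along {R : realType} {m} (F : 'cV[R]_m -> R) (v t : 'cV[R]_m) (G : R -> R) (l : R) :
  (forall h, F (h *: v + t) = G h) -> is_derive (0 : R) (1 : R) G l -> 'D_v F t = l.
Proof.
move=> FG Gl; rewrite -(@derive_val _ _ _ _ _ _ _ Gl).
have E : (fun h : R => h^-1 *: ((F \o shift t) (h *: v) - F t)) =
    (fun h : R => h^-1 *: ((G \o shift 0) (h *: (1 : R^o)) - G 0)).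
  apply/funext => h /=; have -> : F t = G 0 by rewrite -FG scale0r add0r.
  by rewrite /shift /= FG addr0 /GRing.scale /= mulr1.
exact: (congr1 (fun f => lim (f @ 0^')) E).
Qed.

Section affine_model.
Context {R : realType} {d : nat}.

(* The intercept is treated as an additional pair of constant functions. *)
Definition with_intercept {T : Type} (xi : 'I_d -> T -> R) (i : 'I_(1 + d)) (x : T) : R :=
  (col_mx (1%:M : 'M[R]_1) (\col_k xi k x)) i 0.

Lemma with_intercept0 T (xi : 'I_d -> T -> R) i x : with_intercept xi (lshift d i) x = 1.
Proof. by rewrite /with_intercept col_mxEu mxE (ord1 i) eqxx. Qed.

Lemma with_interceptS T (xi : 'I_d -> T -> R) k x : with_intercept xi (rshift 1 k) x = xi k x.
Proof. by rewrite /with_intercept col_mxEd mxE. Qed.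

Context {dX dY} {TX : measurableType dX} {TY : measurableType dY}.
Variables (xi : 'I_d -> {mfun TX >-> R}) (zeta : 'I_d -> {mfun TY >-> R}).
Implicit Types (t : 'cV[R]_(1 + d)) (z : TX * TY) (P : probability (TX * TY)%type R).

Local Notation a := (with_intercept (fun k => xi k : TX -> R)).
Local Notation b := (with_intercept (fun k => zeta k : TY -> R)).

Lemma measurable_with_intercept {d'} {T : measurableType d'} (f : 'I_d -> {mfun T >-> R}) i :
  measurable_fun [set: T] (with_intercept (fun k => f k : T -> R) i).
Proof.
case: (split_ordP i) => k ->.
  have -> : with_intercept (fun k => f k : T -> R) (lshift d k) = cst 1.
    by apply/funext => x; exact: with_intercept0.
  exact: measurable_cst.
have -> : with_intercept (fun k => f k : T -> R) (rshift 1 k) = f k.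
  by apply/funext => x; exact: with_interceptS.
exact: measurable_funP.
Qed.

Lemma model_f_vdot t z : model_f xi zeta t z = vdot a b t z.1 z.2.
Proof.
rewrite /vdot big_split_ord /= big_ord1 !with_intercept0 !mulr1 /model_f; congr (_ + _).
  by rewrite mxE.
by apply: eq_bigr => k _; rewrite !with_interceptS !mxE mulrA.
Qed.

Lemma model_g_vdot t z : model_g xi zeta t z = expR (vdot a b t z.1 z.2) - 1.
Proof. by rewrite -model_f_vdot. Qed.

Lemma model_h_vdot t z : model_h xi zeta t z = expR (vdot a b t z.1 z.2).
Proof. by rewrite -model_f_vdot. Qed.

Lemma criterion_crit n (w : nat -> TX * TY) t :
  criterion xi zeta n w t = crit a b n (fun i => (w i).1) (fun i => (w i).2) t.
Proof.
rewrite /criterion /crit; congr (_ * _ - _ * _); apply: eq_bigr => i _.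
  exact: model_f_vdot.
by apply: eq_bigr => j _; rewrite model_g_vdot.
Qed.

Lemma vdot_delta t (h c : R) i z :
  vdot a b (h *: (c *: delta_mx i 0) + t) z.1 z.2 =
  h * (c * (a i z.1 * b i z.2)) + vdot a b t z.1 z.2.
Proof.
rewrite vdotD !vdotZ; congr (h * (c * _) + _); rewrite /vdot (bigD1 i)//= mxE !eqxx mul1r.
by rewrite big1 ?addr0// => k ki; rewrite mxE (negbTE ki) mul0r.
Qed.

Let partial_vdot i t z : partial i (fun t => vdot a b t z.1 z.2) t = a i z.1 * b i z.2.
Proof.
apply: (derive_along (G := fun h => h * (a i z.1 * b i z.2) + vdot a b t z.1 z.2)).
  by move=> h; rewrite -[X in h *: X]scale1r vdot_delta mul1r.
rewrite (_ : (fun h : R => _) = (a i z.1 * b i z.2) *: (@id R) + cst (vdot a b t z.1 z.2)).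
  by apply: is_derive_eq; rewrite addr0 /GRing.scale /= mulr1.
by apply/funext => h; rewrite !fctE /GRing.scale /= mulrC.
Qed.

Let is_derive_expR_affine (c0 c1 : R) :
  is_derive (0 : R) (1 : R) (fun h : R => expR (h * c1 + c0)) (c1 * expR c0).
Proof.
rewrite (_ : (fun h : R => _) = expR \o (c1 *: (@id R) + cst c0)); last first.
  by apply/funext => h; rewrite !fctE /GRing.scale /= mulrC.
apply: is_derive_eq.
by rewrite /= !fctE /GRing.scale /= mulr0 add0r addr0 mulr1 mulrC.
Qed.

(** This shape is kept by differentiation: c = s = 1 is [model_g], and its partial derivatives have
    the same shape with s = 0, so two applications give the Hessian. *)
Let partial_exp (c s : R) i t z :
  partial i (fun t => c * expR (vdot a b t z.1 z.2) - s) t =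
  c * (a i z.1 * b i z.2) * expR (vdot a b t z.1 z.2).
Proof.
apply: (derive_along
  (G := fun h => c * expR (h * (a i z.1 * b i z.2) + vdot a b t z.1 z.2) - s)).
  by move=> h; rewrite -[X in h *: X]scale1r vdot_delta mul1r.
have D := is_derive_expR_affine (vdot a b t z.1 z.2) (a i z.1 * b i z.2).
rewrite (_ : (fun h : R => _) = c *: (fun h : R =>
   expR (h * (a i z.1 * b i z.2) + vdot a b t z.1 z.2)) - cst s)//.
by apply: is_derive_eq; rewrite subr0 -[LHS]/(c * _); ring.
Qed.

Lemma hessian_model_f t z : hessian (model_f xi zeta ^~ z) t = 0.
Proof.
apply/matrixP => i j; rewrite !mxE.
have -> : model_f xi zeta ^~ z = fun t => vdot a b t z.1 z.2.
  by apply/funext => s; exact: model_f_vdot.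
have -> : partial j (fun t => vdot a b t z.1 z.2) = cst (a j z.1 * b j z.2).
  by apply/funext => s; exact: partial_vdot.
exact: derive_cst.
Qed.

Lemma hessian_model_g z i j : hessian (model_g xi zeta ^~ z) 0 i j =
  (a i z.1 * b i z.2) * (a j z.1 * b j z.2).
Proof.
rewrite mxE.
have -> : model_g xi zeta ^~ z = fun t => 1 * expR (vdot a b t z.1 z.2) - 1.
  by apply/funext => s; rewrite mul1r; exact: model_g_vdot.
have -> : partial j (fun t => 1 * expR (vdot a b t z.1 z.2) - 1) =
    fun t => (a j z.1 * b j z.2) * expR (vdot a b t z.1 z.2) - 0.
  by apply/funext => s; rewrite partial_exp mul1r subr0.
rewrite partial_exp (_ : vdot a b 0 z.1 z.2 = 0) ?expR0 ?mulr1 1?mulrC//.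
by rewrite /vdot big1// => k _; rewrite mxE mul0r.
Qed.

(** [model_f] is linear in the parameter, so only the Hessian of [model_g] contributes. *)
Lemma Sigma1E P : Sigma1 xi zeta P 0 =
  \matrix_(i, j) \int[indep_law P]_z ((a i z.1 * b i z.2) * (a j z.1 * b j z.2)).
Proof.
rewrite /Sigma1 opprB; apply/matrixP => i j; rewrite !mxE.
rewrite [X in _ - X](_ : _ = 0); last first.
  under eq_Rintegral do rewrite hessian_model_f mxE.
  by rewrite Rintegral_cst// mul0r.
by rewrite subr0; apply: eq_Rintegral => z _; exact: hessian_model_g.
Qed.

(** Positions of x_k, y_k and z_k in the stacked vector, after its constant entry. *)
Let px (k : 'I_d) : 'I_(1 + (d + (d + d))) := rshift 1 (lshift (d + d) k).
Let py (k : 'I_d) : 'I_(1 + (d + (d + d))) := rshift 1 (rshift d (lshift d k)).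
Let pz (k : 'I_d) : 'I_(1 + (d + (d + d))) := rshift 1 (rshift d (rshift d k)).

Let psiE v k : psi v (rshift 1 k) 0 = v (px k) 0 * v (py k) 0 - v (pz k) 0 :> R.
Proof. by rewrite /psi col_mxEd !mxE. Qed.

Let psi0 v i : psi v (lshift d i) 0 = 0 :> R.
Proof. by rewrite /psi col_mxEu mxE. Qed.

Let jacobian_psi (mu : 'cV[R]_(1 + (d + (d + d)))) k j :
  jacobian_mx (@psi R d) mu (rshift 1 k) j =
  mu (py k) 0 * (px k == j)%:R + mu (px k) 0 * (py k == j)%:R - (pz k == j)%:R.
Proof.
rewrite mxE.
set x1 := (px k == j)%:R : R; set y1 := (py k == j)%:R : R; set z1 := (pz k == j)%:R : R.
set x := mu (px k) 0; set y := mu (py k) 0; set z := mu (pz k) 0.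
(* Along a coordinate direction the entry of [psi] is a quadratic polynomial in [h]; [B] is its
   linear coefficient. *)
pose B := y * x1 + x * y1 - z1.
apply: (derive_along (G := fun h => (x * y - z) + (h * B + (x1 * y1) * h ^+ 2))).
  by move=> h; rewrite psiE !mxE !andbT -/x -/y -/z -/x1 -/y1 -/z1 /B; ring.
have d1 : is_derive (0 : R) (1 : R) (fun h : R => h * B) B.
  rewrite (_ : (fun h => _) = B *: (@id R)).
    by apply: is_derive_eq; rewrite /GRing.scale /= mulr1.
  by apply/funext => h; rewrite fctE /GRing.scale /= mulrC.
have d2 : is_derive (0 : R) (1 : R) (fun h : R => x1 * y1 * h ^+ 2) 0.
  rewrite (_ : (fun h => _) = (x1 * y1) *: (@id R ^+ 2)).
    by apply: is_derive_eq; rewrite /GRing.scale /=; ring.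
  by apply/funext => h; rewrite !fctE.
have d0 : is_derive (0 : R) (1 : R) (fun=> x * y - z) 0 by exact: is_derive_cst.
have := is_deriveD d0 (is_deriveD d1 d2).
by rewrite add0r addr0.
Qed.

Let jacobian_psi0 (mu : 'cV[R]_(1 + (d + (d + d)))) i j :
  jacobian_mx (@psi R d) mu (lshift d i) j = 0.
Proof.
rewrite mxE (_ : (fun v => _) = cst 0) ?/partial ?derive_cst//.
by apply/funext => v; rewrite psi0.
Qed.

Let jacobian_psi_mul mu (u : 'cV[R]_(1 + (d + (d + d)))) k :
  (jacobian_mx (@psi R d) mu *m u) (rshift 1 k) 0 =
  mu (py k) 0 * u (px k) 0 + mu (px k) 0 * u (py k) 0 - u (pz k) 0.
Proof.
have pick p : \sum_j (p == j)%:R * u j 0 = u p 0.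
  by rewrite (bigD1 p)//= eqxx mul1r big1 ?addr0// => j jp; rewrite eq_sym (negbTE jp) mul0r.
rewrite mxE; under eq_bigr do rewrite jacobian_psi !mulrDl mulNr -!mulrA.
by rewrite !big_split /= sumrN -!mulr_sumr !pick.
Qed.

Section sandwich.
Context {d0} {T : measurableType d0} (Q : probability T R) {N K : nat}.
Variables (D : T -> 'cV[R]_N) (J : 'M[R]_(K, N)).
Hypothesis Dm : forall p, moments Q (fun w => D w p 0).

Lemma sandwich_Rintegral k l :
  (J *m (\matrix_(p, q) \int[Q]_w (D w *m (D w)^T) p q) *m J^T) k l =
  \int[Q]_w ((J *m D w) k 0 * (J *m D w) l 0).
Proof.
have E w : (J *m D w) k 0 * (J *m D w) l 0 =
    \sum_q \sum_p (J k p * J l q) * (D w p 0 * D w q 0).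
  rewrite !mxE mulrC mulr_suml; apply: eq_bigr => q _; rewrite mulr_sumr.
  by apply: eq_bigr => p _; ring.
under [RHS]eq_Rintegral do rewrite E.
have DDi p q : intg Q (fun w => D w p 0 * D w q 0).
  by apply: moments_intg; exact: momentsM.
rewrite Rintegral_sum; last by move=> q _; apply: intg_sum => p _; exact: intgZ.
rewrite mxE; apply: eq_bigr => q _; rewrite !mxE mulr_suml.
rewrite Rintegral_sum; last by move=> p _; exact: intgZ.
apply: eq_bigr => p _; rewrite RintegralZl// mxE mulrAC; congr (_ * _).
by apply: eq_Rintegral => w _; rewrite mxE big_ord1 mxE.
Qed.

End sandwich.

Section covariance.
Variables (P1 : probability TX R) (P2 : probability TY R) (P : probability (TX * TY)%type R).
Hypothesis PE : forall A, measurable A -> P A = (P1 \x P2)%E A.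
Hypotheses (am : forall i, moments P1 (a i)) (bm : forall i, moments P2 (b i)).

Lemma Sigma2E : Sigma2 xi zeta P = centered_product_cov P1 P2 P a b.
Proof.
have xim k : moments P1 (xi k).
  by have := am (rshift 1 k); congr moments; apply/funext => x; exact: with_interceptS.
have zetam k : moments P2 (zeta k).
  by have := bm (rshift 1 k); congr moments; apply/funext => y; exact: with_interceptS.
have Vx z k : statV xi zeta z (px k) 0 = xi k z.1.
  by rewrite /statV col_mxEd col_mxEu mxE.
have Vy z k : statV xi zeta z (py k) 0 = zeta k z.2.
  by rewrite /statV !col_mxEd col_mxEu mxE.
have Vz z k : statV xi zeta z (pz k) 0 = xi k z.1 * zeta k z.2.
  by rewrite /statV !col_mxEd mxE.
have Vm p : moments P (fun z => statV xi zeta z p 0).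
  case: (split_ordP p) => q ->.
    have := moments_cst P 1; congr moments; apply/funext => z.
    by rewrite /statV col_mxEu mxE (ord1 q).
  case: (split_ordP q) => k ->.
    have := moments_fst PE (xim k); congr moments; apply/funext => z.
    by rewrite -Vx.
  case: (split_ordP k) => l ->.
    have := moments_snd PE (zetam l); congr moments; apply/funext => z.
    by rewrite -Vy.
  have := momentsM (moments_fst PE (xim l)) (moments_snd PE (zetam l)).
  by congr moments; apply/funext => z; rewrite -Vz.
have mux k : mean_V xi zeta P (px k) 0 = \int[P1]_x xi k x.
  rewrite mxE; under eq_Rintegral do rewrite Vx.
  by apply: (Rintegral_fst PE); exact: moments_intg.
have muy k : mean_V xi zeta P (py k) 0 = \int[P2]_y zeta k y.
  rewrite mxE; under eq_Rintegral do rewrite Vy.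
  by apply: (Rintegral_snd PE); exact: moments_intg.
have muz k : mean_V xi zeta P (pz k) 0 = (\int[P1]_x xi k x) * \int[P2]_y zeta k y.
  rewrite mxE; under eq_Rintegral do rewrite Vz.
  by apply: (Rintegral_fstsnd PE); exact: moments_intg.
(* Linearizing E xi E zeta - E (xi zeta) gives, up to sign, the product of the centered variables,
   by independence in [muz]. The sign disappears in the covariance, and the intercept row is 0 on
   both sides. *)
have JV z i : (jacobian_mx (@psi R d) (mean_V xi zeta P) *m
    (statV xi zeta z - mean_V xi zeta P)) i 0 = - centered_product P1 P2 a b i z.
  case: (split_ordP i) => k ->.
    rewrite mxE big1; last by move=> j _; rewrite jacobian_psi0 mul0r.
    rewrite /centered_product with_intercept0.
    under eq_Rintegral do rewrite with_intercept0.
    by rewrite Rintegral_prob_cst subrr mul0r oppr0.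
  have subE p : (statV xi zeta z - mean_V xi zeta P) p 0 =
    statV xi zeta z p 0 - mean_V xi zeta P p 0 by rewrite mxE [X in _ + X]mxE.
  rewrite jacobian_psi_mul !subE Vx Vy Vz mux muy muz /centered_product !with_interceptS.
  under [in RHS]eq_Rintegral do rewrite with_interceptS.
  under [X in _ = - (_ * (_ - X))]eq_Rintegral do rewrite with_interceptS.
  by ring.
apply/matrixP => i j; rewrite /Sigma2 /Sigma_V sandwich_Rintegral; last first.
  move=> p; have := momentsB (Vm p) (moments_cst P (mean_V xi zeta P p 0)).
  by congr moments; apply/funext => z; rewrite [RHS]mxE [X in _ = _ + X]mxE.
by rewrite mxE; apply: eq_Rintegral => z _; rewrite !JV mulrNN.
Qed.

End covariance.
End affine_model.

(** * From real integrals to the theorem *)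

Lemma cvg_in_distribution_Rintegral {R : realType} {V : topologicalType}
    {d} {T : measurableType d} (P : probability T R) (U : nat -> T -> V)
    {d'} {T' : measurableType d'} (P' : probability T' R) (Z : T' -> V) :
  (forall (g : V -> R) (M : R), continuous g -> (forall v, `|g v| <= M) ->
    [/\ \forall n \near \oo, measurable_fun [set: T] (fun w => g (U n w)),
        measurable_fun [set: T'] (fun w => g (Z w)) &
        \int[P]_w g (U n w) @[n --> \oo] --> \int[P']_w g (Z w)]) ->
  cvg_in_distribution P U P' Z.
Proof.
move=> H g cg [M gM]; have [mU mZ UZ] := H g M cg gM.
have fin d0 (T0 : measurableType d0) (Q : probability T0 R) (W : T0 -> V) :
    measurable_fun [set: T0] (fun w => g (W w)) ->
    ('E_Q[g \o W])%E = (\int[Q]_w g (W w))%:E.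
  move=> mW; rewrite unlock /Rintegral fineK//; apply: integrable_fin_num => //.
  exact: (@intg_bounded _ _ _ _ _ M).
rewrite (fin _ _ P' Z mZ).
(* Measurability is available only for large n: the estimator is unconstrained for the empty
   sample. *)
have EU : \forall n \near \oo, ('E_P[g \o U n])%E = (\int[P]_w g (U n w))%:E.
  by apply: filterS mU => n; exact: fin.
apply: cvg_EFin; first by apply: filterS EU => n ->.
apply: cvg_trans UZ; apply: near_eq_cvg.
by apply: filterS EU => n /= ->.
Qed.

Section exponential_moments_of_model.
Context {R : realType} {d} {T : measurableType d} (Q : probability T R) {m : nat}.
Variables (v : 'I_m -> T -> R) (Theta : set 'cV[R]_m) (r : R).
Hypothesis mv : forall k, measurable_fun [set: T] (v k).
Hypothesis Theta_box : forall t : 'cV[R]_m, (forall k, `|t k 0| <= r) -> Theta t.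
Hypothesis r0 : 0 < r.
Hypothesis sup_fin : (\int[Q]_z ereal_sup
  [set ((expR (\sum_k t k 0 * v k z) - 1) ^+ 2)%:E | t in Theta] < +oo)%E.

(** The supremum is bounded below by its value at the parameter s e_k, which lies in the box. For
    the exponential y itself, y <= 2 + (y - 1)^2. *)
Lemma intg_expR_of_sup (s : R) k : `|s| <= r -> intg Q (fun z => expR (s * v k z)).
Proof.
move=> sr; have mexp : measurable_fun [set: T] (fun z => expR (s * v k z)).
  by apply: measurableT_comp => //; exact: measurable_funM.
have sq : intg Q (fun z => (expR (s * v k z) - 1) ^+ 2).
  apply: ge0_intg; [|by move=> z; exact: sqr_ge0|].
    by apply: measurable_funX; exact: measurable_funB.
  apply: le_lt_trans sup_fin; apply: nneg_le_integral => z.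
    by rewrite lee_fin sqr_ge0.
  apply: ereal_sup_ubound => /=; exists (s *: delta_mx k 0).
    apply: Theta_box => i; rewrite !mxE andbT normrM; case: (i == k); rewrite ?normr1 ?mulr1//.
    by rewrite normr0 mulr0 ltW.
  congr (((expR _ - 1) ^+ 2)%:E); rewrite (bigD1 k)//= !mxE !eqxx mulr1 big1 ?addr0// => i ik.
  by rewrite !mxE (negbTE ik) mulr0 mul0r.
apply: (@intg_le _ _ _ Q _ (fun z => 2 + (expR (s * v k z) - 1) ^+ 2)) => //.
  by apply: intgD => //; exact: intg_cst.
move=> z; rewrite ger0_norm ?expR_ge0//; set y := expR _.
by have := sqr_ge0 (y - 3 / 2); lra.
Qed.

End exponential_moments_of_model.

Lemma second_moments_psd {R : realType} {d} {T : measurableType d} (Q : probability T R)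
    m (v : 'I_m -> T -> R) : (forall i, moments Q (v i)) ->
  psdmx (\matrix_(i, j) \int[Q]_z (v i z * v j z)).
Proof.
move=> vm; split; first by apply/matrixP => i j; rewrite !mxE; apply: eq_Rintegral => z _;
  rewrite mulrC.
move=> u; pose D z : 'cV[R]_m := \col_i v i z.
have -> : \matrix_(i, j) \int[Q]_z (v i z * v j z) =
    \matrix_(p, q) \int[Q]_z (D z *m (D z)^T) p q.
  apply/matrixP => i j; rewrite !mxE; apply: eq_Rintegral => z _.
  by rewrite mxE big_ord1 !mxE.
rewrite -[X in _ *m X](trmxK u) sandwich_Rintegral; last first.
  by move=> p; have := vm p; congr moments; apply/funext => z; rewrite mxE.
by apply: Rintegral_ge0 => z _; rewrite -expr2 sqr_ge0.
Qed.

Theorem theorem3p3 (R : realType) (d : nat)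
  (dX dY : measure_display)
  (TX : measurableType dX) (TY : measurableType dY)
  (xi : 'I_d -> {mfun TX >-> R}) (zeta : 'I_d -> {mfun TY >-> R})
  (Theta : set 'cV[R]_(1 + d))
  (P : probability (TX * TY)%type R)
  (thetaT : 'cV[R]_(1 + d))
  (dO : measure_display) (Omega : measurableType dO) (Pr : probability Omega R)
  (X : nat -> Omega -> TX) (Y : nat -> Omega -> TY)
  (theta_hat : nat -> Omega -> 'cV[R]_(1 + d)) :
  let h := model_h xi zeta in
  let f := model_f xi zeta in
  let g := model_g xi zeta in
  let Pperp := indep_law P in
  let M n w := criterion xi zeta n (fun i => (X i w, Y i w)) in
  let I_hat n w := sup [set M n w t | t in Theta] in
  let S1 := Sigma1 xi zeta P thetaT in
  let S2 := Sigma2 xi zeta P in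
  (* P belongs to the model, with parameter thetaT *)
  Theta° thetaT ->
  has_density P Pperp (h thetaT) ->
  (forall t, Theta t -> has_density P Pperp (h t) -> t = thetaT) ->
  (* the sample and the estimator *)
  iid Pr (fun i w => (X i w, Y i w)) P ->
  (forall n, (0 < n)%N ->
    random_vector (theta_hat n) /\
    forall w, Theta (theta_hat n w) /\
      forall t, Theta t -> M n w t <= M n w (theta_hat n w)) ->
  (* independence *)
  (forall A, measurable A -> P A = Pperp A) ->
  (* (i) *)
  (forall t t', Theta t -> Theta t' ->
    (forall x y, h t (x, y) = h t' (x, y)) -> t = t') ->
  (* (ii) *)
  Theta° 0 ->
  (forall t, Theta t -> (forall x y, h t (x, y) = 1) -> t = 0) ->
  (* (iii) *)
  compact Theta ->
  (* (iv) *)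
  (\int[P]_z ereal_sup [set `|f t z|%:E | t in Theta] < +oo)%E ->
  (* (v) *)
  (\int[Pperp]_z ereal_sup [set ((g t z) ^+ 2)%:E | t in Theta] < +oo)%E ->
  (* (vi) *)
  (exists2 N, nbhs thetaT N & forall i j k : 'I_(1 + d),
    (exists2 F : TX * TY -> R, P.-integrable [set: TX * TY] (EFin \o F) &
      forall t z, N t ->
        `|partial i (partial j (partial k (f^~ z))) t| <= F z) /\
    (exists G : TX * TY -> R, [/\ measurable_fun [set: TX * TY] G,
      Pperp.-integrable [set: TX * TY] (fun z => ((G z) ^+ 2)%:E) &
      forall t z, N t ->
        `|partial i (partial j (partial k (g^~ z))) t| <= G z])) ->
  (* (vii) *)
  P.-integrable [set: TX * TY]
    (fun z => (frobenius (gradient (f^~ z) thetaT) ^+ 2)%:E) ->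
  Pperp.-integrable [set: TX * TY]
    (fun z => (frobenius (gradient (g^~ z) thetaT) ^+ 2)%:E) ->
  P.-integrable [set: TX * TY]
    (fun z => (frobenius (hessian (f^~ z) thetaT))%:E) ->
  Pperp.-integrable [set: TX * TY]
    (fun z => (frobenius (hessian (g^~ z) thetaT) ^+ 2)%:E) ->
  S1 \in unitmx ->
  (exists (d' : measure_display) (T' : measurableType d')
      (P' : probability T' R) (Z : T' -> 'cV[R]_(1 + d)),
    multivariate_normal P' Z 0 (invmx S1 *m S2 *m invmx S1) /\
    cvg_in_distribution Pr (fun n w => Num.sqrt n%:R *: theta_hat n w) P' Z) /\
  (exists (d' : measure_display) (T' : measurableType d')
      (P' : probability T' R) (Z : T' -> 'cV[R]_(1 + d)),
    multivariate_normal P' Z 0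
      (invmx (sqrtmx S1) *m S2 *m invmx (sqrtmx S1)) /\
    cvg_in_distribution Pr (fun n w => 2 * n%:R * I_hat n w)
      P' (fun w => ((Z w)^T *m Z w) 0 0)).
Proof.
move=> h f g Pperp M I_hat S1 S2 _ _ uniqT iidXY thatP PE _ Theta0 _ _ _ supg _ _ _ _ _.
set P1 : probability TX R := distribution P (@fst TX TY).
set P2 : probability TY R := distribution P (@snd TX TY).
pose a := with_intercept (fun k => xi k : TX -> R).
pose b := with_intercept (fun k => zeta k : TY -> R).
pose v i (z : TX * TY) := a i z.1 * b i z.2.
have PE' A : measurable A -> P A = (P1 \x P2)%E A by exact: PE.
have intE (F : TX * TY -> \bar R) : (\int[Pperp]_z F z = \int[(P1 \x P2)%E]_z F z)%E.
  by apply: eq_measure_integral.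
have intPE (F : TX * TY -> \bar R) : (\int[P]_z F z = \int[(P1 \x P2)%E]_z F z)%E.
  by apply: eq_measure_integral => A mA _; exact: PE'.
have ma := measurable_with_intercept xi; have mb := measurable_with_intercept zeta.
have mv i : measurable_fun [set: TX * TY] (v i).
  apply: measurable_funM; first exact: measurableT_comp (ma i) measurable_fst.
  exact: measurableT_comp (mb i) measurable_snd.
have [r r0 Theta_box] : exists2 r : R, 0 < r &
    forall t : 'cV[R]_(1 + d), (forall k, `|t k 0| <= r) -> Theta t.
  have /nbhs_ballP[r /= r0 rT] := Theta0.
  exists (r / 2); first by rewrite divr_gt0.
  move=> t tr; apply: rT; split => // i j; rewrite (ord1 j) /ball /= mxE sub0r normrN.
  by rewrite (le_lt_trans (tr i))// ltr_pdivrMr// ltr_pMr// ltr1n.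
(* Under independence the parameter 0 also gives the density of [P], so uniqueness applies. *)
have thetaT0 : thetaT = 0.
  apply/esym/uniqT; first exact: interior_subset Theta0.
  move=> A mA; apply: (etrans (PE A mA)).
  have -> : (\int[Pperp]_(z in A) (h 0 z)%:E = \int[Pperp]_(z in A) (cst 1%E) z)%E.
    apply: eq_integral => z _; rewrite /h model_h_vdot /vdot big1 ?expR0// => k _.
    by rewrite mxE mul0r.
  by rewrite integral_cst// mul1e.
have intg_exp (s : R) k : `|s| <= r -> intg (P1 \x P2)%E (fun z => expR (s * v k z)).
  apply: (intg_expR_of_sup mv Theta_box r0); rewrite -intE; apply: le_lt_trans supg.
  rewrite le_eqVlt; apply/orP; left; apply/eqP; apply: eq_integral => z _.
  congr (ereal_sup _); apply/seteqP.
  by split=> y [t Tt <-]; exists t => //; rewrite /g model_g_vdot.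
have vm k : moments (P1 \x P2)%E (v k).
  apply: (moments_expR (mv k) r0); apply: intg_exp; rewrite ?normrN gtr0_norm//.
have S1E : S1 = \matrix_(i, j) \int[(P1 \x P2)%E]_z (v i z * v j z).
  rewrite /S1 thetaT0 Sigma1E; apply/matrixP => i j; rewrite !mxE /Rintegral.
  by rewrite intE.
move=> S1u.
have S1psd : psdmx S1 by rewrite S1E; exact: second_moments_psd.
have [c c0 S1c] := psd_unit_coercive S1psd S1u.
(* Coercivity of [S1] at the k-th basis vector makes the second moment of a_k b_k positive, as
   [moments_factors] requires. *)
have factors k : moments P1 (a k) /\ moments P2 (b k).
  apply: (moments_factors (ma k) (mb k) (vm k)).
  have := S1c (delta_mx k 0) k; rewrite (quad_delta_mx _ erefl) S1E 2!mxE !eqxx expr1n mulr1.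
  by move=> ck; rewrite gt_eqF// (lt_le_trans c0).
have am k : moments P1 (a k) by have [] := factors k.
have bm k : moments P2 (b k) by have [] := factors k.
have S1E' : S1 = product_second_moments P1 P2 a b.
  rewrite S1E; apply/matrixP => i j; rewrite !mxE.
  rewrite -(Rintegral_prodM (moments_intg (momentsM (am i) (am j)))
    (moments_intg (momentsM (bm i) (bm j)))).
  by apply: eq_Rintegral => z _; rewrite /v; ring.
have S2E : S2 = centered_product_cov P1 P2 P a b by exact: Sigma2E.
have S2psd : psdmx S2 by rewrite S2E; exact: (centered_product_cov_psd PE' am bm).
have abi k : intg P (fun z => expR (r * `|a k z.1 * b k z.2|)).
  have h1 : intg (P1 \x P2)%E (fun z => expR (r * `|v k z|)).
    by apply: intg_expR_norm => //; apply: intg_exp; rewrite ?normrN gtr0_norm.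
  apply: ge0_intg => [||]; first by have /integrableP[/measurable_EFinP] := h1.
    by move=> z; exact: expR_ge0.
  rewrite intPE; have /integrableP[_] := h1; apply: le_lt_trans.
  by apply: nneg_le_integral => z; rewrite lee_fin ?expR_ge0//= ler_norm.
have mthat n : (0 < n)%N -> random_vector (theta_hat n) by move=> /thatP[].
have thatP' n w t : (0 < n)%N -> Theta t ->
    crit a b n (X ^~ w) (Y ^~ w) t <= crit a b n (X ^~ w) (Y ^~ w) (theta_hat n w).
  move=> /thatP[_ /(_ w)[_ +]] Tt => /(_ t Tt).
  by rewrite /M !criterion_crit.
have i0 : 'I_(1 + d) := ord0.
have S1psd' : psdmx (product_second_moments P1 P2 a b) by rewrite -S1E'.
have S1u' : product_second_moments P1 P2 a b \in unitmx by rewrite -S1E'.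
have Spsym : (invmx S1)^T = invmx S1 by rewrite trmx_inv S1psd.1.
have [d' [T' [P' [Z NZ]]]] := normal_exists S2psd.
have NZ' : multivariate_normal P' Z 0 (centered_product_cov P1 P2 P a b) by rewrite -S2E.
split.
  exists d', T', P', (fun w => invmx S1 *m Z w); split.
    by have := multivariate_normal_mulmx (invmx S1) NZ; rewrite Spsym.
  apply: cvg_in_distribution_Rintegral => G B cG GB; split.
  - near=> n; have n0 : (0 < n)%N by near: n; exact: nbhs_infty_gt.
    suff mt : random_vector (fun w => Num.sqrt n%:R *: theta_hat n w).
      exact (measurable_continuous_bounded mt cG GB).
    move=> k; under eq_fun do rewrite mxE.
    by apply: measurable_funM => //; exact: mthat.
  - suff mt : random_vector (fun w => invmx S1 *m Z w).
      exact (measurable_continuous_bounded mt cG GB).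
    by have [] := multivariate_normal_mulmx (invmx S1) NZ.
  - rewrite S1E'.
    exact: (cvg_argmax PE' iidXY am bm i0 r0 abi S1psd' S1u' r0 Theta_box mthat thatP' NZ' cG GB).
(* The limit of the maximum is Z^T S1^-1 Z with Z of covariance [S2]. Writing S1^-1 as the square of
   the symmetric Q^-1 turns it into the squared length of Q^-1 Z. *)
have [[Rsym Rpsd] RR] := sqrtmxP S1psd.
set Q := sqrtmx S1 in Rsym Rpsd RR *.
have Qu : Q \in unitmx by move: S1u; rewrite -RR unitmx_mul => /andP[].
have Qsym : (invmx Q)^T = invmx Q by rewrite trmx_inv Rsym.
have QQ : invmx Q *m invmx Q = invmx S1.
  have h1 : invmx Q *m invmx Q *m S1 = 1%:M by rewrite -RR mulmxA mulmxKV// mulVmx.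
  by rewrite -[LHS](mulmxK S1u) h1 mul1mx.
(* The supremum is attained at [theta_hat], hence bounded and equal to the value there. *)
have I_hatE n w : (0 < n)%N -> I_hat n w = crit a b n (X ^~ w) (Y ^~ w) (theta_hat n w).
  move=> n0; have [_ /(_ w)[Tt maxt]] := thatP n n0.
  rewrite -[RHS]/(crit a b n (fun i => (X i w, Y i w).1) (fun i => (X i w, Y i w).2) _).
  rewrite -criterion_crit; apply/eqP; rewrite eq_le; apply/andP; split.
    apply: ge_sup; first by exists (M n w (theta_hat n w)), (theta_hat n w).
    by move=> _ [t Tt' <-]; exact: maxt.
  apply: ub_le_sup; last by exists (theta_hat n w).
  by exists (M n w (theta_hat n w)) => _ [t Tt' <-]; exact: maxt.
exists d', T', P', (fun w => invmx Q *m Z w); split.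
  by have := multivariate_normal_mulmx (invmx Q) NZ; rewrite Qsym.
have ZZ w : ((invmx Q *m Z w)^T *m (invmx Q *m Z w)) 0 0 = ((Z w)^T *m invmx S1 *m Z w) 0 0.
  by rewrite trmx_mul Qsym !mulmxA -(mulmxA _ (invmx Q) (invmx Q)) QQ.
apply: cvg_in_distribution_Rintegral => G B cG GB; split.
- near=> n; have n0 : (0 < n)%N by near: n; exact: nbhs_infty_gt.
  under eq_fun do rewrite I_hatE//.
  apply: measurableT_comp; first exact: continuous_measurable_fun.
  by apply: measurable_funM => //; apply: (measurable_crit iidXY am bm); exact: mthat.
- under eq_fun do rewrite ZZ.
  apply: measurableT_comp; first exact: continuous_measurable_fun.
  have [mZ _ _] := NZ.
  under eq_fun do rewrite -mulmxA mxE.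
  apply: measurable_sum => k; apply: measurable_funM.
    by under eq_fun do rewrite mxE; exact: mZ.
  by have [+ _ _] := multivariate_normal_mulmx (invmx S1) NZ; apply.
- under [X in _ --> X]eq_Rintegral do rewrite ZZ S1E'.
  have := cvg_max PE' iidXY am bm i0 r0 abi S1psd' S1u' r0 Theta_box mthat thatP' NZ' cG GB.
  apply: cvg_trans; apply: near_eq_cvg; near=> n.
  have n0 : (0 < n)%N by near: n; exact: nbhs_infty_gt.
  by apply: eq_Rintegral => w _; rewrite I_hatE.
Unshelve. all: by end_near.
Qed.
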